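(* In the weighted Indian buffet model described in the context, let $\beta\in[0,1)$ and $B\in\mathcal{B}$, and let $L_n(B)=\mathrm{card}(B\cap S_n)$. If $\overline{R}_n:=\frac1n\sum_{i=1}^nR_i\to r$ almost surely for some constant $r$, then \[ \frac{L_n(B)}{a_n(\beta)}\longrightarrow m(B)\lambda(\beta)\quad\text{a.s.} \] Moreover, if in addition $\frac{\sum_{j=1}^n j^{\beta-1}E|\overline{R}_j-r|}{\sqrt{a_n(\beta)}}\to0$, then \[ \sqrt{a_n(\beta)}\Bigl\{\frac{L_n(B)}{a_n(\beta)}-m(B)\lambda(\beta)\Bigr\}\longrightarrow\mathcal{N}\bigl(0,m(B)\lambda(\beta)\bigr)\quad\text{stably}. \] Here $a_n(\beta)=\log n$ and $\lambda(\beta)=\alpha c/r$ if $\beta=0$, while $a_n(\beta)=n^\beta$ and $\lambda(\beta)=\frac{\alpha\Gamma(c+1)}{\Gamma(c+\beta)}\frac{1}{\beta r^{1-\beta}}$ if $\beta\in(0,1)$.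
   Context: Let $\mathcal{X}$ be a separable metric space with Borel $\sigma$-field $\mathcal{B}$, and let $\mathcal{M}$ be the set of finite positive measures on $\mathcal{B}$; $\mu\in\mathcal{M}$ is diffuse if $\mu\{x\}=0$ for all $x$. All random quantities live on a probability space $(\Omega,\mathcal{A},P)$. A random measure (r.m.) is a map $M:\Omega\to\mathcal{M}$ such that $\omega\mapsto M(\omega)(B)$ is measurable for each $B\in\mathcal{B}$. A Poisson r.m. with intensity $\nu\in\mathcal{M}$ is an r.m. $M$ with $M(B_1),\dots,M(B_k)$ independent for pairwise disjoint $B_j$ and $M(B)\sim\mathrm{Poi}(\nu(B))$ for all $B$ (with $\mathrm{Poi}(0)=\delta_0$). Each $\nu\in\mathcal{M}$ is uniquely $\nu=\nu_c+\nu_d$, $\nu_c$ diffuse, $\nu_d=\sum_j\gamma_j\delta_{x_j}$. $M\sim\mathrm{BeP}(\nu)$ (Bernoulli r.m. with hazard measure $\nu$) means $M=M_1+M_2$ with $M_1,M_2$ independent, $M_1$ Poisson with intensity $\nu_c$, $M_2=\sum_jV_j\delta_{x_j}$ with independent indicators $V_j$, $P(V_j=1)=\gamma_j$. ''$X\mid\mathcal{G}\sim Y\mid\mathcal{G}$'' means $P(X\in A\mid\mathcal{G})=P(Y\in A\mid\mathcal{G})$ a.s. for all measurable $A$. Model: fix a diffuse probability measure $m$ on $\mathcal{B}$ and reals $\alpha>0$, $\beta<1$, $c>-\beta$. $(M_n)_{n\ge1}$ are r.m.'s and $(R_n)_{n\ge1}$ real random variables such that for each $n\ge1$, $R_n$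 is independent of $(M_1,\dots,M_n,R_1,\dots,R_{n-1})$ and $R_n\ge u$ for a constant $u>\max(\beta,0)$; and $M_{n+1}\mid\mathcal{F}_n\sim\mathrm{BeP}(\nu_n)$ for all $n\ge0$, where $\mathcal{F}_0=\{\varnothing,\Omega\}$, $\mathcal{F}_n=\sigma(M_1,\dots,M_n,R_1,\dots,R_n)$, $S_n=\{x: M_i\{x\}=1\text{ for some } i\le n\}$, $\nu_0=\alpha m$ and for $n\ge1$ \[ \nu_n=\sum_{x\in S_n}\frac{\sum_{i=1}^nR_iM_i\{x\}-\beta}{\sum_{i=1}^nR_i+c}\,\delta_x+\Lambda_n\, m,\qquad \Lambda_0=\alpha,\ \ \Lambda_n=\alpha\frac{\Gamma(c+1)\Gamma(c+\beta+\sum_{i=1}^nR_i)}{\Gamma(c+\beta)\Gamma(c+1+\sum_{i=1}^nR_i)}. \] Stable convergence: a kernel is an r.m. $K$ with $K(\omega)(\mathbb{R})=1$ for all $\omega$. Real random variables $X_n$ converge stably to $K$ if $E\{K(f)\mid H\}=\lim_nE\{f(X_n)\mid H\}$ for all $H\in\mathcal{A}$ with $P(H)>0$ and all bounded continuous $f$. $\mathcal{N}(0,a)$ is the Gaussian law with mean $0$ and variance $a\ge0$ ($\mathcal N(0,0)=\delta_0$), viewed as a constant kernel. *)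

(* Defs.v *)
From HB Require Import structures.
From mathcomp Require Import all_boot all_order all_algebra.
From mathcomp Require Import all_classical all_reals all_analysis.
From mathcomp Require Import measurable_realfun normal_distribution.

Set Implicit Arguments.
Unset Strict Implicit.
Unset Printing Implicit Defensive.

Import Order.TTheory GRing.Theory Num.Def Num.Theory.
Import numFieldTopology.Exports.

Local Open Scope classical_set_scope.
Local Open Scope ring_scope.

Section IBP_defs.
Context {R : realType}.

Definition metric_open {X : Type} (dist : X -> X -> R) (O : set X) : Prop :=
  forall x, O x -> exists2 e : R, 0 < e & [set y | dist x y < e] `<=` O.

Definition separable_metric_Borel {d} (X : measurableType d)
    (dist : X -> X -> R) : Prop :=
  [/\ (forall x y, dist x y = 0 <-> x = y),
      (forall x y, dist x y = dist y x),
      (forall x y z, dist x z <= dist x y + dist y z),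
      (exists2 D : set X, countable D &
         forall x e, 0 < e -> exists2 y, D y & dist x y < e)
    & (@measurable d X = <<s metric_open dist >>)].

Definition Meas {d} (X : measurableType d) :=
  {finite_measure set X -> \bar R}.

Definition diffuse {d} {X : measurableType d} (mu : set X -> \bar R) :=
  forall x : X, mu [set x] = 0%E.

Definition sigma_gen {dO} {Omega : measurableType dO}
    (fs : set (Omega -> \bar R)) : set (set Omega) :=
  <<s [set A | exists2 f, fs f &
          exists2 E : set (\bar R), measurable E & A = f @^-1` E] >>.

Definition measurable_wrt {dO} {Omega : measurableType dO}
    (G : set (set Omega)) (f : Omega -> \bar R) : Prop :=
  forall E : set (\bar R), measurable E -> G (f @^-1` E).

Definition indep_sigma {dO} {Omega : measurableType dO}
    (P : probability Omega R) (F G : set (set Omega)) : Prop :=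
  forall A B, F A -> G B -> P (A `&` B) = (P A * P B)%E.

Definition mutual_indep {dO} {Omega : measurableType dO} {I : eqType}
    (P : probability Omega R) (D : set I) (F : I -> set (set Omega)) : Prop :=
  forall (s : seq I) (A : I -> set Omega), uniq s ->
    (forall i, i \in s -> D i /\ F i (A i)) ->
    P (\bigcap_(i in [set j | j \in s]) A i) = (\prod_(i <- s) P (A i))%E.

Definition random_measure {dO d} {Omega : measurableType dO}
    {X : measurableType d} (M : Omega -> Meas X) : Prop :=
  forall B, measurable B -> measurable_fun setT (fun w => M w B).

Definition sigma_rm {dO d} {Omega : measurableType dO}
    {X : measurableType d} (M : Omega -> set X -> \bar R) : set (set Omega) :=
  sigma_gen [set f | exists2 B, measurable B & f = (fun w => M w B)].

(* Poisson law: Poi(l){k} = e^-l l^k / k!  (so Poi(0) = delta_0) *)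
Definition poi (l : R) (k : nat) : R := expR (- l) * l ^+ k / k`!%:R.

Definition poisson_rm {dO d} {Omega : measurableType dO}
    {X : measurableType d} (P : probability Omega R) (M : Omega -> Meas X)
    (nu : set X -> \bar R) : Prop :=
  [/\ random_measure M,
      (forall B, measurable B -> forall k : nat,
         P [set w | M w B = (k%:R)%:E] = (poi (fine (nu B)) k)%:E)
    & (forall (k : nat) (B : 'I_k -> set X),
         (forall j, measurable (B j)) ->
         (forall i j, i != j -> B i `&` B j = set0) ->
         mutual_indep P setT
           (fun j => sigma_gen [set (fun w => M w (B j))]))].

Definition atoms {d} {X : measurableType d} (nu : set X -> \bar R) : set X :=
  [set x | (0 < nu [set x])%E].

Definition nu_d {d} {X : measurableType d} (nu : set X -> \bar R)
  (B : set X) : \bar R := (\esum_(x in B `&` atoms nu) nu [set x])%E.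

Definition nu_c {d} {X : measurableType d} (nu : set X -> \bar R)
  (B : set X) : \bar R := (nu B - nu_d nu B)%E.

(* N ~ BeP(nu) on the probability space (Omega, P):
   N = M1 + M2, M1 Poisson with intensity nu_c, M2 = sum_j V_j delta_{x_j}
   (x_j the atoms of nu), V_j independent indicators, P(V_j = 1) = nu{x_j},
   M1 and M2 independent. *)
Definition is_BeP {dO d} {Omega : measurableType dO} {X : measurableType d}
    (P : probability Omega R) (N : Omega -> Meas X) (nu : set X -> \bar R)
    : Prop :=
  random_measure N /\
  exists (M1 : Omega -> Meas X) (V : X -> Omega -> \bar R),
    let M2 := fun w (B : set X) => (\esum_(x in B `&` atoms nu) V x w)%E in
    [/\ poisson_rm P M1 (nu_c nu),
        (forall x, atoms nu x ->
           [/\ measurable_fun setT (V x),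
               (forall w, V x w = 0%E \/ V x w = 1%E)
             & P (V x @^-1` [set 1%E]) = nu [set x]]),
        mutual_indep P (atoms nu) (fun x => sigma_gen [set V x]),
        indep_sigma P (sigma_rm (fun w B => M1 w B)) (sigma_rm M2)
      & (forall w B, measurable B -> N w B = (M1 w B + M2 w B)%E)].

Definition meas_sigma {d} {X : measurableType d} : set (set (Meas X)) :=
  <<s [set A | exists2 B : set X, measurable B &
         exists2 E : set (\bar R), measurable E &
           A = [set mu : Meas X | E (mu B)]] >>.

Definition BeP_law {d} {X : measurableType d} (nu : set X -> \bar R)
    (Q : set (Meas X) -> \bar R) : Prop :=
  exists (dO' : measure_display) (Omega' : measurableType dO')
         (P' : probability Omega' R) (N : Omega' -> Meas X),
    is_BeP P' N nu /\ forall A, meas_sigma A -> Q A = P' (N @^-1` A).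

(* Mn | G ~ BeP(nu) : a G-measurable version of P(Mn in A | G) is
   BeP(nu(w))(A) *)
Definition cond_BeP {dO d} {Omega : measurableType dO} {X : measurableType d}
    (P : probability Omega R) (G : set (set Omega)) (Mn : Omega -> Meas X)
    (nu : Omega -> set X -> \bar R) : Prop :=
  exists Q : Omega -> set (Meas X) -> \bar R,
    (forall w, BeP_law (nu w) (Q w)) /\
    forall A, meas_sigma A ->
      measurable_wrt G (fun w => Q w A) /\
      forall H, G H ->
        P (Mn @^-1` A `&` H) = (\int[P]_(w in H) Q w A)%E.

Definition Gamma (x : R) : R :=
  fine (\int[lebesgue_measure]_(t in [set t : R | (0 < t)%R])
          (powR t (x - 1) * expR (- t))%:E)%E.

Section model.
Context {dO d} {Omega : measurableType dO} {X : measurableType d}.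
Variables (m : probability X R) (alpha beta c : R).
Variables (M : nat -> Omega -> Meas X) (Rv : nat -> Omega -> R).
(* indices start at 1: M 1, M 2, ... and Rv 1, Rv 2, ... *)

Definition F_ (n : nat) : set (set Omega) :=
  sigma_gen ([set f | exists i B, [/\ (1 <= i <= n)%N, measurable B &
                         f = (fun w => M i w B)]] `|`
             [set f | exists2 i, (1 <= i <= n)%N &
                         f = (fun w => (Rv i w)%:E)]).

Definition G_ (n : nat) : set (set Omega) :=
  sigma_gen ([set f | exists i B, [/\ (1 <= i <= n)%N, measurable B &
                         f = (fun w => M i w B)]] `|`
             [set f | exists2 i, (1 <= i < n)%N &
                         f = (fun w => (Rv i w)%:E)]).

Definition sumR (n : nat) (w : Omega) : R := \sum_(1 <= i < n.+1) Rv i w.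

Definition Rbar (n : nat) (w : Omega) : R := sumR n w / n%:R.

Definition S_ (n : nat) (w : Omega) : set X :=
  [set x | exists2 i, (1 <= i <= n)%N & M i w [set x] = 1%E].

Definition Lambda (n : nat) (w : Omega) : R :=
  if n == 0%N then alpha else
  alpha * (Gamma (c + 1) * Gamma (c + beta + sumR n w)) /
          (Gamma (c + beta) * Gamma (c + 1 + sumR n w)).

Definition weight (n : nat) (w : Omega) (x : X) : R :=
  ((\sum_(1 <= i < n.+1) Rv i w * fine (M i w [set x])) - beta) /
  (sumR n w + c).

Definition nu_ (n : nat) (w : Omega) (B : set X) : \bar R :=
  ((\esum_(x in S_ n w `&` B) (weight n w x)%:E) +
   (Lambda n w)%:E * m B)%E.

(* L_n(B) = card (B cap S_n)  (S_n is finite) *)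
Definition L_ (n : nat) (B : set X) (w : Omega) : R :=
  fine (\esum_(x in B `&` S_ n w) (1%E : \bar R))%E.

End model.

Definition a_ (beta : R) (n : nat) : R :=
  if beta == 0 then ln (n%:R) else powR (n%:R) beta.

Definition lambda_ (alpha c r beta : R) : R :=
  if beta == 0 then alpha * c / r
  else alpha * Gamma (c + 1) / Gamma (c + beta) / (beta * powR r (1 - beta)).

Definition cexp_ev {dO} {Omega : measurableType dO} (P : probability Omega R)
    (H : set Omega) (Y : Omega -> R) : R :=
  fine (\int[P]_(w in H) (Y w)%:E)%E / fine (P H).

Definition gauss_int (v : R) (f : R -> R) : R :=
  if v == 0 then f 0 else
  fine (\int[lebesgue_measure]_x (f x * normal_pdf 0 (Num.sqrt v) x)%:E)%E.

(* stable convergence of real random variables Xn to a kernel K, where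
   Kf w f = K(w)(f) = integral of f against K(w) *)
Definition stably_to {dO} {Omega : measurableType dO}
    (P : probability Omega R) (Xn : nat -> Omega -> R)
    (Kf : Omega -> (R -> R) -> R) : Prop :=
  forall H, measurable H -> (0 < P H)%E ->
  forall f : R -> R, continuous f -> (exists M : R, forall x, `|f x| <= M) ->
    (fun n => cexp_ev P H (fun w => f (Xn n w))) @ \oo -->
      cexp_ev P H (fun w => Kf w f).

End IBP_defs.

(* Main.v *)
(* Off S_n, the measure M_(n+1) only involves the diffuse part of nu_n. So, given
   F_n, the number N_n of points of B that it adds to S_n is Poisson with the
   F_n-measurable parameter Lambda_n m(B), and L_n(B) = N_0 + ... + N_(n-1) a.s.
   Bounds on Gamma(z) / Gamma(z + 1 - beta), which come from the concavity of
   t^(1 - beta), show that the compensator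
   A_n = m(B) (Lambda_0 + ... + Lambda_(n-1)) is close to m(B) lambda(beta) a_n,
   up to a constant and a multiple of the sum of j^(beta - 1) |Rbar_j - r|.
   The martingales exp(t L_n - (e^t - 1) A_n) give Chernoff bounds, hence the
   strong law along a subsequence, and then everywhere by monotonicity. With t of
   order a_n^(-1/2) they give the limit of E[Y exp(s (L_n - A_n) / sqrt a_n)] for
   bounded F_k-measurable Y, hence convergence in law under such densities,
   which Renyi's decorrelation argument extends to arbitrary events. *)
Require Import Defs.
From HB Require Import structures.
From mathcomp Require Import all_boot all_order all_algebra.
From mathcomp Require Import all_classical all_reals all_analysis.
From mathcomp Require Import measurable_realfun normal_distribution finmap.
From mathcomp Require Import ring lra zify.

Set Implicit Arguments.
Unset Strict Implicit.
Unset Printing Implicit Defensive.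

Import Order.TTheory GRing.Theory Num.Def Num.Theory.
Import numFieldTopology.Exports.

Local Open Scope classical_set_scope.
Local Open Scope ring_scope.

(** The hypothesis on [M n.+1] concerns conditional laws, read off its masses on fixed Borel sets,
    whereas [S_] is random and defined by masses exactly equal to 1. Finite partitions into cells
    bridge this gap: they reduce the random set to finitely many fixed ones, and show that almost
    surely the measures are integer valued and put no double point off the earlier points. [L_] is
    not shown to be measurable; it agrees almost surely with sums of the measurable [new_points].
    For the stable limit everything stays real: conditionally Poisson increments have explicit
    exponential moments, so Laplace transforms take the place of characteristic functions. They are
    computed for L_n centred at A_n. The theorem centres at v a_n, where v = m(B) lambda(beta), and
    the error (A_n - v a_n) / sqrt a_n is known to vanish only in L1, which controls Lipschitz
    functions but not exponentials. A bounded continuous f is therefore approximated by polynomials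
    in a sine, which are Lipschitz as well as limits of exponential sums in the sense of
    [approx]. *)

Section measure_extras.
Context {R : realType} {d} {T : measurableType d}.

Lemma bounded_convergence (mu : {finite_measure set T -> \bar R}) (D : set T)
    (f_ : nat -> T -> R) (f : T -> R) (K : R) :
  measurable D -> (forall n, measurable_fun D (f_ n)) -> measurable_fun D f ->
  {ae mu, forall x, D x -> f_ ^~ x @ \oo --> f x} ->
  (forall n x, D x -> `|f_ n x| <= K) ->
  (\int[mu]_(x in D) (f_ n x)%:E)%E @[n --> \oo] -->
  (\int[mu]_(x in D) (f x)%:E)%E.
Proof.
move=> mD mf_ mf cf bf.
have [] := @dominated_convergence _ _ _ mu _ mD (fun n x => (f_ n x)%:E)
  (EFin \o f) (EFin \o cst K).
- by move=> n; apply/measurable_EFinP; exact: mf_.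
- exact/measurable_EFinP.
- apply: filterS cf => x cf Dx; apply: cvg_EFin; first exact: nearW.
  exact: cf.
- exact: finite_measure_integrable_cst.
- by apply: aeW => x n Dx /=; rewrite lee_fin bf.
by [].
Qed.

End measure_extras.

(** Distinct naturals are at distance at least 1, so a Cauchy sequence of naturals is eventually
    constant. *)
Lemma cvg_nat_eventually {R : realType} (u : nat -> \bar R) (v : R) :
  (forall l, exists k : nat, u l = k%:R%:E) -> u @ \oo --> v%:E ->
  \forall l \near \oo, u l = v%:E.
Proof.
move=> /choice[k uE] uv.
have kv : (k l)%:R @[l --> \oo] --> v.
  have : fine \o u @ \oo --> v by exact: fine_cvg uv.
  by apply: cvg_trans; apply: near_eq_cvg; apply: nearW => l; rewrite /= uE.
have [N _ kN] : \forall l \near \oo, `|v - (k l)%:R| < 2^-1.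
  by move/cvgrPdist_lt : (kv); apply; lra.
have keq l : (N <= l)%N -> k l = k N.
  move=> Nl; have h1 := kN l Nl; have h2 := kN N (leqnn N).
  have : `|(k l)%:R - (k N)%:R| < 1 :> R.
    have -> : (k l)%:R - (k N)%:R = (v - (k N)%:R) - (v - (k l)%:R) :> R by ring.
    by rewrite (le_lt_trans (ler_normB _ _))//; lra.
  rewrite ltr_norml => /andP[h3 h4].
  have aux (a b : nat) : (a < b)%N -> a%:R + 1 <= b%:R :> R.
    by rewrite natr1 ler_nat.
  move: h3 h4 aux; move: (k l) (k N) => a b {}h1 {}h2 aux.
  apply/eqP; rewrite eqn_leq; apply/andP; split; rewrite leqNgt; apply/negP => /aux.
    move: h1 h2; move: (a%:R : R) (b%:R : R) => x y *; lra.
  move: h1 h2; move: (a%:R : R) (b%:R : R) => x y *; lra.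
have -> : v = (k N)%:R.
  apply: (cvg_unique _ kv) => //; apply: cvg_near_cst.
  by exists N => // l Nl /=; rewrite keq.
by exists N => // l Nl /=; rewrite uE keq.
Qed.

Lemma measurable_superlevel {R : realType} {d} {T : measurableType d}
    (f : T -> R) (c : R) :
  measurable_fun setT f -> measurable [set w | c <= f w].
Proof.
move=> mf; have -> : [set w | c <= f w] = setT `&` f @^-1` `[c, +oo[%classic.
  by apply/seteqP; split=> w /=; rewrite in_itv/= andbT => // -[].
exact: mf.
Qed.

Section boole.
Context {R : realType} {d} {T : measurableType d}.

Lemma Boole_inequality_seq (mu : {measure set T -> \bar R}) (I : Type)
    (s : seq I) (A : I -> set T) : (forall i, measurable (A i)) ->
  (mu (\big[setU/set0]_(i <- s) A i) <= \sum_(i <- s) mu (A i))%E.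
Proof.
move=> mA; elim: s => [|i s IH]; first by rewrite !big_nil measure0.
rewrite !big_cons; apply: le_trans (measureU2 _ _ _) _ => //.
  exact: bigsetU_measurable.
exact: leeD2l.
Qed.

End boole.

(** * Taylor remainders of the exponential and the sine *)

Section real_extras.
Context {R : realType}.

(** As N! i! divides (N + i)!, the tail from N on is dominated by |x|^N / N! times the exponential
    series of |x|. *)
Lemma series_tail_le (u : nat -> R) (x s : R) (N : nat) :
  (forall k, `|u k| <= `|x| ^+ k / k`!%:R) -> series u @ \oo --> s ->
  `|s - \sum_(k < N) u k| <= `|x| ^+ N / N`!%:R * expR `|x|.
Proof.
move=> ule us.
have cvgN : `|series u n - \sum_(k < N) u k| @[n --> \oo] -->
    `|s - \sum_(k < N) u k|.
  by apply: cvg_norm; apply: cvgB => //; exact: cvg_cst.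
rewrite -(cvg_lim (@Rhausdorff R) cvgN); apply: limr_le; first exact: cvgP cvgN.
exists N => // n /= Nn.
have -> : series u n - \sum_(k < N) u k = \sum_(i < n - N) u (N + i)%N.
  rewrite /series /= -(big_mkord xpredT u) (big_cat_nat _ Nn)//= addrAC subrr add0r.
  by rewrite -{1}[N]add0n big_addn big_mkord; apply: eq_bigr => i _; rewrite addnC.
apply: le_trans (ler_norm_sum _ _ _) _.
have fle i : `|u (N + i)%N| <= `|x| ^+ N / N`!%:R * exp_coeff `|x| i.
  apply: le_trans (ule _) _; rewrite /exp_coeff /= exprD -!mulrA ler_wpM2l ?exprn_ge0//.
  rewrite [leRHS]mulrCA ler_wpM2l ?exprn_ge0//.
  rewrite -invfM lef_pV2 ?posrE ?mulr_gt0 ?ltr0n ?fact_gt0//.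
  rewrite -natrM ler_nat -(bin_fact (leq_addr i N)) addKn.
  by rewrite leq_pmull// bin_gt0 leq_addr.
apply: le_trans (ler_sum _ (fun i _ => fle _)) _.
rewrite -mulr_sumr ler_wpM2l ?mulr_ge0 ?invr_ge0 ?exprn_ge0//.
have := @is_cvg_series_exp_coeff R `|x|.
rewrite /expR => /(@nondecreasing_cvgn_le _ _).
move=> /(_ _ (n - N)%N); rewrite /series /= big_mkord; apply.
by apply/nondecreasing_seqP => k; rewrite /series /= big_nat_recr//= lerDl exp_coeff_ge0.
Qed.

Lemma expR_taylor (x : R) N :
  `|expR x - \sum_(k < N) x ^+ k / k`!%:R| <= `|x| ^+ N / N`!%:R * expR `|x|.
Proof.
apply: (@series_tail_le (exp_coeff x)); last exact: is_cvg_series_exp_coeff.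
by move=> k; rewrite /exp_coeff /= normrM normrX normfV normr_nat.
Qed.

Lemma sin_taylor (x : R) N :
  `|sin x - \sum_(k < N) sin_coeff x k| <= `|x| ^+ N / N`!%:R * expR `|x|.
Proof.
apply: series_tail_le; last first.
  by rewrite sin.unlock; exact: is_cvg_series_sin_coeff.
move=> k; rewrite /sin_coeff /= !normrM normfV !normrX normrN normr1 expr1n mulr1.
rewrite !normr_nat ler_wpM2r ?invr_ge0// ler_piMl ?exprn_ge0//.
by case: (odd k).
Qed.

End real_extras.

(** * Poisson and Bernoulli random measures *)

Section poisson_weights.
Context {R : realType}.
Implicit Types (l t : R) (k : nat).

Lemma cvg_series_expR (x : R) : series (exp_coeff x) @ \oo --> expR x.
Proof. exact: is_cvg_series_exp_coeff. Qed.

Lemma cvg_series_poi_mgf l t :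
  series (fun k => poi l k * expR (t * k%:R)) @ \oo -->
  expR (l * (expR t - 1)).
Proof.
rewrite mulrBr mulr1 expRD mulrC.
have -> : series (fun k => poi l k * expR (t * k%:R)) =
    (fun n => expR (- l) * series (exp_coeff (l * expR t)) n).
  apply/funext => n; rewrite /series /= mulr_sumr; apply: eq_bigr => k _.
  rewrite /poi /exp_coeff /= exprMn -expRM_natr; ring.
by apply: cvgM; [exact: cvg_cst | exact: cvg_series_expR].
Qed.

Lemma poi_ge0 l k : 0 <= l -> 0 <= poi l k.
Proof.
by move=> l0; rewrite /poi divr_ge0// mulr_ge0 ?expR_ge0// exprn_ge0.
Qed.

Lemma nneseries_poi_mgf l t : 0 <= l ->
  (\sum_(k <oo) (poi l k * expR (t * k%:R))%:E)%E =
  (expR (l * (expR t - 1)))%:E.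
Proof.
move=> l0; apply/cvg_lim => //.
have -> : (fun n => \sum_(0 <= k < n) (poi l k * expR (t * k%:R))%:E)%E =
    EFin \o series (fun k => poi l k * expR (t * k%:R)).
  by apply/funext => n; rewrite /= sumEFin.
apply: cvg_EFin; first exact: nearW.
exact: cvg_series_poi_mgf.
Qed.

Lemma nneseries_poi l : 0 <= l -> (\sum_(k <oo) (poi l k)%:E)%E = 1%E.
Proof.
move=> l0; have := nneseries_poi_mgf 0 l0.
rewrite expR0 subrr mulr0 expR0 => <-; apply: eq_eseriesr => k _.
by rewrite mul0r expR0 mulr1.
Qed.

Lemma poi_le1 l k : 0 <= l -> poi l k <= 1.
Proof.
move=> l0; rewrite -lee_fin -(nneseries_poi l0).
have := @nneseries_lim_ge R (fun k => (poi l k)%:E) xpredT 0 k.+1.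
move=> h; apply: le_trans (h _); last by move=> i _ _; rewrite lee_fin poi_ge0.
rewrite big_nat_recr //= leeDr // sume_ge0 // => i _.
by rewrite lee_fin poi_ge0.
Qed.

(** Since e^(- l) >= 1 - l, the product (1 + l) e^(- l) is at least 1 - l^2. So a Poisson variable
    exceeds 1 with probability at most l^2, which will exclude double points in small cells. *)
Lemma poi01_ge l : 0 <= l -> 1 - l ^+ 2 <= poi l 0 + poi l 1.
Proof.
move=> l0; rewrite /poi expr0 expr1 !mulr1 !divr1.
have := expR_ge1Dx (- l); nra.
Qed.

Lemma continuous_poi k : continuous (fun l : R => poi l k).
Proof.
move=> l; apply: cvgM; last exact: cvg_cst.
apply: cvgM; last exact: exprn_continuous.
apply: continuous_comp; last exact: continuous_expR.
exact: opp_continuous.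
Qed.

Lemma cvg_poi (T : Type) (F : set_system T) (FF : Filter F) (u : T -> R) l k :
  u @ F --> l -> poi (u x) k @[x --> F] --> poi l k.
Proof.
move=> ul; apply: (@continuous_cvg _ _ _ F _ u (fun l => poi l k)) ul.
exact: continuous_poi.
Qed.

End poisson_weights.

Section bep.
Context {R : realType}.

(** Infinitely many terms equal to 1 would make the sum exceed every bound. *)
Lemma esum_zero_one (T : choiceType) (A : set T) (a : T -> \bar R) :
  (forall x, A x -> a x = 0%E \/ a x = 1%E) ->
  (\esum_(x in A) a x)%E != +oo%E ->
  exists k : nat, (\esum_(x in A) a x)%E = k%:R%:E.
Proof.
move=> a01.
have a0 x : A x -> (0 <= a x)%E by move=> /a01[] ->.
have -> : (\esum_(x in A) a x)%E =
    (\esum_(x in A `&` [set x | a x = 1%E]) 1)%E.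
  rewrite esum_mkcondr; apply: eq_esum => x Ax.
  case: ifPn => [/set_mem//|/negP nx]; case: (a01 _ Ax) => // ax1.
  by exfalso; apply: nx; apply/mem_set.
have [fA _|iA] := pselect (finite_set (A `&` [set x | a x = 1%E])).
  exists #|` fset_set (A `&` [set x | a x = 1%E])|.
  rewrite esum_fset// (eq_fsbigr (cst 1%E))//.
  by rewrite card_fset_sum1// natr_sum -sumEFin fsbig_finite.
move=> /eqP[]; apply/eqyP => r r0.
have [D DA Dr] := infinite_set_fset (truncn r).+1 iA.
apply: esum_ge; exists [set` D] => //.
apply: (@le_trans _ _ (truncn r).+1%:R%:E).
  by rewrite lee_fin ltW// truncnS_gt.
rewrite (eq_fsbigr (cst 1%E))// fsbig_finite//= set_fsetK.
have -> : (\sum_(x <- D) 1)%E = (#|` D|%:R)%:E :> \bar R.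
  by rewrite card_fset_sum1// natr_sum -sumEFin.
by rewrite lee_fin ler_nat.
Qed.

Lemma meas_sigma_ev d (X : measurableType d) (C : set X) (E : set (\bar R)) :
  measurable C -> measurable E ->
  meas_sigma [set mu : @Meas R d X | E (mu C)].
Proof. by move=> mC mE; apply: sub_sigma_algebra; exists C => //; exists E. Qed.

Definition natE : set (\bar R) := [set x | exists k : nat, x = k%:R%:E].

Lemma natE_bigcup : natE = \bigcup_(k : nat) [set k%:R%:E].
Proof. by apply/seteqP; split=> x /= [k]; exists k. Qed.

Lemma measurable_natE : measurable natE.
Proof. by rewrite natE_bigcup; apply: bigcup_measurable => k _. Qed.

(** The Poisson part is a natural number almost surely because the Poisson weights sum to 1. The
    Bernoulli part is a sum of zeros and ones, and it is finite because [N w] is a finite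
    measure. *)
Lemma bep_nat d (X : measurableType d) (nu : set X -> \bar R)
    (Q : set (@Meas R d X) -> \bar R) (C : set X) :
  BeP_law nu Q -> measurable C -> Q [set mu | natE (mu C)] = 1%E.
Proof.
move=> [d0 [Om [P' [N [[mN [M1 [V [[mM1 pM1 _] hV _ _ hN]]]] hQ]]]]] mC.
rewrite hQ; last by apply: meas_sigma_ev => //; exact: measurable_natE.
apply/eqP; rewrite eq_le probability_le1/=; last first.
  rewrite -[_ @^-1` _]setTI.
  exact: (mN _ mC measurableT _ measurable_natE).
pose A k := [set w | M1 w C = k%:R%:E].
have mA k : measurable (A k).
  by rewrite -[A k]setTI; apply: (mM1 _ mC measurableT [set _]).
(* [nu_c] is a difference, so its sign is not evident; it is read off the probability l e^(- l) of
   the value 1. *)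
have l0 : 0 <= fine (nu_c nu C).
  have := pM1 _ mC 1%N; set l := fine _ => h.
  have : (0 <= P' [set w | M1 w C = 1%:R%:E])%E by [].
  by rewrite h lee_fin /poi expr1 divr1 pmulr_rge0// expR_gt0.
rewrite -[leLHS](nneseries_poi l0).
rewrite -(eq_eseriesr (fun k _ => pM1 _ mC k)).
rewrite -[leLHS](@measure_semi_bigcup _ _ _ P' A)//; last 2 first.
- apply/trivIsetP => i j _ _ ij; rewrite /A; apply/seteqP; split=> // w [/= Ai].
  rewrite Ai => -[] /eqP; by rewrite eqr_nat (negbTE ij).
- exact: bigcup_measurable.
apply: le_measure.
- exact/mem_set/bigcup_measurable.
- apply: mem_set; rewrite -[_ @^-1` _]setTI.
  exact: (mN _ mC measurableT _ measurable_natE).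
move=> w [k _ Ak]; rewrite /=.
have NC : N w C \is a fin_num by exact: fin_num_measure.
move: (NC); rewrite hN// Ak => NC'.
have [||j ->] := @esum_zero_one _ (C `&` atoms nu) (V^~ w).
- by move=> x [_ /hV[_ + _]]; apply.
- by apply/eqP => h; move: NC'; rewrite h.
by exists (k + j)%N; rewrite natrD EFinD.
Qed.

Lemma bep_poisson d (X : measurableType d) (nu : set X -> \bar R)
    (Q : set (@Meas R d X) -> \bar R) (C : set X) k :
  BeP_law nu Q -> measurable C -> C `&` atoms nu = set0 ->
  Q [set mu | mu C = k%:R%:E] = (poi (fine (nu C)) k)%:E.
Proof.
move=> [d0 [Om [P' [N [[mN [M1 [V [[mM1 pM1 _] hV _ _ hN]]]] hQ]]]]] mC C0.
rewrite hQ; last by apply: (meas_sigma_ev (E := [set _])).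
transitivity (P' [set w | M1 w C = k%:R%:E]).
  congr (P' _); apply/seteqP; split=> w /=;
    by rewrite hN// C0 esum_set0 adde0.
by rewrite pM1// /nu_c /nu_d C0 esum_set0 sube0.
Qed.

End bep.

(** * Partitions into cells *)

Section cells.
Context {R : realType} {d} {X : measurableType d} (C : nat -> set X).
Hypothesis mC : forall k, measurable (C k).
Hypothesis sepC : forall x y, (forall k, C k x <-> C k y) -> x = y.

(** The fibres of [code l] form a finite measurable partition, finer as l grows; since [C] separates
    points, the cells around x shrink to x. *)
Definition code l (x : X) : {ffun 'I_l -> bool} := [ffun i => `[< C (val i) x >]].

Definition cell l (b : {ffun 'I_l -> bool}) : set X := code l @^-1` [set b].

Lemma codeP l x y : (code l x = code l y) <->
  (forall k, (k < l)%N -> (C k x <-> C k y)).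
Proof.
split=> [/ffunP h k kl|h].
  have := h (Ordinal kl); rewrite !ffunE /= => e.
  by split=> /asboolP; [rewrite e|rewrite -e] => /asboolP.
apply/ffunP => -[k kl]; rewrite !ffunE /=.
by apply/asboolP/asboolP; apply h.
Qed.

Lemma code_eq_le l l' x y : (l <= l')%N -> code l' x = code l' y ->
  code l x = code l y.
Proof. by move=> ll /codeP h; apply/codeP => k kl; apply/h/leq_trans/ll. Qed.

Lemma measurable_cell l b : measurable (@cell l b).
Proof.
have -> : @cell l b = \bigcap_(i in [set: 'I_l])
    (if b i then C (val i) else ~` C (val i)).
  apply/seteqP; split=> x.
    move=> /= <- i _; rewrite ffunE; case: ifPn => [/asboolP//|/asboolP//].
  move=> h; apply/ffunP => i; have := h i I; rewrite ffunE.
  by case: (b i) => /= hi; apply/asboolP.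
apply: fin_bigcap_measurable => // i _; case: (b i) => //.
exact: measurableC.
Qed.
Hint Resolve measurable_cell : core.

Lemma measurable_code l (J : set {ffun 'I_l -> bool}) :
  measurable (code l @^-1` J).
Proof.
have -> : code l @^-1` J = \bigcup_(b in J) cell b.
  apply/seteqP; split=> x /=; first by exists (code l x).
  by move=> [b Jb /= h]; rewrite h.
exact: fin_bigcup_measurable.
Qed.

Definition cellx l x : set X := cell (code l x).

Lemma cellx_self l x : cellx l x x. Proof. by []. Qed.

Lemma cellx_nonincreasing x : nonincreasing_seq (fun l => cellx l x).
Proof. by move=> l l' ll; apply/subsetPset => y; exact: code_eq_le. Qed.

Lemma bigcap_cellx x : \bigcap_l cellx l x = [set x].
Proof.
apply/seteqP; split=> y /=; last by move=> ->.
by move=> h; apply: sepC => k; have /codeP := h k.+1 I; apply.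
Qed.

Lemma measurable_singleton (x : X) : measurable [set x].
Proof. by rewrite -bigcap_cellx; apply: bigcap_measurableType => l _; exact: measurable_cell. Qed.
Hint Resolve measurable_singleton : core.

Lemma cvg_cellx (mu : @Meas R d X) x :
  mu (cellx l x) @[l --> \oo] --> mu [set x].
Proof.
rewrite -bigcap_cellx; apply: (@nonincreasing_cvg_mu _ _ _ mu).
- by rewrite -ge0_fin_numE//; apply: fin_num_measure; exact: measurable_cell.
- by move=> i; exact: measurable_cell.
- by rewrite bigcap_cellx.
- exact: cellx_nonincreasing.
Qed.

Section counting.
Variable mu : @Meas R d X.
Hypothesis nat_mu : forall l b, natE (mu (@cell l b)).

(** A nonincreasing sequence of naturals is constant once it reaches its minimum, and continuity
    from above identifies the constant as the mass of x. *)
Lemma cellx_eventually x :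
  exists l, forall l', (l <= l')%N -> mu (cellx l' x) = mu [set x].
Proof.
have /choice[u uE] : forall l, exists k : nat, mu (cellx l x) = k%:R%:E.
  by move=> l; exact: nat_mu.
have du l l' : (l <= l')%N -> (u l' <= u l)%N.
  move=> ll; rewrite -(ler_nat R) -lee_fin -!uE.
  apply: le_measure; [exact/mem_set/measurable_cell|exact/mem_set/measurable_cell|].
  exact/subsetPset/(cellx_nonincreasing _ ll).
pose Q := [pred k | `[< exists l, u l = k >]].
have exQ : exists k, Q k by exists (u 0%N); apply/asboolP; exists 0%N.
case: (ex_minnP exQ) => k /asboolP[l ul] kmin.
have ku l' : (l <= l')%N -> mu (cellx l' x) = k%:R%:E.
  move=> ll; rewrite uE; congr (_%:R%:E); apply/eqP; rewrite eqn_leq.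
  by rewrite -{1}ul du//= kmin//; apply/asboolP; exists l'.
exists l => l' ll; rewrite ku//; apply/esym.
apply: (cvg_unique _ (@cvg_cellx mu x)) => //.
apply: cvg_near_cst; exists l => // j /= lj; exact: ku.
Qed.

Lemma nat_singleton x : natE (mu [set x]).
Proof. by have [l /(_ _ (leqnn l)) <-] := cellx_eventually x; exact: nat_mu. Qed.

Lemma singleton_ge1 x : mu [set x] != 0%E -> (1 <= mu [set x])%E.
Proof.
by have [k ->] := nat_singleton x; rewrite lee_fin ler1n lt0n eqe pnatr_eq0.
Qed.

(** Each atom weighs at least 1, while the total mass is finite. *)
Lemma finite_atoms : finite_set [set x | mu [set x] != 0%E].
Proof.
apply: contrapT => iA.
have fmu : mu setT \is a fin_num by exact: fin_num_measure.
have [D DA Dr] := infinite_set_fset (truncn (fine (mu setT))).+1 iA.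
have DE : [set` D] = \bigcup_(i in [set` D]) [set i].
  by apply/seteqP; split=> x /=; [exists x|move=> [i iD ->]].
have : (mu [set` D] <= mu setT)%E.
  apply: le_measure; [apply: mem_set|exact: mem_set|by []].
  by rewrite DE; exact: fin_bigcup_measurable.
apply/negP; rewrite -ltNge -{1}(fineK fmu).
apply: (@lt_le_trans _ _ (#|` D|%:R)%:E).
  by rewrite lte_fin (lt_le_trans (truncnS_gt _))// ler_nat.
rewrite DE measure_fin_bigcup//; last first.
  by move=> i j _ _ [x [/= <- <-]].
rewrite -fsbig_seq//= card_fset_sum1 natr_sum -sumEFin.
by rewrite big_seq [leRHS]big_seq; apply: lee_sum => x /DA; exact: singleton_ge1.
Qed.

Lemma measurable_nonatoms : measurable [set x | mu [set x] = 0%E].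
Proof.
have -> : [set x | mu [set x] = 0%E] = ~` [set x | mu [set x] != 0%E].
  by apply/seteqP; split=> x /= => [->|/negP]; rewrite ?eqxx// negbK => /eqP.
apply: measurableC; apply: countable_measurable => //.
exact/finite_set_countable/finite_atoms.
Qed.

(** By [cellx_eventually] a point of mass 0 lies in some cell of mass 0, and there are only
    countably many cells. So integer masses on cells make the measure purely atomic. *)
Lemma measure_nonatoms : mu [set x | mu [set x] = 0%E] = 0%E.
Proof.
apply: measure_negligible; first exact: measurable_nonatoms.
pose Z l := code l @^-1` [set b | mu (cell b) = 0%E].
suff : mu.-negligible (\bigcup_l Z l).
  apply: negligibleS.
  move=> x /= x0; have [l /(_ _ (leqnn l)) lx] := cellx_eventually x.
  by exists l => //; rewrite /Z /= -x0 -lx.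
apply: negligible_bigcup => l; exists (Z l); split=> //.
  exact: measurable_code.
have -> : Z l = \bigcup_(b in [set b | mu (@cell l b) = 0%E]) cell b.
  apply/seteqP; split=> x; first by exists (code l x).
  by move=> [b b0 h]; rewrite /Z /= h.
rewrite measure_fin_bigcup//; first by rewrite fsbig1.
  exact: finite_finset.
by move=> i j _ _ [x [/= <- <-]].
Qed.

End counting.

Section realization.
Variable mu : nat -> @Meas R d X.

Definition points n : set X :=
  [set x | exists2 i, (1 <= i <= n)%N & mu i [set x] = 1%E].

(* A union of level-l cells indexed by a random finite set depending only on
   mu 1, ..., mu n, and increasing in l to the complement of [points n]: it
   reduces conditional laws at a random set to laws at deterministic ones. *)
Definition unhit n l : set X :=
  [set x | forall i, (1 <= i <= n)%N -> mu i (cellx l x) = 0%E].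

Lemma points_sub n : points n `<=` points n.+1.
Proof. by move=> x [i /andP[i1 iN] h]; exists i => //; rewrite i1 leqW. Qed.

Lemma measurable_unhit n l : measurable (unhit n l).
Proof.
exact: (measurable_code
  [set b | forall i, (1 <= i <= n)%N -> mu i (@cell l b) = 0%E]).
Qed.

Lemma unhit_nondecreasing n : nondecreasing_seq (unhit n).
Proof.
move=> l l' ll; apply/subsetPset => x h i iN.
apply/eqP; rewrite -measure_le0 -(h i iN); apply: le_measure.
- exact/mem_set/measurable_cell.
- exact/mem_set/measurable_cell.
- exact/subsetPset/(cellx_nonincreasing _ ll).
Qed.

Hypothesis nat_mu : forall i l b, (1 <= i)%N -> natE (mu i (@cell l b)).

Lemma bigcup_unhit n : \bigcup_l unhit n l =
  [set x | forall i, (1 <= i <= n)%N -> mu i [set x] = 0%E].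
Proof.
apply/seteqP; split=> x.
  move=> [l _ h] i iN; apply/eqP; rewrite -measure_le0 -(h i iN).
  apply: le_measure; [exact: mem_set|exact/mem_set/measurable_cell|].
  by move=> _ ->; exact: cellx_self.
move=> h.
have /choice[f fE] : forall i, exists l, (1 <= i <= n)%N ->
    forall l', (l <= l')%N -> mu i (cellx l' x) = 0%E.
  move=> i; have [iN|] := boolP (1 <= i <= n)%N; last by exists 0%N.
  have [|l lE] := @cellx_eventually (mu i) _ x.
    by move=> l b; apply: nat_mu; case/andP: iN.
  by exists l => _ l' ll; rewrite lE// h.
exists (\max_(i < n.+1) f i)%N => // i iN; apply: fE => //.
have iS : (i < n.+1)%N by case/andP: iN.
exact: (leq_bigmax (Ordinal iS)).
Qed.

Hypothesis simple_mu : forall n l0, exists2 l, (l0 <= l)%N & forall b,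
  (forall i, (1 <= i <= n)%N -> mu i (@cell l b) = 0%E) ->
  (mu n.+1 (@cell l b) <= 1)%E.

(** [points] records only masses exactly equal to 1. By induction x has mass 0 for the earlier
    measures, hence lies in a fine unhit cell, where [simple_mu] bounds its new mass by 1. This mass
    is a natural number, and the value 1 would put x in [points n.+1]. *)
Lemma points_off n x : ~ points n x ->
  forall i, (1 <= i <= n)%N -> mu i [set x] = 0%E.
Proof.
elim: n => [_ i /andP[i1]|n IH Sx i /andP[i1]].
  by rewrite leqn0 => /eqP i0; move: i1; rewrite i0.
have {}IH := IH (fun h => Sx (points_sub h)).
rewrite leq_eqVlt ltnS => /predU1P[ein|iN]; last by apply: IH; rewrite i1.
have [l0 _ l0x] : (\bigcup_l unhit n l) x by rewrite bigcup_unhit.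
have [l ll lE] := simple_mu n l0.
have : (mu n.+1 [set x] <= 1)%E.
  apply: le_trans (lE (code l x) _).
    by apply: le_measure; [exact: mem_set|exact/mem_set/measurable_cell|move=> _ ->].
  by have /subsetPset := unhit_nondecreasing n ll; apply.
have := @nat_singleton (mu n.+1) (fun l b => @nat_mu n.+1 l b isT) x.
move=> [k kE]; rewrite ein kE lee_fin.
case: k kE => [//|[|k]] kE; last by rewrite (ler_nat _ _ 1).
by exfalso; apply: Sx; exists n.+1 => //=; rewrite leqnn.
Qed.

Lemma bigcup_unhitE n : \bigcup_l unhit n l = ~` points n.
Proof.
rewrite bigcup_unhit; apply/seteqP; split=> x; last exact: points_off.
by move=> h [i /h ->] /esym/eqP; rewrite onee_eq0.
Qed.

Lemma finite_points n : finite_set (points n).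
Proof.
apply: (@sub_finite_set _ _
    (\bigcup_(i in `I_n.+1) [set x | mu i.+1 [set x] != 0%E])).
  move=> x [[//|i] /andP[_ iN] h]; exists i; first exact: ltnW.
  by rewrite /= h onee_eq0.
apply: bigcup_finite => // i _; apply: finite_atoms => l b; exact: nat_mu.
Qed.

Lemma measurable_points n : measurable (points n).
Proof.
apply: countable_measurable; first exact: measurable_singleton.
exact/finite_set_countable/finite_points.
Qed.

Lemma measure_off_points n : mu n.+1 (~` points n.+1) = 0%E.
Proof.
have nm : forall l b, natE (mu n.+1 (@cell l b)) by move=> l b; exact: nat_mu.
apply/eqP; rewrite -measure_le0 -(measure_nonatoms nm); apply: le_measure.
- exact/mem_set/measurableC/measurable_points.
- exact/mem_set/measurable_nonatoms.
- by move=> x /points_off; apply; rewrite /= leqnn.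
Qed.

Lemma new_points_mass n x : points n.+1 x -> ~ points n x ->
  mu n.+1 [set x] = 1%E.
Proof.
move=> [i /andP[i1]]; rewrite leq_eqVlt ltnS => /predU1P[->//|iN] h Sx.
by exfalso; apply: Sx; exists i; rewrite ?i1.
Qed.

(** Off [points n] the measure [mu n.+1] is carried by the finitely many new points, each of mass
    exactly 1. *)
Lemma card_new_points B n : measurable B ->
  mu n.+1 (B `&` ~` points n) =
  (\esum_(x in B `&` (points n.+1 `\` points n)) 1)%E.
Proof.
move=> mB.
have mS k : measurable (points k) := measurable_points k.
pose A := B `&` (points n.+1 `\` points n).
have mA : measurable A by apply: measurableI => //; exact: measurableD.
have fA : finite_set A.
  by apply: sub_finite_set (finite_points n.+1) => x [_ []].
transitivity (mu n.+1 A).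
  have -> : B `&` ~` points n = A `|` (B `&` ~` points n `&` ~` points n.+1).
    rewrite /A; apply/seteqP; split=> x.
      by move=> [Bx Sx]; have [?|?] := pselect (points n.+1 x); [left|right].
    by move=> [[? [? ?]]|[[? ?] ?]].
  rewrite measureU//; last 2 first.
  - by apply: measurableI; [apply: measurableI => //|]; exact: measurableC.
  - by apply/seteqP; split=> // x [[_ [? _]]] [].
  rewrite [X in (_ + X)%E](_ : _ = 0%E) ?adde0//.
  apply/eqP; rewrite -measure_le0 -(measure_off_points n); apply: le_measure.
  - apply: mem_set.
    by apply: measurableI; [apply: measurableI => //|]; exact: measurableC.
  - exact/mem_set/measurableC.
  - by move=> x [].
rewrite esum_fset//.
have -> : A = \bigcup_(i in A) [set i].
  by apply/seteqP; split=> x /=; [exists x|move=> [i iD ->]].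
rewrite measure_fin_bigcup//; first last.
  by move=> i j _ _ [x [/= <- <-]].
by apply: eq_fsbigr => x /set_mem [_ []]; exact: new_points_mass.
Qed.

Lemma card_points_S B n :
  (\esum_(x in B `&` points n.+1) (1 : \bar R) =
   \esum_(x in B `&` points n) 1 +
   \esum_(x in B `&` (points n.+1 `\` points n)) 1)%E.
Proof.
rewrite (esumID (points n))//; congr (_ + _)%E.
  congr esum; rewrite -setIA; congr (_ `&` _).
  by apply/setIidPr; exact: points_sub.
by congr esum; rewrite -setIA.
Qed.

End realization.
End cells.

(** * The number of new points *)

Section separating.
Context {R : realType} {d} {X : measurableType d} (dist : X -> X -> R).

(** A ball of radius less than half of [dist x y], about a point of the dense set close enough to x,
    contains x but not y. *)
Lemma separating_sequence : separable_metric_Borel dist ->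
  exists C : nat -> set X, (forall k, measurable (C k)) /\
    (forall x y, (forall k, C k x <-> C k y) -> x = y).
Proof.
move=> [d0 dC dT [D /countable_injP[f finj] denseD] mE].
have dge0 x y : 0 <= dist x y.
  have := dT x y x; rewrite (dC y x) (proj2 (d0 x x) erefl); lra.
(* Centres are named by their image under an injection of [D] into the naturals; for an n that names
   no centre the set is empty. *)
pose ballD (n j : nat) : set X :=
  [set y | exists z, [/\ D z, f z = n & dist z y < j.+1%:R^-1]].
exists (fun k => if (choice.unpickle k : option (nat * nat)%type) is Some (n, j) then ballD n j else set0).
split=> [k|x y xy].
  case: choice.unpickle => [[n j]|//]; rewrite mE; apply: sub_sigma_algebra.
  move=> y [z [Dz fz zy]]; exists (j.+1%:R^-1 - dist z y).
    by rewrite subr_gt0.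
  move=> y' /=; rewrite ltrBrDl => yy'; exists z; split=> //.
  exact: le_lt_trans (dT z y y') yy'.
apply/d0/eqP; rewrite eq_le dge0 andbT leNgt; apply/negP => dxy.
have [j jE] : exists j : nat, j.+1%:R^-1 < dist x y / 2.
  exists (truncn (dist x y / 2)^-1).
  rewrite -ltf_pV2 ?posrE// ?divr_gt0// ?invr_gt0// invrK.
  exact: truncnS_gt.
have j0 : 0 < (j.+1%:R^-1 : R) by [].
have [z Dz xz] := denseD x _ j0.
have := xy (choice.pickle (f z, j)); rewrite choice.pickleK.
move=> [+ _] => -[|z' [Dz' fz' z'y]]; first by exists z; split; rewrite // dC.
have ez : z' = z by apply: finj => //; apply: mem_set.
suff : dist x y < dist x y by rewrite ltxx.
move: jE xz z'y (dT x z y); rewrite ez; move: (j.+1%:R^-1) => e.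
lra.
Qed.

End separating.

(** * Generated sigma-algebras and finite case distinctions *)

Section generated.
Context {R : realType} {dO} {Omega : measurableType dO}.
Implicit Types fs : set (Omega -> \bar R).

Definition gen_of fs : set (set Omega) :=
  [set A | exists2 f, fs f & exists2 E : set (\bar R), measurable E & A = f @^-1` E].

(** Carries the generated sigma-algebra as a measurable type, so that measurability with respect to
    the past becomes ordinary measurability on another type. *)
Definition gen_type fs := g_sigma_algebraType (gen_of fs).

Lemma sigma_gen_fun fs f : fs f -> measurable_fun [set: gen_type fs] f.
Proof.
move=> fsf _ E mE; rewrite setTI; apply: sub_sigma_algebra.
by exists f => //; exists E.
Qed.

Lemma sigma_gen_sub fs : (forall f, fs f -> measurable_fun [set: Omega] f) ->
  sigma_gen fs `<=` measurable.
Proof.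
move=> mfs; apply: smallest_sub; first exact: sigma_algebra_measurable.
move=> A [f fsf [E mE ->]]; rewrite -[_ @^-1` _]setTI.
exact: (mfs _ fsf measurableT).
Qed.

Lemma sigma_gen_mono fs fs' : fs `<=` fs' -> sigma_gen fs `<=` sigma_gen fs'.
Proof.
move=> ss; apply: smallest_sub; first exact: smallest_sigma_algebra.
move=> A [f fsf [E mE ->]]; apply: sub_sigma_algebra.
by exists f; [exact: ss|exists E].
Qed.

End generated.

Section finite_case.
Context {d} {T : measurableType d} {d'} {T' : measurableType d'} {I : finType}.

Lemma measurable_fun_finite_case (J : T -> I) (g : I -> T -> T') :
  (forall i, measurable (J @^-1` [set i])) ->
  (forall i, measurable_fun setT (g i)) ->
  measurable_fun setT (fun w => g (J w) w).
Proof.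
move=> mJ mg _ E mE; rewrite setTI.
have -> : (fun w => g (J w) w) @^-1` E =
    \bigcup_(i in [set: I]) (J @^-1` [set i] `&` g i @^-1` E).
  apply/seteqP; split=> w /=; first by exists (J w).
  by move=> [i _ [/= <-]].
apply: fin_bigcup_measurable => [|i _]; first exact: finite_finset.
by apply: measurableI => //; rewrite -[_ @^-1` _]setTI; exact: mg.
Qed.

End finite_case.

Section finite_case_sums.
Context {R : realType} {d} {T : measurableType d} {I : finType}.
Variables (mu : {measure set T -> \bar R}) (J : T -> I).
Hypothesis mJ : forall i, measurable (J @^-1` [set i]).

Let caseE (A : set T) :
  A = \bigcup_(i in [set: I]) (A `&` J @^-1` [set i]).
Proof. by apply/seteqP; split=> w; [exists (J w)|move=> [i _ []]]. Qed.

Lemma measure_finite_case (A : set T) : measurable A ->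
  mu A = (\sum_(i : I) mu (A `&` J @^-1` [set i]))%E.
Proof.
move=> mA; rewrite {1}(caseE A) measure_fin_bigcup.
- rewrite fsbig_finite; last exact: finite_finset.
  apply: perm_big; apply: uniq_perm => [||i].
  + exact: fset_uniq.
  + exact: index_enum_uniq.
  + rewrite mem_index_enum in_fset_set; last exact: finite_finset.
    exact: mem_set.
- exact: finite_finset.
- by move=> i j _ _ [w [[_ /= <-] [_ /= <-]]].
- by move=> i _; exact: measurableI.
Qed.

Lemma ge0_integral_finite_case (A : set T) (f : T -> \bar R) :
  measurable A -> measurable_fun A f -> (forall x, A x -> (0 <= f x)%E) ->
  (\int[mu]_(x in A) f x =
   \sum_(i : I) \int[mu]_(x in A `&` J @^-1` [set i]) f x)%E.
Proof.
move=> mA mf f0.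
have AE : A = \big[setU/set0]_(i <- index_enum I) (A `&` J @^-1` [set i]).
  rewrite -bigcup_seq {1}(caseE A); congr bigcup.
  by apply/seteqP; split=> i //= _; rewrite mem_index_enum.
rewrite [in LHS]AE ge0_integral_bigsetU//.
- by move=> i; exact: measurableI.
- exact: index_enum_uniq.
- by move=> i j _ _ [w [[_ /= <-] [_ /= <-]]].
- by rewrite -AE.
- by rewrite -AE.
Qed.

End finite_case_sums.

(** * Measurability of the Gamma function *)

Section gamma_measurable.
Context {R : realType}.

Lemma measurable_funV_ge0 d (T : measurableType d) (D : set T) (f : T -> R) :
  measurable_fun D f -> (forall x, 0 <= f x) ->
  measurable_fun D (fun x => (f x)^-1).
Proof.
move=> mf f0.
(* Inversion on the nonnegative reals, with value 0 at 0, as a composite of measurable functions. *)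
have -> : (fun x => (f x)^-1) =
    (fun y => if y == 0 then 0 else expR (- ln y)) \o f.
  apply/funext => x /=; case: eqP => [->|/eqP fx]; first by rewrite invr0.
  by rewrite expRN lnK// posrE lt_neqAle eq_sym fx f0.
apply: measurableT_comp => //.
apply: measurable_fun_ifT => //; first exact: measurable_fun_eqr.
by do 2 apply: measurableT_comp => //.
Qed.

Lemma Gamma_integrand_measurable :
  measurable_fun [set: R * R] (fun z : R * R =>
    (if 0 < z.2 then expR ((z.1 - 1) * ln z.2 - z.2) else 0)%:E : \bar R).
Proof.
apply/measurable_EFinP; apply: measurable_fun_ifT => //.
  apply: measurable_fun_ltr => //.
apply: measurableT_comp => //; apply: measurable_funB => //.
apply: measurable_funM; first exact: measurable_funB.
exact: measurableT_comp.
Qed.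

(** Extended by 0 to the whole line and written with [expR] and [ln], the integrand is jointly
    measurable in both variables; Tonelli then yields [measurable_Gamma]. *)
Lemma GammaE (x : R) : Gamma x = fine (\int[lebesgue_measure]_t
  (if 0 < t then expR ((x - 1) * ln t - t) else 0)%:E)%E.
Proof.
rewrite /Gamma integral_mkcond; congr fine; apply: eq_integral => t _.
rewrite patchE; case: ifPn => [/set_mem /= t0|nt].
  by rewrite t0 /powR gt_eqF// -expRD.
by case: ifPn => // t0; move/negP: nt; case; exact: mem_set.
Qed.

Lemma measurable_Gamma : measurable_fun setT (@Gamma R).
Proof.
rewrite (_ : @Gamma R = fun x : R => fine (\int[lebesgue_measure]_t
  (if 0 < t then expR ((x - 1) * ln t - t) else 0)%:E)%E); last first.
  by apply/funext => x; exact: GammaE.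
apply: measurableT_comp => //.
apply: (@measurable_fun_fubini_tonelli_F _ _ _ _ _ lebesgue_measure
  (fun z : R * R => (if 0 < z.2 then expR ((z.1 - 1) * ln z.2 - z.2) else 0)%:E)).
  exact: Gamma_integrand_measurable.
by move=> z; rewrite lee_fin; case: ifPn => // _; exact: expR_ge0.
Qed.

Lemma Gamma_ge0 (x : R) : 0 <= Gamma x.
Proof.
rewrite GammaE fine_ge0// integral_ge0// => t _; rewrite lee_fin.
by case: ifPn => // _; exact: expR_ge0.
Qed.

End gamma_measurable.

(** * The conditional law of the number of new points *)

Section model.
Context {R : realType}
    {dO : measure_display} {Omega : measurableType dO} (P : probability Omega R)
    {d : measure_display} {X : measurableType d}
    (m : probability X R) (alpha beta c : R)
    (M : nat -> Omega -> @Meas R d X) (Rv : nat -> Omega -> R).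
Hypothesis mM : forall n, (1 <= n)%N -> random_measure (M n).
Hypothesis mRv : forall n, (1 <= n)%N -> measurable_fun setT (Rv n).
Hypothesis alpha_ge0 : 0 <= alpha.
Hypothesis mdiff : diffuse m.
Hypothesis condM :
  forall n, cond_BeP P (F_ M Rv n) (M n.+1) (nu_ m alpha beta c M Rv n).

Definition gens n : set (Omega -> \bar R) :=
  [set f | exists i B, [/\ (1 <= i <= n)%N, measurable B &
                         f = (fun w => M i w B)]] `|`
  [set f | exists2 i, (1 <= i <= n)%N & f = (fun w => (Rv i w)%:E)].

Lemma F_sub n : F_ M Rv n `<=` measurable.
Proof.
apply: sigma_gen_sub => f [[i [B [/andP[i1 _] mB ->]]]|[i /andP[i1 _] ->]].
  exact: mM.
by apply/measurable_EFinP; exact: mRv.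
Qed.

Lemma F_mono n : F_ M Rv n `<=` F_ M Rv n.+1.
Proof.
apply: sigma_gen_mono => f [[i [B [/andP[i1 iN] mB ->]]]|[i /andP[i1 iN] ->]].
  by left; exists i, B; split=> //; rewrite i1 leqW.
by right; exists i => //; rewrite i1 leqW.
Qed.

Definition FT n := gen_type (gens n).

Lemma M_FT n i B : (1 <= i <= n)%N -> measurable B ->
  measurable_fun [set: FT n] (fun w => M i w B).
Proof. by move=> iN mB; apply: sigma_gen_fun; left; exists i, B. Qed.

Lemma Rv_FT n i : (1 <= i <= n)%N -> measurable_fun [set: FT n] (Rv i).
Proof.
by move=> iN; apply/measurable_EFinP; apply: sigma_gen_fun; right; exists i.
Qed.

Lemma sumR_FT n : measurable_fun [set: FT n] (sumR Rv n).
Proof.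
have -> : sumR Rv n = fun w => \sum_(i < n) Rv i.+1 w.
  by apply/funext => w; rewrite /sumR big_add1 /= big_mkord.
by apply: measurable_sum => i; apply: Rv_FT; rewrite /= ltn_ord.
Qed.

Lemma Lambda_FT n : measurable_fun [set: FT n] (Lambda alpha beta c Rv n).
Proof.
rewrite /Lambda; case: eqP => // _.
have mG x : measurable_fun [set: FT n] (fun w => Gamma (x + sumR Rv n w)).
  apply: measurableT_comp; first exact: measurable_Gamma.
  by apply: measurable_funD => //; exact: sumR_FT.
apply: measurable_funM.
  by apply: measurable_funM => //; apply: measurable_funM.
apply: measurable_funV_ge0; first by apply: measurable_funM.
by move=> w; rewrite mulr_ge0 ?Gamma_ge0.
Qed.

Lemma Lambda_ge0 n w : 0 <= Lambda alpha beta c Rv n w.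
Proof.
rewrite /Lambda; case: eqP => // _.
by rewrite divr_ge0 ?mulr_ge0 ?Gamma_ge0.
Qed.

(** As [m] is diffuse, the atoms of [nu_] lie in [S_]; on H the set C meets none of them, and its
    conditional mass is Poisson. Here C is fixed; [hit_law] passes to random sets. *)
Lemma cond_law n C H k : measurable C -> F_ M Rv n H ->
  (forall w, H w -> C `&` S_ M n w = set0) ->
  P (M n.+1 @^-1` [set mu | mu C = k%:R%:E] `&` H) =
  (\int[P]_(w in H) (poi (Lambda alpha beta c Rv n w * fine (m C)) k)%:E)%E.
Proof.
move=> mC FH HS; have [Q [lawQ QE]] := condM n.
have mA := @meas_sigma_ev R _ X C [set k%:R%:E] mC (emeasurable_set1 _).
have [_ ->//] := QE _ mA.
apply: eq_integral => w /set_mem Hw.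
have atS : atoms (nu_ m alpha beta c M Rv n w) `<=` S_ M n w.
  move=> x; rewrite /atoms /= /nu_ mdiff mule0 adde0 => h.
  apply: contrapT => Sx; move: h; rewrite [esum _ _](_ : _ = 0%E) ?ltxx//.
  by apply: esum1 => y [Sy yx]; exfalso; apply: Sx; rewrite -yx.
rewrite (bep_poisson _ (lawQ w))//; last first.
  by apply/seteqP; split=> // x [Cx /atS Sx]; rewrite -(HS w Hw).
congr (poi _ _)%:E; rewrite /nu_ setIC (HS w Hw) esum_set0 add0e.
by rewrite fineM// fin_num_measure.
Qed.

Lemma ae_natE n C : measurable C -> P [set w | ~ natE (M n.+1 w C)] = 0%E.
Proof.
move=> mC; have [Q [lawQ QE]] := condM n.
have mA := meas_sigma_ev (X := X) mC (@measurable_natE R).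
have [_ /(_ setT)] := QE _ mA.
rewrite (eq_integral (fun=> 1%E)); last first.
  by move=> w _; apply: (bep_nat (lawQ w)).
rewrite integral_cst// mul1e setIT => h.
have FT0 : F_ M Rv n setT by exact: (@measurableT _ (FT n)).
have {}h : P (M n.+1 @^-1` [set mu | natE (mu C)]) = 1%E.
  by rewrite (h FT0); exact: probability_setT.
rewrite (_ : [set w | _] = ~` (M n.+1 @^-1` [set mu | natE (mu C)])); last by [].
rewrite probability_setC ?h ?subee//.
rewrite -[_ @^-1` _]setTI; apply: (mM _ mC) => //; exact: measurable_natE.
Qed.

Section limit.
Variable C : nat -> set X.
Hypothesis mC : forall k, measurable (C k).
Hypothesis sepC : forall x y, (forall k, C k x <-> C k y) -> x = y.
Hypothesis bndL : forall n, exists K, forall w, Lambda alpha beta c Rv n w <= K.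
Variable B : set X.
Hypothesis mB : measurable B.

(** The random set [unhit] depends on the outcome only through this variable, which has finitely
    many values and is measurable for [FT n]. *)
Definition empty_cells n l w : {set {ffun 'I_l -> bool}} :=
  [set b | `[< forall i, (1 <= i <= n)%N -> M i w (cell C b) = 0%E >]]%SET.

Lemma unhitE n l w : unhit C (M^~ w) n l =
  code C l @^-1` [set b | b \in empty_cells n l w].
Proof.
by apply/seteqP; split=> x; rewrite /unhit /= inE => /asboolP.
Qed.

Lemma empty_cells_FT n l (J : {set {ffun 'I_l -> bool}}) :
  @measurable _ (FT n) (empty_cells n l @^-1` [set J]).
Proof.
have -> : empty_cells n l @^-1` [set J] =
    \bigcap_(b in [set: {ffun 'I_l -> bool}])
      (if b \in J then \bigcap_(i in [set i | (1 <= i <= n)%N]) [set w | M i w (cell C b) = 0%E]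
       else ~` \bigcap_(i in [set i | (1 <= i <= n)%N]) [set w | M i w (cell C b) = 0%E]).
  apply/seteqP; split=> w.
    move=> /= <- b _; rewrite inE; case: ifPn => /asboolP h; first exact: h.
    by move=> h'; apply: h => i iN; exact: h'.
  move=> h; apply/setP => b; rewrite inE; have := h b I.
  case: (b \in J) => h'; first by apply/asboolP => i iN; exact: h'.
  by apply/asboolP => h2; apply: h' => i iN; exact: h2.
have mi b : @measurable _ (FT n)
    (\bigcap_(i in [set i | (1 <= i <= n)%N]) [set w | M i w (cell C b) = 0%E]).
  apply: bigcap_measurableType => i iN.
  have := M_FT iN (measurable_cell mC b).
  move=> /(_ measurableT [set 0%E] (emeasurable_set1 _)); rewrite setTI.
  exact.
apply: (@fin_bigcap_measurable _ (FT n)) => [|b _]; first exact: finite_finset.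
by case: ifPn => _; [exact: mi|apply: measurableC; exact: mi].
Qed.

Lemma FT_sub n (H : set Omega) : @measurable _ (FT n) H -> measurable H.
Proof. by move/F_sub. Qed.

Lemma FT_subS n (H : set Omega) : @measurable _ (FT n) H -> @measurable _ (FT n.+1) H.
Proof. by move/F_mono. Qed.

Lemma FT_fun n d' (T' : measurableType d') (f : Omega -> T') :
  measurable_fun [set: FT n] f -> measurable_fun [set: Omega] f.
Proof.
move=> mf _ E mE; rewrite setTI; apply: (@FT_sub n).
by rewrite -[X in measurable X]setTI; exact: mf.
Qed.

(** At each level l the set takes finitely many values, whence measurability and, in [hit_law], a
    conditional law; as l grows, [hit] increases to [new_points]. *)
Definition hit n l w : \bar R := M n.+1 w (B `&` unhit C (M^~ w) n l).

Lemma hit_FT n l : measurable_fun [set: FT n.+1] (hit n l).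
Proof.
pose g (J : {set {ffun 'I_l -> bool}}) (w : FT n.+1) :=
  M n.+1 w (B `&` code C l @^-1` [set b | b \in J]).
have -> : hit n l = fun w => g (empty_cells n l w) w.
  by apply/funext => w; rewrite /hit unhitE.
apply: (@measurable_fun_finite_case _ (FT n.+1) _ _ _ (empty_cells n l) g).
  by move=> J; apply: FT_subS; exact: empty_cells_FT.
move=> J; apply: M_FT; first by rewrite /= leqnn.
by apply: measurableI => //; exact: measurable_code.
Qed.

Definition rate n l w : R := Lambda alpha beta c Rv n w * fine (m (B `&` unhit C (M^~ w) n l)).

Lemma rate_FT n l : measurable_fun [set: FT n] (rate n l).
Proof.
apply: measurable_funM; first exact: Lambda_FT.
pose g (J : {set {ffun 'I_l -> bool}}) (w : FT n) :=
  fine (m (B `&` code C l @^-1` [set b | b \in J])).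
have -> : (fun w => fine (m (B `&` unhit C (M^~ w) n l))) =
    fun w => g (empty_cells n l w) w.
  by apply/funext => w; rewrite unhitE.
apply: (@measurable_fun_finite_case _ (FT n) _ _ _ (empty_cells n l) g).
  by move=> J; exact: empty_cells_FT.
by move=> J; exact: measurable_cst.
Qed.

Lemma rate_ge0 n l w : 0 <= rate n l w.
Proof. by rewrite mulr_ge0 ?Lambda_ge0 ?fine_ge0. Qed.

Lemma poi_FT n k (f : Omega -> R) : measurable_fun [set: FT n] f ->
  measurable_fun [set: Omega] (fun w => (poi (f w) k)%:E).
Proof.
move=> mf; apply/measurable_EFinP.
apply: (measurableT_comp (f := fun l : R => poi l k)).
  by apply: continuous_measurable_fun; exact: continuous_poi.
exact: FT_fun mf.
Qed.

Lemma points_hit n l w (J := [set b | b \in empty_cells n l w]) :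
  (code C l @^-1` J) `&` S_ M n w = set0.
Proof.
apply/seteqP; split=> // x []; rewrite -unhitE => h [i iN hi].
have : (M i w [set x] <= M i w (cellx C l x))%E.
  apply: le_measure.
  - exact/mem_set/(measurable_singleton mC sepC).
  - exact/mem_set/(measurable_cell mC).
  - by move=> _ ->.
by rewrite hi (h i iN) lee_fin ler10.
Qed.

(** H is split according to the value of [empty_cells]. On each piece the set is fixed and misses
    [S_], so [cond_law] applies. *)
Lemma hit_law n l k H : F_ M Rv n H ->
  P (hit n l @^-1` [set k%:R%:E] `&` H) =
  (\int[P]_(w in H) (poi (rate n l w) k)%:E)%E.
Proof.
move=> FH.
pose HJ J := H `&` empty_cells n l @^-1` [set J].
have mJ J : measurable (empty_cells n l @^-1` [set J]).
  by apply: FT_sub; exact: empty_cells_FT.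
have FHJ J : F_ M Rv n (HJ J).
  apply: (@measurableI _ (FT n)) => //; exact: empty_cells_FT.
have mhit : measurable (hit n l @^-1` [set k%:R%:E]).
  by rewrite -[X in measurable X]setTI; apply: (FT_fun (@hit_FT n l)).
have mH : measurable H by exact: F_sub FH.
rewrite (measure_finite_case P mJ); last exact: measurableI.
rewrite (ge0_integral_finite_case P mJ)//; last 2 first.
- by apply: measurable_funTS; apply: poi_FT; exact: rate_FT.
- by move=> w _; rewrite lee_fin poi_ge0// rate_ge0.
apply: eq_bigr => J _.
have -> : hit n l @^-1` [set k%:R%:E] `&` H `&` empty_cells n l @^-1` [set J] =
    M n.+1 @^-1` [set mu | mu (B `&` code C l @^-1` [set` J]) = k%:R%:E] `&` HJ J.
  rewrite -setIA; apply/seteqP; split=> w [/= h [Hw Jw]]; split=> //;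
  by move: h; rewrite /hit unhitE Jw.
etransitivity; first apply: (@cond_law n _ (HJ J) k) => //.
- by apply: measurableI => //; exact: measurable_code.
- move=> w [_ /= Jw]; have := points_hit n l w; rewrite Jw => h.
  by rewrite -setIA h setI0.
by apply: eq_integral => w /set_mem [_ /= Jw]; rewrite /rate unhitE Jw.
Qed.

Definition empty_cell n l b : set Omega :=
  [set w | forall i, (1 <= i <= n)%N -> M i w (@cell _ X C l b) = 0%E].

Lemma empty_cell_F n l b : F_ M Rv n (@empty_cell n l b).
Proof.
have -> : @empty_cell n l b =
    \bigcap_(i in [set i | (1 <= i <= n)%N]) [set w | M i w (cell C b) = 0%E] by [].
apply: (@bigcap_measurableType _ (FT n)) => i iN.
have := M_FT iN (measurable_cell mC b).
by move=> /(_ measurableT [set 0%E] (emeasurable_set1 _)); rewrite setTI.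
Qed.

Lemma empty_cell_off n l b w : @empty_cell n l b w -> cell C b `&` S_ M n w = set0.
Proof.
move=> h; apply/seteqP; split=> // x [xb [i iN hi]].
have : (M i w [set x] <= M i w (cell C b))%E.
  apply: le_measure.
  - exact/mem_set/(measurable_singleton mC sepC).
  - exact/mem_set/(measurable_cell mC).
  - by move=> _ ->.
by rewrite hi (h i iN) lee_fin ler10.
Qed.

(* The expected number of such cells is at most a multiple of the sum of
   [m (cell b) ^+ 2], which vanishes as the cells shrink because m is diffuse. *)
Definition crowded n l b : set Omega := @empty_cell n l b `&`
  [set w | M n.+1 w (cell C b) != 0%E /\ M n.+1 w (cell C b) != 1%E].

Lemma measurable_Mset n (A : set X) (E : set (\bar R)) : measurable A ->
  measurable E -> measurable [set w | E (M n.+1 w A)].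
Proof.
by move=> mA mE; have := @mM n.+1 isT _ mA measurableT _ mE; rewrite setTI.
Qed.

Lemma crowdedE n l b : @crowded n l b = @empty_cell n l b `\`
  ([set w | [set 0%:R%:E] (M n.+1 w (cell C b))] `|`
   [set w | [set 1%:R%:E] (M n.+1 w (cell C b))]).
Proof.
apply/seteqP; split=> w /= [h h'].
  by split=> // -[e|e]; case: h' => /eqP h1 /eqP h2; [exact: h1|exact: h2].
by split=> //; split; apply/eqP => e; apply: h'; [left|right].
Qed.

Lemma measurable_crowded n l b : measurable (@crowded n l b).
Proof.
rewrite crowdedE; apply: measurableD; first by apply: F_sub; exact: empty_cell_F.
by apply: measurableU; apply: measurable_Mset => //; exact: measurable_cell.
Qed.

(** On [empty_cell] the conditional mass of the cell is Poisson with parameter at most K m(cell),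
    and [poi01_ge] bounds the probability that it is neither 0 nor 1. *)
Lemma crowded_le n K l b : (forall w, Lambda alpha beta c Rv n w <= K) ->
  (P (@crowded n l b) <=
   (K ^+ 2)%:E * (m (cell C b) * m (cell C b)))%E.
Proof.
move=> LK.
have mc : measurable (@cell _ X C l b) by exact: measurable_cell.
have mE : measurable (@empty_cell n l b) by apply: F_sub; exact: empty_cell_F.
set q := fine (m (cell C b)).
have q0 : 0 <= q by rewrite fine_ge0.
have mq : m (cell C b) = q%:E by rewrite fineK// fin_num_measure.
have law k : P ([set w | [set k%:R%:E] (M n.+1 w (cell C b))] `&` @empty_cell n l b) =
    (\int[P]_(w in @empty_cell n l b) (poi (Lambda alpha beta c Rv n w * q) k)%:E)%E.
  apply: cond_law => //; first exact: empty_cell_F.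
  by move=> w; exact: empty_cell_off.
have L0 w : 0 <= Lambda alpha beta c Rv n w := Lambda_ge0 n w.
have mp k : measurable_fun (@empty_cell n l b)
    (fun w => (poi (Lambda alpha beta c Rv n w * q) k)%:E).
  apply: measurable_funTS; apply: (@poi_FT n).
  by apply: measurable_funM => //; exact: Lambda_FT.
have K0 : 0 <= K by exact: le_trans (L0 point) (LK point).
have key : (P (@empty_cell n l b) <=
    P ([set w | [set 0%:R%:E] (M n.+1 w (cell C b))] `&` @empty_cell n l b) +
    P ([set w | [set 1%:R%:E] (M n.+1 w (cell C b))] `&` @empty_cell n l b) +
    (K ^+ 2)%:E * (m (cell C b) * m (cell C b)))%E.
  rewrite !law mq -!EFinM.
  apply: (@le_trans _ _ (\int[P]_(w in @empty_cell n l b)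
      ((poi (Lambda alpha beta c Rv n w * q) 0)%:E +
       (poi (Lambda alpha beta c Rv n w * q) 1)%:E + (K ^+ 2 * (q * q))%:E))%E).
    rewrite -[leLHS]mul1e -integral_cst//; apply: ge0_le_integral => //.
    - by apply: emeasurable_funD => //; apply: emeasurable_funD.
    - move=> w _ /=; rewrite -!EFinD lee_fin.
      have := poi01_ge (mulr_ge0 (L0 w) q0).
      have : (Lambda alpha beta c Rv n w * q) ^+ 2 <= K ^+ 2 * (q * q).
        rewrite exprMn -expr2 ler_wpM2r ?exprn_ge0// lerXn2r ?nnegrE//.
      lra.
  rewrite ge0_integralD//; last 3 first.
  - by move=> w _; rewrite -EFinD lee_fin addr_ge0// poi_ge0// mulr_ge0.
  - by apply: emeasurable_funD.
  - by move=> w _; rewrite lee_fin mulr_ge0// ?exprn_ge0// mulr_ge0.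
  rewrite ge0_integralD//; last 2 first.
  - by move=> w _; rewrite lee_fin poi_ge0// mulr_ge0.
  - by move=> w _; rewrite lee_fin poi_ge0// mulr_ge0.
  rewrite leeD2l// integral_cst// -[leRHS]mule1 lee_wpmul2l//.
  - by rewrite lee_fin mulr_ge0// ?exprn_ge0// mulr_ge0.
  - exact: probability_le1.
move: key; rewrite crowdedE.
set A := [set w | [set 0%:R%:E] _]; set A' := [set w | [set 1%:R%:E] _].
have mA : measurable A by apply: measurable_Mset.
have mA' : measurable A' by apply: measurable_Mset.
have -> : P (@empty_cell n l b) = (P (A `&` @empty_cell n l b) +
    P (A' `&` @empty_cell n l b) + P (@empty_cell n l b `\` (A `|` A')))%E.
  rewrite -measureU//; first last.
  - apply/seteqP; split=> // w [[/= h0 _] [h1 _]].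
    by move: h1; rewrite /A' /= h0 => /eqP; rewrite eqe eqr_nat.
  - exact: measurableI.
  - exact: measurableI.
  rewrite -setIUl [LHS](measureDI P mE (measurableU _ _ mA mA')).
  by rewrite addeC setIC.
rewrite leeD2lE// fin_numD !fin_num_measure//; exact: measurableI.
Qed.

(** The sum is the integral over x of the mass of the cell of x, and this mass decreases to that of
    the point x, which is 0. *)
Lemma cvg_squares_cells :
  (\sum_(b : {ffun 'I_l -> bool}) m (cell C b) * m (cell C b))%E @[l --> \oo] --> 0%E.
Proof.
have -> : (fun l => (\sum_(b : {ffun 'I_l -> bool}) m (cell C b) * m (cell C b))%E) =
    (fun l => \int[m]_x (fine (m (cellx C l x)))%:E)%E.
  apply/funext => l.
  have mcode (b : {ffun 'I_l -> bool}) : measurable (code C l @^-1` [set b]).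
    exact: measurable_cell.
  rewrite (ge0_integral_finite_case m mcode)//; last first.
  - by move=> x _; rewrite lee_fin fine_ge0.
  - pose g (b : {ffun 'I_l -> bool}) (x : X) := (fine (m (cell C b)))%:E.
    apply: (@measurable_fun_finite_case _ X _ _ _ (code C l) g) => // b.
    exact: measurable_cst.
  apply: eq_bigr => b _; rewrite setTI.
  rewrite (eq_integral (fun=> m (cell C b))); last first.
    by move=> x /set_mem /= <-; rewrite fineK// fin_num_measure//; exact: measurable_cell.
  by rewrite integral_cst.
rewrite [X in _ --> X](_ : _ = \int[m]_x (fine (m [set x]))%:E)%E; last first.
  by rewrite integral0_eq// => x _; rewrite mdiff.
apply: (@bounded_convergence _ _ _ m setT _ _ 1) => //.
- move=> l; pose g (b : {ffun 'I_l -> bool}) (x : X) := fine (m (cell C b)).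
  apply: (@measurable_fun_finite_case _ X _ _ _ (code C l) g) => b.
    exact: measurable_cell.
  exact: measurable_cst.
- rewrite [X in measurable_fun _ X](_ : _ = cst 0); first exact: measurable_cst.
  by apply/funext => x; rewrite mdiff.
- apply: aeW => x _; apply: fine_cvg; rewrite fineK; last first.
    by rewrite mdiff.
  exact: (cvg_cellx mC sepC).
- move=> l x _; rewrite ger0_norm ?fine_ge0//.
  rewrite -lee_fin fineK ?fin_num_measure//; last exact: measurable_cell.
  by apply: probability_le1; exact: measurable_cell.
Qed.

(** The probability of a crowded cell at level l tends to 0, so crowding at every level from [l0] on
    is a null event. Arbitrarily fine levels without crowding are all that [simple_mu] asks for. *)
Lemma ae_uncrowded n : {ae P, forall w, forall l0, exists2 l, (l0 <= l)%N &
  forall b, ~ @crowded n l b w}.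
Proof.
have [K LK] := bndL n.
pose E l := \bigcup_(b in [set: {ffun 'I_l -> bool}]) @crowded n l b.
have mE l : measurable (E l).
  by apply: fin_bigcup_measurable => [|b _]; [exact: finite_finset|exact: measurable_crowded].
pose q l : \bar R := (\sum_(b : {ffun 'I_l -> bool}) m (cell C b) * m (cell C b))%E.
have PE l : (P (E l) <= (K ^+ 2)%:E * q l)%E.
  have -> : E l = \big[setU/set0]_(b <- index_enum {ffun 'I_l -> bool}) @crowded n l b.
    rewrite -bigcup_seq; congr bigcup.
    by apply/seteqP; split=> i //= _; rewrite mem_index_enum.
  rewrite ge0_sume_distrr => [|b _]; last by rewrite mule_ge0.
  apply: le_trans; first by apply: Boole_inequality_seq => b; exact: measurable_crowded.
  by apply: lee_sum => b _; exact: crowded_le.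
have q0 : ((K ^+ 2)%:E * q l)%E @[l --> \oo] --> 0%E.
  by rewrite -(mule0 (K ^+ 2)%:E); apply: cvgeMl => //; exact: cvg_squares_cells.
apply: ae_foralln => l0.
have mI : measurable (\bigcap_(l in [set l | (l0 <= l)%N]) E l).
  by apply: bigcap_measurableType => l _.
exists (\bigcap_(l in [set l | (l0 <= l)%N]) E l); split=> //; last first.
  move=> w /= h l /= ll; apply: contrapT => h'; apply: h; exists l => // b hb.
  by apply: h'; exists b.
apply/eqP; rewrite -measure_le0 -(cvg_lim (@ereal_hausdorff R) q0).
apply: lime_ge; first by apply/cvg_ex; exists 0%E.
exists l0 => // l /= ll; apply: le_trans (PE l).
by apply: le_measure; [exact: mem_set|exact: mem_set|exact: bigcap_inf].
Qed.

Lemma ae_nat_cells : {ae P, forall w, forall n l (J : {set {ffun 'I_l -> bool}}),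
  natE (M n.+1 w (B `&` code C l @^-1` [set` J])) /\
  natE (M n.+1 w (code C l @^-1` [set` J]))}.
Proof.
apply: ae_foralln => n; apply: ae_foralln => l.
apply: filter_forall => J.
have mJ : measurable (code C l @^-1` [set` J]) by exact: measurable_code.
have nat_ae A : measurable A -> {ae P, forall w, natE (M n.+1 w A)}.
  move=> mA; exists [set w | ~ natE (M n.+1 w A)]; split=> //.
    apply: (@measurable_Mset n A (~` natE)) => //.
    by apply: measurableC; exact: measurable_natE.
  exact: ae_natE.
apply: filterS2 (nat_ae _ (measurableI _ _ mB mJ)) (nat_ae _ mJ).
by move=> w.
Qed.

(** The first and last clauses are the pathwise hypotheses [nat_mu] and [simple_mu]; the middle one
    makes [hit] eventually constant in l. *)
Definition good w := [/\
  (forall i l b, (1 <= i)%N -> natE (M i w (@cell _ X C l b))),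
  (forall n l, natE (hit n l w)) &
  (forall n l0, exists2 l, (l0 <= l)%N & forall b,
     (forall i, (1 <= i <= n)%N -> M i w (@cell _ X C l b) = 0%E) ->
     (M n.+1 w (@cell _ X C l b) <= 1)%E)].

Lemma ae_good : {ae P, forall w, good w}.
Proof.
have hu : {ae P, forall w, forall n, forall l0, exists2 l, (l0 <= l)%N &
  forall b, ~ @crowded n l b w}.
  by apply: ae_foralln => n; exact: ae_uncrowded.
apply: filterS2 ae_nat_cells hu => w hn {}hu; split.
- move=> [//|i] l b _; have [_] := hn i l [set b]%SET.
  congr (natE (M _ _ _)); apply/seteqP; split=> x /=; rewrite inE.
    by move=> /eqP.
  by move=> ->.
- by move=> n l; rewrite /hit unhitE; have [] := hn n l (empty_cells n l w).
- move=> n l0; have [l ll hl] := hu n l0; exists l => // b hb.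
  rewrite leNgt; apply/negP => h1; apply: (hl b); split=> //.
  by split; apply/eqP => e; move: h1; rewrite e ?ltxx// lte_fin ltr10.
Qed.

(** For [good] outcomes the union is the complement of [S_]. This form keeps the quantity measurable
    on all of [Omega], as a limit of [hit]. *)
Definition new_points n w : R :=
  fine (M n.+1 w (B `&` \bigcup_l unhit C (M^~ w) n l)).

Lemma cvg_hit n w : hit n l w @[l --> \oo] --> (new_points n w)%:E.
Proof.
have mU l : measurable (B `&` unhit C (M^~ w) n l).
  by apply: measurableI => //; exact: measurable_unhit.
rewrite /new_points fineK; last first.
  by apply: fin_num_measure; rewrite setI_bigcupr; exact: bigcup_measurable.
rewrite setI_bigcupr; apply: (@nondecreasing_cvg_mu _ _ _ (M n.+1 w)) => //.
  exact: bigcup_measurable.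
move=> l l' ll; apply/subsetPset; apply: setIS.
exact/subsetPset/(unhit_nondecreasing mC).
Qed.

Lemma new_points_FT n : measurable_fun [set: FT n.+1] (new_points n).
Proof.
apply/measurable_EFinP.
apply: (@emeasurable_fun_cvg _ (FT n.+1) _ _ (hit n)) => [l|w _].
  exact: hit_FT.
exact: cvg_hit.
Qed.

Lemma new_points_ge0 n w : 0 <= new_points n w.
Proof. exact: fine_ge0. Qed.

Lemma good_hit n w : good w -> \forall l \near \oo, hit n l w = (new_points n w)%:E.
Proof.
by move=> [_ h _]; apply: cvg_nat_eventually; [move=> l; exact: h|exact: cvg_hit].
Qed.

(** The sets [unhit] increase to the complement of the finite set [S_], which the diffuse [m] does
    not charge. *)
Lemma good_rate n w : good w ->
  rate n l w @[l --> \oo] --> Lambda alpha beta c Rv n w * fine (m B).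
Proof.
move=> [hn _ hs]; apply: cvgM; first exact: cvg_cst.
have mU l : measurable (B `&` unhit C (M^~ w) n l).
  by apply: measurableI => //; exact: measurable_unhit.
have mS : measurable (points (M^~ w) n) by exact: measurable_points.
have -> : m B = m (\bigcup_l (B `&` unhit C (M^~ w) n l)).
  rewrite -setI_bigcupr (bigcup_unhitE mC sepC hn hs).
  rewrite [LHS](measureDI m mB mS) -setDE.
  rewrite [X in (_ + X)%E](_ : _ = 0%E) ?adde0//.
  apply/eqP; rewrite -measure_le0.
  apply: (@le_trans _ _ (m (points (M^~ w) n))).
    by apply: le_measure; [apply: mem_set; exact: measurableI|exact: mem_set|by move=> x []].
  have -> : points (M^~ w) n = \bigcup_(x in points (M^~ w) n) [set x].
    by apply/seteqP; split=> x /=; [exists x|move=> [i iD ->]].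
  rewrite measure_fin_bigcup//.
  - by rewrite fsbig1// => x _; exact: mdiff.
  - exact: (finite_points mC sepC hn).
  - by move=> i j _ _ [x [/= <- <-]].
  - by move=> x _; exact: (measurable_singleton mC sepC).
apply: fine_cvg; rewrite fineK; last first.
  by apply: fin_num_measure; exact: bigcup_measurable.
apply: (@nondecreasing_cvg_mu _ _ _ m) => //; first exact: bigcup_measurable.
move=> l l' ll; apply/subsetPset; apply: setIS.
exact/subsetPset/(unhit_nondecreasing mC).
Qed.

(** Both sides of [hit_law] pass to the limit in l by bounded convergence: almost surely the
    indicators are eventually constant and the rates converge. *)
Lemma new_points_law n k H : F_ M Rv n H ->
  P (new_points n @^-1` [set k%:R] `&` H) =
  (\int[P]_(w in H) (poi (Lambda alpha beta c Rv n w * fine (m B)) k)%:E)%E.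
Proof.
move=> FH; have mH : measurable H by exact: F_sub FH.
have mc : measurable (new_points n @^-1` [set k%:R]).
  by rewrite -[X in measurable X]setTI; apply: (FT_fun (@new_points_FT n)).
have mh l : measurable (hit n l @^-1` [set k%:R%:E]).
  by rewrite -[X in measurable X]setTI; apply: (FT_fun (@hit_FT n l)).
have h1 : P (hit n l @^-1` [set k%:R%:E] `&` H) @[l --> \oo] -->
    P (new_points n @^-1` [set k%:R] `&` H).
  rewrite -integral_indic//.
  under eq_fun do rewrite -integral_indic//.
  apply: (@bounded_convergence _ _ _ P _ _ _ 1) => //.
  - by move=> l; apply: measurable_funTS; exact: measurable_indic.
  - apply: filterS ae_good => w gw _; apply: cvg_near_cst.
    apply: filterS (good_hit n gw) => l hl; rewrite !indicE; congr (_%:R).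
    congr (nat_of_bool _); apply/idP/idP => /set_mem /= h; apply/mem_set => /=.
      by move: h; rewrite hl => -[].
    by rewrite hl h.
  - by move=> l w _; rewrite indicE; case: (_ \in _); rewrite ?normr1 ?normr0.
have h2 : P (hit n l @^-1` [set k%:R%:E] `&` H) @[l --> \oo] -->
    (\int[P]_(w in H) (poi (Lambda alpha beta c Rv n w * fine (m B)) k)%:E)%E.
  under eq_fun do rewrite hit_law//.
  apply: (@bounded_convergence _ _ _ P _ _ _ 1) => //.
  - move=> l; apply: measurable_funTS; apply/measurable_EFinP/(@poi_FT n).
    exact: rate_FT.
  - apply: measurable_funTS; apply/measurable_EFinP/(@poi_FT n).
    by apply: measurable_funM => //; exact: Lambda_FT.
  - apply: filterS ae_good => w gw _.
    by apply: cvg_poi; exact: good_rate.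
  - move=> l w _; rewrite ger0_norm ?poi_le1 ?poi_ge0//; exact: rate_ge0.
exact: cvg_unique h1 h2.
Qed.

Lemma good_new_points n w : good w -> exists k : nat, new_points n w = k%:R.
Proof.
move=> gw; have [_ hn _] := gw; have [l _ hl] := good_hit n gw.
by have [k] := hn n l; rewrite hl//= => -[->]; exists k.
Qed.

(** [new_points_law] is summed over k, the value being almost surely a natural number. The
    martingale part knows the conditional Poisson law only through this identity. *)
Lemma new_points_mgf n t H : F_ M Rv n H ->
  (\int[P]_(w in H) (expR (t * new_points n w))%:E =
   \int[P]_(w in H)
     (expR (Lambda alpha beta c Rv n w * fine (m B) * (expR t - 1)))%:E)%E.
Proof.
move=> FH; have mH : measurable H by exact: F_sub FH.
have mc k : measurable (new_points n @^-1` [set k%:R]).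
  by rewrite -[X in measurable X]setTI; apply: (FT_fun (@new_points_FT n)).
have mL : measurable_fun [set: Omega]
    (fun w => Lambda alpha beta c Rv n w * fine (m B)).
  by apply: (@FT_fun n); apply: measurable_funM => //; exact: Lambda_FT.
have L0 w : 0 <= Lambda alpha beta c Rv n w * fine (m B).
  by rewrite mulr_ge0 ?Lambda_ge0 ?fine_ge0.
have -> : (\int[P]_(w in H)
    (expR (Lambda alpha beta c Rv n w * fine (m B) * (expR t - 1)))%:E =
    \sum_(k <oo) (expR (t * k%:R))%:E * P (new_points n @^-1` [set k%:R] `&` H))%E.
  under eq_integral do rewrite -nneseries_poi_mgf//.
  rewrite integral_nneseries//.
  - apply: eq_eseriesr => k _; rewrite new_points_law// -ge0_integralZl_EFin//.
    + by apply: eq_integral => w _; rewrite mulrC EFinM.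
    + by move=> w _; rewrite lee_fin poi_ge0.
    + apply: measurable_funTS; apply: (@poi_FT n).
      by apply: measurable_funM => //; exact: Lambda_FT.
  - move=> k; apply/measurable_EFinP/measurable_funM => //.
    apply/measurable_funTS/measurable_EFinP/(@poi_FT n).
    by apply: measurable_funM => //; exact: Lambda_FT.
  - by move=> k w _; rewrite lee_fin mulr_ge0 ?expR_ge0 ?poi_ge0.
transitivity (\int[P]_(w in H) (\sum_(k <oo)
    (expR (t * k%:R) * \1_(new_points n @^-1` [set k%:R]) w)%:E))%E.
  apply: ge0_ae_eq_integral => //.
  - apply/measurable_EFinP/measurable_funTS; apply: measurableT_comp => //.
    by apply: measurable_funM => //; exact: (FT_fun (@new_points_FT n)).
  - apply: ge0_emeasurable_sum => [k w _ _|k _].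
      by rewrite lee_fin mulr_ge0 ?expR_ge0.
    by apply/measurable_EFinP/measurable_funTS; apply: measurable_funM.
  - move=> w _; apply: nneseries_ge0 => k _ _.
    by rewrite lee_fin mulr_ge0 ?expR_ge0.
  apply: filterS ae_good => w gw _; have [j wj] := good_new_points n gw.
  rewrite (@nneseriesD1 _ _ j)//.
  rewrite eseries0 ?adde0; last first.
    move=> k _ /= kj; rewrite indicE memNset ?mulr0//= wj => /eqP.
    by rewrite eqr_nat eq_sym (negbTE kj).
  by rewrite indicE (mem_set (wj : (new_points n @^-1` [set j%:R]) w)) mulr1 wj.
rewrite integral_nneseries//.
- apply: eq_eseriesr => k _; rewrite -integral_indic// -ge0_integralZl_EFin//.
  + exact/measurable_EFinP/measurable_funTS/measurable_indic.
- move=> k; apply/measurable_EFinP/measurable_funTS; exact: measurable_funM.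
Qed.

Lemma ae_L_new_points : {ae P, forall w, forall n,
  L_ M n B w = \sum_(i < n) new_points i w}.
Proof.
apply: filterS ae_good => w [hn hh hs] n.
suff : (\esum_(x in B `&` points (M^~ w) n) 1 = (\sum_(i < n) new_points i w)%:E)%E.
  by rewrite /L_ => ->.
elim: n => [|n IH].
  rewrite big_ord0 (_ : points _ 0 = set0) ?setI0 ?esum_set0//.
  by apply/seteqP; split=> // x [i]; case: i.
rewrite card_points_S IH big_ord_recr /= EFinD; congr (_ + _)%E.
rewrite -(card_new_points mC sepC hn hs n mB) /new_points.
rewrite (bigcup_unhitE mC sepC hn hs) fineK//; apply: fin_num_measure.
by apply: measurableI => //; apply: measurableC; exact: measurable_points.
Qed.

End limit.

End model.

(** * Exponential martingales and the strong law *)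

Section sub_sigma_algebra.
Context {R : realType} {d} {T : measurableType d} (mu : {measure set T -> \bar R}).
Variable G : set (set T).
Hypothesis Gsub : <<s G >> `<=` measurable.
Local Notation TG := (g_sigma_algebraType G).

Lemma measurable_fun_sub d' (T' : measurableType d') (f : T -> T') :
  measurable_fun [set: TG] f -> measurable_fun [set: T] f.
Proof.
move=> mf _ E mE; rewrite setTI; apply: Gsub.
by have := mf measurableT E mE; rewrite setTI.
Qed.

Import HBNNSimple.

Lemma integral_nnsfun_mul (h : {nnsfun TG >-> R}) (f : T -> R) :
  measurable_fun setT f -> (forall x, 0 <= f x) ->
  (\int[mu]_x (h x * f x)%:E = \sum_(i < #|` fset_set (range h)|)
     ((fset_set (range h))`_i)%:E *
     \int[mu]_(x in h @^-1` [set (fset_set (range h))`_i]) (f x)%:E)%E.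
Proof.
move=> mf f0; set s := fset_set (range h).
have s0 (i : 'I_#|` s|) : 0 <= s`_i.
  have : s`_i \in s by exact: mem_nth.
  by rewrite in_fset_set// => /set_mem[x _ <-]; exact: fun_ge0.
have mA y : measurable (h @^-1` [set y] : set T).
  apply: Gsub; change (@measurable _ TG (h @^-1` [set y])).
  exact: measurable_funPTI.
have m1 (i : 'I_#|` s|) : measurable_fun [set: T]
    (fun x : T => (s`_i * \1_(h @^-1` [set s`_i] : set T) x * f x)%:E).
  apply/measurable_EFinP; apply: measurable_funM => //.
  by apply: measurable_funM => //; exact: measurable_indic.
transitivity (\int[mu]_x (\sum_(i < #|` s|)
    (s`_i * \1_(h @^-1` [set s`_i]) x * f x)%:E))%E.
  by apply: eq_integral => x _; rewrite sumEFin -mulr_suml -fimfunEord.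
rewrite ge0_integral_sum//; last first.
  by move=> i x _; rewrite lee_fin !mulr_ge0.
apply: eq_bigr => i _; rewrite -ge0_integralZl_EFin//; last 2 first.
- by move=> x _; rewrite lee_fin.
- by apply: measurable_funTS; exact/measurable_EFinP.
rewrite [RHS]integral_mkcond; apply: eq_integral => x _.
by rewrite patchE indicE; case: ifPn => hx; rewrite ?mulr1 ?mulr0 ?mul0r.
Qed.

(** The pull-out property of conditional expectation in integrated form: equality on events extends
    to simple functions, then to Y by monotone convergence. Nonnegativity spares every integrability
    condition. *)
Lemma integral_mul_sub (f g : T -> R) (Y : T -> R) :
  measurable_fun setT f -> (forall x, 0 <= f x) ->
  measurable_fun setT g -> (forall x, 0 <= g x) ->
  (forall H, @measurable _ TG H ->
    \int[mu]_(x in H) (f x)%:E = \int[mu]_(x in H) (g x)%:E)%E ->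
  measurable_fun [set: TG] Y -> (forall x, 0 <= Y x) ->
  (\int[mu]_x (Y x * f x)%:E = \int[mu]_x (Y x * g x)%:E)%E.
Proof.
move=> mf f0 mg g0 fg mY Y0.
have mEY : measurable_fun [set: TG] (EFin \o Y) by exact/measurable_EFinP.
pose h := nnsfun_approx measurableT mEY.
have hY x : h n x @[n --> \oo] --> Y x.
  have /fine_cvg : (h n x)%:E @[n --> \oo] --> (Y x)%:E.
    by apply: (cvg_nnsfun_approx measurableT mEY) => // y _; rewrite lee_fin.
  exact.
have lim_h (k : T -> R) : measurable_fun setT k -> (forall x, 0 <= k x) ->
    (\int[mu]_x (h n x * k x)%:E)%E @[n --> \oo] --> (\int[mu]_x (Y x * k x)%:E)%E.
  move=> mk k0.
  have -> : (\int[mu]_x (Y x * k x)%:E)%E =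
      (\int[mu]_x limn (fun n => (h n x * k x)%:E))%E.
    apply: eq_integral => x _; apply/esym/cvg_lim => //.
    apply: cvg_EFin; first exact: nearW.
    by apply: cvgM; [exact: hY|exact: cvg_cst].
  apply: cvg_monotone_convergence => //.
  - move=> n; apply/measurable_EFinP; apply: measurable_funM => //.
    exact: measurable_fun_sub.
  - by move=> n x _; rewrite lee_fin mulr_ge0.
  - move=> x _ i j ij; rewrite lee_fin ler_wpM2r//.
    by have /lefP := @nd_nnsfun_approx _ TG _ _ measurableT _ mEY i j ij; apply.
apply: (cvg_unique _ (lim_h f mf f0)) => //.
have -> : (fun n => \int[mu]_x (h n x * f x)%:E)%E =
    (fun n => \int[mu]_x (h n x * g x)%:E)%E; last exact: lim_h.
apply/funext => n; rewrite !integral_nnsfun_mul//; apply: eq_bigr => i _.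
by rewrite fg//; exact: measurable_funPTI.
Qed.

End sub_sigma_algebra.

Section markov.
Context {R : realType} {d} {T : measurableType d} (mu : {measure set T -> \bar R}).

Lemma markov_set (A : set T) (f : T -> R) (c : R) : measurable A ->
  measurable_fun setT f -> (forall x, 0 <= f x) -> 0 <= c ->
  (forall x, A x -> c <= f x) -> (c%:E * mu A <= \int[mu]_x (f x)%:E)%E.
Proof.
move=> mA mf f0 c0 cf; rewrite -integral_cst//.
apply: (@le_trans _ _ (\int[mu]_(x in A) (f x)%:E)%E).
  apply: ge0_le_integral => //.
  by apply: measurable_funTS; exact/measurable_EFinP.
apply: ge0_subset_integral => //; first exact/measurable_EFinP.
by move=> x _; rewrite lee_fin.
Qed.

Lemma borel_cantelli_ae (F : nat -> set T) (q C : R) :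
  (forall n, measurable (F n)) -> 0 <= q < 1 -> 0 <= C ->
  (forall n, (mu (F n) <= (C * q ^+ n)%:E)%E) ->
  {ae mu, forall x, \forall n \near \oo, ~ F n x}.
Proof.
move=> mF /andP[q0 q1] C0 muF.
exists (lim_sup_set F); split.
- apply: bigcap_measurableType => k _; exact: bigcup_measurable.
- apply: lim_sup_set_cvg0 => //.
  apply: (@le_lt_trans _ _ (\sum_(n <oo) (geometric C q n)%:E)%E).
    by apply: lee_nneseries => // n _; exact: muF.
  have cg : cvgn (series (geometric C q)).
    by apply: is_cvg_geometric_series; rewrite ger0_norm.
  have -> : (\sum_(n <oo) (geometric C q n)%:E)%E = (limn (series (geometric C q)))%:E.
    apply/cvg_lim => //.
    have -> : (fun n => \sum_(0 <= k < n) (geometric C q k)%:E)%E =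
        EFin \o series (geometric C q).
      by apply/funext => n; rewrite /= sumEFin.
    by apply: cvg_EFin; [exact: nearW|exact: cg].
  exact: ltry.
- move=> x /= h n _; apply: contrapT => h'; apply: h; exists n => // k /= nk Fk.
  by apply: h'; exists k.
Qed.

End markov.

(** * From a subsequence to the whole sequence *)

Section subsequence.
Context {R : realType} (a : nat -> R).
Hypothesis a_ge0 : forall n, 0 <= a n.
Hypothesis a_nd : forall i j, (i <= j)%N -> a i <= a j.
Hypothesis a_step : forall n, a n.+1 <= a n + 1.
Hypothesis a_oo : a @ \oo --> +oo.

Let ex_level (j : nat) : exists n, j%:R <= a n.
Proof.
by have [n _ /(_ n (leqnn n))] := (cvgryPge a).1 a_oo j%:R; exists n.
Qed.

(* Convergence along these indices extends to all indices by monotonicity,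
   because a grows by steps of at most 1. *)
Definition level j : nat := ex_minn (ex_level j).

Lemma level_ge j : j%:R <= a (level j).
Proof. by rewrite /level; case: ex_minnP. Qed.

Lemma level_le j n : j%:R <= a n -> (level j <= n)%N.
Proof. by rewrite /level; case: ex_minnP => k _ h; exact: h. Qed.

(** If j is the integer part of [a n], then n lies between [level j] and [level j.+1], and for large
    j the value of a at [level j] lies between j and j + 1. Monotonicity of u then squeezes u n / a
    n between the quotients along [level], up to the factors j / (j + 1) and (j + 2) / j. *)
Lemma cvg_level (u : nat -> R) (v : R) : (forall i j, (i <= j)%N -> u i <= u j) ->
  0 <= u 0%N -> u (level j) / a (level j) @[j --> \oo] --> v ->
  u n / a n @[n --> \oo] --> v.
Proof.
move=> u_nd u0 uv.
have u_ge0 n : 0 <= u n by apply: le_trans u0 (u_nd _ _ _).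
(* The condition on [a 0] makes [level j] positive; its predecessor is below j by minimality, and
   one step adds at most 1. *)
have upper j : (0 < j)%N -> a 0%N < j%:R -> a (level j) <= j%:R + 1.
  move=> j0 aj; have := level_ge j; have := @level_le j.
  case: (level j) => [_|k h _]; first by rewrite leNgt aj.
  apply: le_trans (a_step k) _; rewrite lerD2r; apply: ltW; rewrite ltNge.
  by apply/negP => /h; rewrite ltnn.
pose t n := truncn (a n).
have t_oo : t @ \oo --> \oo.
  apply/cvgnyPge => A; move/cvgryPge : (a_oo) => /(_ A%:R).
  apply: filterS => n An; rewrite /t -(ler_nat R).
  by rewrite ler_nat truncn_ge_nat.
have tle n : (t n)%:R <= a n by have /andP[] := truncn_itv (a_ge0 n).
have tlt n : a n < (t n).+1%:R by have /andP[] := truncn_itv (a_ge0 n).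
have lo : u (level j) / a (level j) * (j%:R / j.+1%:R) @[j --> \oo] --> v.
  rewrite -[v in _ --> v]mulr1; apply: cvgM => //.
  have -> : (fun j => j%:R / j.+1%:R : R) = (fun j => 1 - harmonic j).
    apply/funext => j; rewrite /harmonic /= -natr1.
    by field; rewrite natr1.
  rewrite -[X in _ --> X]subr0; apply: cvgB; first exact: cvg_cst.
  exact: cvg_harmonic.
(* Stated with j.+1 in the role of j, so that no denominator vanishes; it is later composed with the
   predecessor of [t n]. *)
have hi : u (level j.+2) / a (level j.+2) * (j.+3%:R / j.+1%:R) @[j --> \oo] --> v.
  rewrite -[v in _ --> v]mulr1; apply: cvgM.
    pose f j := u (level j) / a (level j).
    rewrite (_ : (fun j => _) = [sequence f (n + 2)%N]_n) ?(cvg_shiftn 2 f)//.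
    by apply/funext => j; rewrite /= addn2.
  have -> : (fun j => j.+3%:R / j.+1%:R : R) = (fun j => 1 + 2 * harmonic j).
    apply/funext => j; rewrite /harmonic /= -addn2 natrD.
    by field.
  rewrite -[X in _ --> X]addr0; apply: cvgD; first exact: cvg_cst.
  by rewrite -[X in _ --> X](mulr0 2); apply: cvgM; [exact: cvg_cst|exact: cvg_harmonic].
have t1_oo : (fun n => (t n).-1) @ \oo --> \oo.
  apply/cvgnyPge => A; move/cvgnyPge : (t_oo) => /(_ A.+1).
  by apply: filterS => n; case: (t n).
have {}lo := cvg_comp _ _ t_oo lo.
have {}hi := cvg_comp _ _ t1_oo hi.
apply: (squeeze_cvgr _ lo hi).
move/cvgnyPge : (t_oo) => /(_ (truncn (a 0%N)).+2).
apply: filterS => n tn /=.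
have t0 : (0 < t n)%N by apply: leq_trans tn.
have -> : ((t n).-1.+1 = t n)%N by rewrite prednK.
have tn0 : 0 < (t n)%:R :> R by rewrite ltr0n.
have an0 : 0 < a n by apply: lt_le_trans (tle n).
have al j : (0 < j)%N -> 0 < a (level j).
  by move=> j0; apply: lt_le_trans (level_ge j); rewrite ltr0n.
apply/andP; split.
- have le1 : (t n)%:R / a (level (t n)) <= 1.
    by rewrite ler_pdivrMr ?al// mul1r level_ge.
  apply: (@le_trans _ _ (u n / (t n).+1%:R)); last first.
    by rewrite ler_wpM2l// lef_pV2 ?posrE// ltW.
  rewrite (_ : _ * _ = u (level (t n)) / (t n).+1%:R * ((t n)%:R / a (level (t n)))); last first.
    by ring.
  apply: (@le_trans _ _ (u (level (t n)) / (t n).+1%:R)).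
    by rewrite ler_piMr// divr_ge0.
  by rewrite ler_wpM2r ?invr_ge0//; apply: u_nd; apply: level_le.
- have nlev : (n <= level (t n).+1)%N.
    rewrite leqNgt; apply/negP => /ltnW /a_nd.
    by rewrite leNgt (lt_le_trans (tlt n))// level_ge.
  apply: (@le_trans _ _ (u (level (t n).+1) / (t n)%:R)).
    apply: (@le_trans _ _ (u (level (t n).+1) / a n)).
      by rewrite ler_wpM2r ?invr_ge0//; exact: u_nd.
    by rewrite ler_wpM2l// lef_pV2 ?posrE.
  rewrite (_ : _ * (_ / _) = u (level (t n).+1) / (t n)%:R *
    ((t n).+2%:R / a (level (t n).+1))); last by ring.
  rewrite ler_peMr ?divr_ge0// ler_pdivlMr ?al// mul1r.
  have := upper (t n).+1 isT; rewrite -natr1 -[(t n).+2%:R]natr1 -natr1; apply.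
  rewrite natr1; apply: lt_trans (truncnS_gt _) _; rewrite ltr_nat.
  exact: ltn_trans tn.
Qed.

End subsequence.

(** * Exponential martingales of conditionally Poisson increments *)

Section poisson_increments.
Context {R : realType} {d} {T : measurableType d} (P : probability T R).
Variable G : nat -> set (set T).
Hypothesis Gsub : forall n, <<s G n >> `<=` measurable.
Hypothesis Gmono : forall n, <<s G n >> `<=` <<s G n.+1 >>.
Local Notation TG n := (g_sigma_algebraType (G n)).
Variables (N lam : nat -> T -> R).
Hypothesis mN : forall n, measurable_fun [set: TG n.+1] (N n).
Hypothesis mlam : forall n, measurable_fun [set: TG n] (lam n).
Hypothesis lam_ge0 : forall n w, 0 <= lam n w.
Hypothesis N_mgf : forall n t H, @measurable _ (TG n) H ->
  (\int[P]_(w in H) (expR (t * N n w))%:E =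
   \int[P]_(w in H) (expR (lam n w * (expR t - 1)))%:E)%E.

Definition total n w := \sum_(i < n) N i w.
Definition compensator n w := \sum_(i < n) lam i w.
(* A martingale, since N n is Poisson of parameter lam n given the past. *)
Definition emart (t : R) n w := expR (t * total n w - (expR t - 1) * compensator n w).

Lemma measurable_fun_le d' (T' : measurableType d') (f : T -> T') k n :
  (k <= n)%N -> measurable_fun [set: TG k] f -> measurable_fun [set: TG n] f.
Proof.
elim: n => [|n IH]; first by rewrite leqn0 => /eqP->.
rewrite leq_eqVlt ltnS => /predU1P[->//|/IH + mf] => /(_ mf) {}mf _ E mE.
by apply: Gmono; exact: mf.
Qed.

Lemma measurable_total n : measurable_fun [set: TG n] (total n).
Proof.
by apply: measurable_sum => i; apply: measurable_fun_le; last exact: mN.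
Qed.

Lemma measurable_comp n k : (n <= k.+1)%N -> measurable_fun [set: TG k] (compensator n).
Proof.
move=> nk; apply: measurable_sum => i; apply: measurable_fun_le; last exact: mlam.
by rewrite -ltnS (leq_trans (ltn_ord i)).
Qed.

Lemma measurable_emart t n : measurable_fun [set: TG n] (emart t n).
Proof.
apply: measurableT_comp => //; apply: measurable_funB.
  by apply: measurable_funM => //; exact: measurable_total.
by apply: measurable_funM => //; exact: measurable_comp.
Qed.

Lemma emart_gt0 t n w : 0 < emart t n w. Proof. exact: expR_gt0. Qed.

Lemma emart0 t w : emart t 0 w = 1.
Proof. by rewrite /emart /total /compensator !big_ord0 !mulr0 subrr expR0. Qed.

(** The compensator is predictable: [compensator n.+1] is known at time n, so all factors but
    [expR (t * N n w)] can be pulled out before [N_mgf] is applied. *)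
Lemma emart_step t n (Y : T -> R) : measurable_fun [set: TG n] Y ->
  (forall w, 0 <= Y w) ->
  (\int[P]_w (Y w * emart t n.+1 w)%:E = \int[P]_w (Y w * emart t n w)%:E)%E.
Proof.
move=> mY Y0.
pose Y' w := Y w * expR (t * total n w - (expR t - 1) * compensator n.+1 w).
have mY' : measurable_fun [set: TG n] Y'.
  apply: measurable_funM => //; apply: measurableT_comp => //.
  apply: measurable_funB.
    by apply: measurable_funM => //; exact: measurable_total.
  by apply: measurable_funM => //; exact: measurable_comp.
have Y'0 w : 0 <= Y' w by rewrite mulr_ge0 ?expR_ge0.
transitivity (\int[P]_w (Y' w * expR (t * N n w))%:E)%E.
  apply: eq_integral => w _; congr _%:E; rewrite /Y' /emart -mulrA -expRD.
  by congr (_ * expR _); rewrite /total big_ord_recr /=; ring.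
etransitivity.
  apply: (@integral_mul_sub _ _ _ P _ (@Gsub n) _
    (fun w => expR (lam n w * (expR t - 1))) Y') => //.
  - apply: measurableT_comp => //; apply: measurable_funM => //.
    by apply: (measurable_fun_sub (@Gsub n.+1)); exact: mN.
  - apply: measurableT_comp => //; apply: measurable_funM => //.
    by apply: (measurable_fun_sub (@Gsub n)); exact: mlam.
  - by move=> H; exact: N_mgf.
apply: eq_integral => w _; congr _%:E; rewrite /Y' /emart -mulrA -expRD.
by congr (_ * expR _); rewrite /compensator big_ord_recr /=; ring.
Qed.

Lemma emart_integral t k n (Y : T -> R) : (k <= n)%N ->
  measurable_fun [set: TG k] Y -> (forall w, 0 <= Y w) ->
  (\int[P]_w (Y w * emart t n w)%:E = \int[P]_w (Y w * emart t k w)%:E)%E.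
Proof.
move=> + mY Y0; elim: n => [|n IH]; first by rewrite leqn0 => /eqP->.
rewrite leq_eqVlt ltnS => /predU1P[->//|kn]; rewrite -IH//.
by apply: emart_step => //; exact: measurable_fun_le mY.
Qed.

Lemma emart_integral1 t n : (\int[P]_w (emart t n w)%:E = 1)%E.
Proof.
have := @emart_integral t 0%N n (cst 1) (leq0n n) (measurable_cst _)
  (fun=> ler01).
under eq_integral do rewrite mul1r.
move=> ->; under eq_integral do rewrite mul1r emart0.
by rewrite integral_cst// mul1e; exact: probability_setT.
Qed.

Variables (a : nat -> R) (K : R).
Hypothesis N_ge0 : forall n w, 0 <= N n w.
Hypothesis a_ge0 : forall n, 0 <= a n.
Hypothesis a_nd : forall i j, (i <= j)%N -> a i <= a j.
Hypothesis a_step : forall n, a n.+1 <= a n + 1.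
Hypothesis a_oo : a @ \oo --> +oo.
Hypothesis K_gt0 : 0 < K.
Hypothesis comp_le : forall n w, (2 <= n)%N -> compensator n w <= K * a n.

Lemma comp_ge0 n w : 0 <= compensator n w.
Proof. by apply: sumr_ge0 => i _. Qed.

Lemma total_nd w i j : (i <= j)%N -> total i w <= total j w.
Proof.
move=> /subnKC <-; rewrite /total big_split_ord /= lerDl.
by apply: sumr_ge0 => k _.
Qed.

Lemma mT_total n : measurable_fun [set: T] (total n).
Proof. by apply: (measurable_fun_sub (@Gsub n)); exact: measurable_total. Qed.

Lemma mT_comp n : measurable_fun [set: T] (compensator n).
Proof.
by apply: (measurable_fun_sub (@Gsub n)); apply: measurable_comp; exact: leqW.
Qed.

Lemma mT_emart t n : measurable_fun [set: T] (emart t n).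
Proof. by apply: (measurable_fun_sub (@Gsub n)); exact: measurable_emart. Qed.

Lemma expR_centered t n w : expR (t * (total n w - compensator n w)) =
  emart t n w * expR ((expR t - 1 - t) * compensator n w).
Proof. by rewrite /emart -expRD; congr expR; ring. Qed.

Lemma expR_phi_le t n w : (2 <= n)%N -> `|t| <= 1 ->
  expR ((expR t - 1 - t) * compensator n w) <= expR (K * expR 1 * t ^+ 2 * a n).
Proof.
move=> n2 t1; rewrite ler_expR.
have h : expR t - 1 - t <= t ^+ 2 * expR 1.
  apply: le_trans (ler_norm _) _.
  have := expR_taylor t 2; rewrite !big_ord_recr big_ord0 /= add0r expr0 expr1.
  rewrite fact0 (_ : 1`!%:R = 1 :> R)// !divr1 opprD addrA => /le_trans; apply.
  rewrite real_normK ?num_real// -mulrA ler_wpM2l ?sqr_ge0//.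
  rewrite ler_pdivrMl ?ltr0n ?fact_gt0//.
  have : expR `|t| <= expR 1 by rewrite ler_expR.
  have := expR_gt0 (1 : R); rewrite (_ : 2`!%:R = 2 :> R)//; lra.
have e0 : 0 <= t ^+ 2 * expR 1 by rewrite mulr_ge0 ?sqr_ge0 ?expR_ge0.
apply: (@le_trans _ _ (t ^+ 2 * expR 1 * compensator n w)).
  by rewrite ler_wpM2r ?comp_ge0.
apply: (@le_trans _ _ (t ^+ 2 * expR 1 * (K * a n))).
  by rewrite ler_wpM2l// comp_le.
by rewrite le_eqVlt; apply/orP; left; apply/eqP; ring.
Qed.

Lemma centered_mgf_le t n : (2 <= n)%N -> `|t| <= 1 ->
  (\int[P]_w (expR (t * (total n w - compensator n w)))%:E <=
   (expR (K * expR 1 * t ^+ 2 * a n))%:E)%E.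
Proof.
move=> n2 t1.
rewrite -[leRHS]mule1 -(emart_integral1 t n) -ge0_integralZl_EFin//; last 2 first.
- by move=> w _; rewrite lee_fin expR_ge0.
- by apply/measurable_EFinP; exact: mT_emart.
apply: ge0_le_integral => //.
- apply/measurable_EFinP; apply: measurableT_comp => //.
  by apply: measurable_funM => //; apply: measurable_funB; [exact: mT_total|exact: mT_comp].
- by apply/measurable_EFinP; apply: measurable_funM => //; exact: mT_emart.
- move=> w _; rewrite -EFinM lee_fin expR_centered mulrC.
  by rewrite ler_wpM2r ?expR_ge0// expR_phi_le.
Qed.

Lemma chernoff (eps : R) : 0 < eps -> exists2 kap, 0 < kap &
  forall n, (2 <= n)%N ->
    (P [set w | (eps * a n <= `|total n w - compensator n w|)%R]
       <= (2 * expR (- kap * a n))%:E)%E.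
Proof.
move=> e0; set c := K * expR 1.
have c0 : 0 < c by rewrite mulr_gt0 ?expR_gt0.
(* With this t the quadratic term c t^2 a_n is at most half of the gain t eps a_n, and the other
   half gives the constant [kap]. The minimum with 1 is what [centered_mgf_le] needs. *)
set t := Num.min 1 (eps / (2 * c)).
have t0 : 0 < t by rewrite lt_min ltr01 divr_gt0 ?mulr_gt0.
have t1 : t <= 1 by rewrite ge_min lexx.
have tc : c * t <= eps / 2.
  have : t <= eps / (2 * c) by rewrite ge_min lexx orbT.
  rewrite ler_pdivlMr ?mulr_gt0//; lra.
exists (t * eps / 2); first by rewrite divr_gt0 ?mulr_gt0.
move=> n n2.
have mD : measurable_fun [set: T] (fun w => total n w - compensator n w).
  by apply: measurable_funB; [exact: mT_total|exact: mT_comp].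
have side (s : R) : `|s| = 1 ->
    (P [set w | (eps * a n <= s * (total n w - compensator n w))%R]
      <= (expR (- (t * eps / 2) * a n))%:E)%E.
  move=> s1.
  have mA : measurable [set w | eps * a n <= s * (total n w - compensator n w)].
    by apply: measurable_superlevel; exact: measurable_funM.
  have := @markov_set _ _ _ P _ (fun w => expR (t * s * (total n w - compensator n w)))
    (expR (t * (eps * a n))) mA.
  move=> /(_ _ _ _ _)/le_trans => H.
  have {}H : ((expR (t * (eps * a n)))%:E *
     P [set w | (eps * a n <= s * (total n w - compensator n w))%R] <=
     (expR (c * (t * s) ^+ 2 * a n))%:E)%E.
    apply: H.
    - by apply: measurableT_comp => //; apply: measurable_funM.
    - by move=> w; exact: expR_ge0.
    - exact: expR_ge0.
    - by move=> w /= h; rewrite ler_expR -mulrA ler_wpM2l// ltW.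
    - by apply: centered_mgf_le => //; rewrite normrM s1 mulr1 gtr0_norm.
  have PA : P [set w | eps * a n <= s * (total n w - compensator n w)] \is a fin_num.
    exact: fin_num_measure.
  move: H; rewrite -(fineK PA) -EFinM !lee_fin => H.
  rewrite -(ler_pM2l (expR_gt0 (t * (eps * a n)))); apply: le_trans H _.
  rewrite -expRD ler_expR exprMn (_ : s ^+ 2 = 1); last first.
    by rewrite -real_normK ?num_real// s1 expr1n.
  have := ler_wpM2r (mulr_ge0 (ltW t0) (a_ge0 n)) tc; lra.
apply: (@le_trans _ _ (P ([set w | (eps * a n <= 1 * (total n w - compensator n w))%R] `|`
    [set w | (eps * a n <= (-1) * (total n w - compensator n w))%R]))).
  apply: le_measure.
  - by apply/mem_set/measurable_superlevel; exact: measurableT_comp.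
  - by apply/mem_set/measurableU; apply: measurable_superlevel; exact: measurable_funM.
  - move=> w /=; case: (ger0P (total n w - compensator n w)) => _ h; first by left; rewrite mul1r.
    by right; rewrite mulN1r.
apply: le_trans (measureU2 _ _ _) _.
- by apply: measurable_superlevel; exact: measurable_funM.
- by apply: measurable_superlevel; exact: measurable_funM.
rewrite [X in (_ <= X%:E)%E](_ : _ =
  expR (- (t * eps / 2) * a n) + expR (- (t * eps / 2) * a n)); last by ring.
by rewrite EFinD leeD// side ?normr1// normrN normr1.
Qed.

(** As a is at least j at [level j], the Chernoff bounds are dominated by a geometric series and
    Borel-Cantelli applies. The shift by [j0] secures [2 <= level a_oo j], the range of
    [chernoff]. *)
Lemma ae_centered_level (eps : R) : 0 < eps ->
  {ae P, forall w, \forall j \near \oo,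
    `|total (level a_oo j) w - compensator (level a_oo j) w| < eps * a (level a_oo j)}.
Proof.
move=> e0; have [kap k0 hk] := chernoff e0.
have [j0 j0P] : exists j0, forall j, (j0 <= j)%N -> (2 <= level a_oo j)%N.
  exists (truncn (a 1%N)).+1 => j jj; rewrite leqNgt; apply/negP; rewrite ltnS => h.
  have := le_trans (level_ge a_oo j) (a_nd h); apply/negP; rewrite -ltNge.
  by apply: lt_le_trans (truncnS_gt _) _; rewrite ler_nat.
pose F j := [set w | eps * a (level a_oo (j + j0)) <=
  `|total (level a_oo (j + j0)) w - compensator (level a_oo (j + j0)) w|].
have := @borel_cantelli_ae _ _ _ P F (expR (- kap)) 2.
have q1 : 0 <= expR (- kap) < 1.
  by rewrite expR_ge0 expR_lt1 oppr_lt0.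
have mF j : measurable (F j).
  apply: measurable_superlevel; apply: measurableT_comp => //.
  by apply: measurable_funB; [exact: mT_total|exact: mT_comp].
move=> /(_ mF q1 _ _) H.
have {}H : {ae P, forall x, \forall n \near \oo, ~ F n x}.
  apply: H => // n; apply: le_trans (hk _ _) _; first by rewrite j0P// leq_addl.
  rewrite lee_fin ler_wpM2l// -expRM_natr ler_expR !mulNr lerN2.
  rewrite ler_pM2l//; apply: le_trans (level_ge a_oo _).
  by rewrite ler_nat leq_addr.
apply: filterS H => w [N0 _ NH]; exists (N0 + j0)%N => // j /= jN.
have jj : (j0 <= j)%N by apply: leq_trans jN; rewrite leq_addl.
have hN : (N0 <= j - j0)%N by rewrite leq_subRL// addnC.
have /negP := NH _ hN.
by rewrite /F /= subnK// -ltNge.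
Qed.

Theorem total_slln (v : R) :
  {ae P, forall w, compensator n w / a n @[n --> \oo] --> v} ->
  {ae P, forall w, total n w / a n @[n --> \oo] --> v}.
Proof.
move=> cv.
have H : {ae P, forall w, forall i : nat, \forall j \near \oo,
    `|total (level a_oo j) w - compensator (level a_oo j) w| < i.+1%:R^-1 * a (level a_oo j)}.
  by apply: ae_foralln => i; apply: ae_centered_level; rewrite invr_gt0.
apply: filterS2 cv H => w cv H.
apply: (cvg_level a_ge0 a_nd a_step (a_oo := a_oo)).
- by move=> i j ij; exact: total_nd.
- by rewrite /total big_ord0.
have l_oo : level a_oo @ \oo --> \oo.
  apply/cvgnyPge => A; exists (truncn (a A)).+1 => // j /= jA.
  rewrite leqNgt; apply/negP => /ltnW /a_nd; apply/negP; rewrite -ltNge.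
  apply: lt_le_trans (level_ge a_oo j).
  by apply: lt_le_trans (truncnS_gt _) _; rewrite ler_nat.
have {}cv := cvg_comp _ _ l_oo cv.
rewrite -[v in _ --> v]addr0.
have -> : (fun j => total (level a_oo j) w / a (level a_oo j)) =
    (fun j => compensator (level a_oo j) w / a (level a_oo j) +
      (total (level a_oo j) w - compensator (level a_oo j) w) / a (level a_oo j)).
  by apply/funext => j; rewrite -mulrDl addrC subrK.
apply: cvgD; first exact: cv.
apply/cvgr0Pnorm_lt => e e0.
have [i iE] : exists i : nat, i.+1%:R^-1 < e.
  exists (truncn e^-1); rewrite -ltf_pV2 ?posrE// ?invr_gt0// invrK.
  exact: truncnS_gt.
have pos : \forall j \near \oo, 0 < a (level a_oo j).
  by exists 1%N => // j /= j1; apply: lt_le_trans (level_ge a_oo j); rewrite ltr0n.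
apply: filterS2 pos (H i) => j aj hj.
rewrite normrM normfV (gtr0_norm aj) ltr_pdivrMr//.
by apply: lt_trans hj _; rewrite ltr_pM2r.
Qed.

End poisson_increments.

(** * From Laplace transforms to weak convergence *)

Section exponential_sums.
Context {R : realType}.
Implicit Types (b c e x : R) (f g h : R -> R).

(** Twice the hyperbolic cosine of b x: for b >= 0 comparable to e^(b |x|), and itself a sum of two
    exponentials, so that its expectation is given by Laplace transforms. *)
Definition wt b x : R := expR (b * x) + expR (- (b * x)).

Definition expsum (l : seq (R * R)) x : R :=
  \sum_(p <- l) p.1 * expR (p.2 * x).

Lemma wt_gt0 b x : 0 < wt b x.
Proof. by rewrite addr_gt0 ?expR_gt0. Qed.

Lemma wt_ge2 b x : 2 <= wt b x.
Proof. by rewrite /wt; have := expR_ge1Dx (b * x); have := expR_ge1Dx (- (b * x)); lra. Qed.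

Lemma expR_norm_le_wt b x : 0 <= b -> expR (b * `|x|) <= wt b x.
Proof.
move=> b0; rewrite /wt; case: (ger0P x) => _; first by rewrite lerDl expR_ge0.
by rewrite mulrN lerDr expR_ge0.
Qed.

Lemma wt_le_expR_norm b x : 0 <= b -> wt b x <= 2 * expR (b * `|x|).
Proof.
move=> b0.
have h1 : expR (b * x) <= expR (b * `|x|) by rewrite ler_expR ler_wpM2l// ler_norm.
have h2 : expR (- (b * x)) <= expR (b * `|x|).
  by rewrite ler_expR -mulrN ler_wpM2l// -normrN ler_norm.
rewrite /wt; lra.
Qed.

Lemma wt_le b b' x : 0 <= b -> b <= b' -> wt b x <= 2 * wt b' x.
Proof.
move=> b0 bb; apply: le_trans (wt_le_expR_norm x b0) _; rewrite ler_pM2l//.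
apply: le_trans (expR_norm_le_wt _ (le_trans b0 bb)).
by rewrite ler_expR ler_wpM2r.
Qed.

Lemma wt_mul b b' x : 0 <= b -> 0 <= b' -> wt b x * wt b' x <= 4 * wt (b + b') x.
Proof.
move=> b0 b0'.
apply: le_trans (ler_pM (ltW (wt_gt0 _ _)) (ltW (wt_gt0 _ _))
  (wt_le_expR_norm x b0) (wt_le_expR_norm x b0')) _.
rewrite mulrACA -expRD -mulrDl.
rewrite (_ : 2 * 2 = 4 :> R); last by ring.
by rewrite ler_pM2l//; apply: expR_norm_le_wt; rewrite addr_ge0.
Qed.

Lemma expsum_cat l l' x : expsum (l ++ l') x = expsum l x + expsum l' x.
Proof. by rewrite /expsum big_cat. Qed.

Lemma expsum_mul l l' x :
  expsum [seq (p.1 * q.1, p.2 + q.2) | p <- l, q <- l'] x =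
  expsum l x * expsum l' x.
Proof.
rewrite /expsum big_allpairs_dep mulr_suml; apply: eq_bigr => p _.
rewrite mulr_sumr; apply: eq_bigr => q _ /=; rewrite mulrDl expRD; ring.
Qed.

(* Convergence of Laplace transforms passes to such limits of exponential sums,
   the error being controlled by the transforms at b and - b. *)
Definition approx b g := forall e, 0 < e ->
  exists l, forall x, `|g x - expsum l x| <= e * wt b x.

Lemma approx_cst b c : approx b (cst c).
Proof.
move=> e e0; exists [:: (c, 0)] => x.
by rewrite /expsum big_seq1 /= mul0r expR0 mulr1 subrr normr0 mulr_ge0 ?ltW ?wt_gt0.
Qed.

Lemma approxD b g h : approx b g -> approx b h -> approx b (fun x => g x + h x).
Proof.
move=> ag ah e e0; have [l lE] := ag _ (divr_gt0 e0 (ltr0Sn _ 1)).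
have [l' lE'] := ah _ (divr_gt0 e0 (ltr0Sn _ 1)).
exists (l ++ l') => x; rewrite expsum_cat opprD addrACA.
apply: le_trans (ler_normD _ _) _; have := lE x; have := lE' x; lra.
Qed.

Lemma approxM b b' g h cg ch : 0 <= b -> 0 <= b' ->
  (forall x, `|g x| <= cg * wt b x) -> (forall x, `|h x| <= ch * wt b' x) ->
  approx b g -> approx b' h -> approx (b + b') (fun x => g x * h x).
Proof.
move=> b0 b0' hg hh ag ah e e0.
have cg0 : 0 <= cg.
  by rewrite -(pmulr_lge0 _ (wt_gt0 b 0)) (le_trans _ (hg 0)).
have ch0 : 0 <= ch.
  by rewrite -(pmulr_lge0 _ (wt_gt0 b' 0)) (le_trans _ (hh 0)).
(* The 4 comes from [wt_mul]; taking [e1] at most 1 lets [ch + 1] bound the approximant of h. *)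
set k := 4 * (cg + ch + 1).
have k0 : 0 < k by rewrite mulr_gt0// ltr_wpDl// addr_ge0.
set e1 := Num.min 1 (e / k).
have e10 : 0 < e1 by rewrite lt_min ltr01 divr_gt0.
have e11 : e1 <= 1 by rewrite ge_min lexx.
have e1k : e1 * k <= e by rewrite -ler_pdivlMr// ge_min lexx orbT.
have [l lE] := ag _ e10; have [l' lE'] := ah _ e10.
exists [seq (p.1 * q.1, p.2 + q.2) | p <- l, q <- l'] => x.
rewrite expsum_mul; set p := expsum l x; set q := expsum l' x.
have qle : `|q| <= (ch + 1) * wt b' x.
  have -> : q = h x - (h x - q) by ring.
  apply: le_trans (ler_normB _ _) _; rewrite mulrDl mul1r lerD//.
  by apply: le_trans (lE' x) _; rewrite ler_piMl// ltW// wt_gt0.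
have -> : g x * h x - p * q = g x * (h x - q) + (g x - p) * q by ring.
apply: le_trans (ler_normD _ _) _; rewrite !normrM.
apply: (@le_trans _ _ ((cg * wt b x) * (e1 * wt b' x) +
    (e1 * wt b x) * ((ch + 1) * wt b' x))).
  by rewrite lerD// ler_pM.
rewrite (_ : _ + _ = e1 * (cg + ch + 1) * (wt b x * wt b' x)); last by ring.
apply: (@le_trans _ _ (e1 * (cg + ch + 1) * (4 * wt (b + b') x))).
  by rewrite ler_wpM2l ?wt_mul// mulr_ge0 ?ltW// ltr_wpDl// addr_ge0.
rewrite (_ : _ * (4 * _) = e1 * k * wt (b + b') x); last by rewrite /k; ring.
by rewrite ler_wpM2r// ltW// wt_gt0.
Qed.

Lemma approx_limit b g :
  (forall e, 0 < e -> exists2 h, approx b h & forall x, `|g x - h x| <= e * wt b x) ->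
  approx b g.
Proof.
move=> H e e0; have [h ah hE] := H _ (divr_gt0 e0 (ltr0Sn _ 1)).
have [l lE] := ah _ (divr_gt0 e0 (ltr0Sn _ 1)); exists l => x.
rewrite -(subrK (h x) (g x)) -addrA; apply: le_trans (ler_normD _ _) _.
have := lE x; have := hE x; lra.
Qed.

Lemma approx_le b b' g : 0 <= b -> b <= b' -> approx b g -> approx b' g.
Proof.
move=> b0 bb ag e e0; have [l lE] := ag _ (divr_gt0 e0 (ltr0Sn _ 1)).
exists l => x; apply: le_trans (lE x) _.
rewrite -mulrA ler_pM2l// ler_pdivrMl//; exact: wt_le.
Qed.

(** Asking this at every rate b > 0 makes the class stable under products: each factor is taken at
    rate b / 2. *)
Definition subexp g := forall b, 0 < b ->
  (exists c, forall x, `|g x| <= c * wt b x) /\ approx b g.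

Lemma subexp_cst c : subexp (cst c).
Proof.
move=> b b0; split; last exact: approx_cst.
exists `|c| => x; rewrite ler_peMr//.
by apply: le_trans (wt_ge2 b x); rewrite ler1n.
Qed.

Lemma subexpM g h : subexp g -> subexp h -> subexp (fun x => g x * h x).
Proof.
move=> sg sh b b0; have b20 : 0 < b / 2 by rewrite divr_gt0.
have [[cg gE] ag] := sg _ b20; have [[ch hE] ah] := sh _ b20.
have bb : b = b / 2 + b / 2 by field.
split; last first.
  by rewrite bb; apply: (approxM (ltW b20) (ltW b20) gE hE).
exists (4 * (cg * ch)) => x; rewrite normrM.
apply: le_trans (ler_pM _ _ (gE x) (hE x)) _ => //.
have cg0 : 0 <= cg by rewrite -(pmulr_lge0 _ (wt_gt0 (b / 2) 0)) (le_trans _ (gE 0)).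
have ch0 : 0 <= ch by rewrite -(pmulr_lge0 _ (wt_gt0 (b / 2) 0)) (le_trans _ (hE 0)).
rewrite mulrACA (_ : 4 * (cg * ch) * _ = cg * ch * (4 * wt (b / 2 + b / 2) x)).
  by rewrite ler_wpM2l ?mulr_ge0//; exact: (wt_mul _ (ltW b20) (ltW b20)).
by rewrite -bb; ring.
Qed.

Lemma norm_le_wt b x : 0 < b -> `|x| <= b^-1 * wt b x.
Proof.
move=> b0; rewrite -ler_pdivrMl ?invr_gt0// invrK.
apply: le_trans (expR_norm_le_wt x (ltW b0)).
by apply: le_trans (expR_ge1Dx _); rewrite lerDr.
Qed.

(** The identity is the limit of (e^(d x) - 1) / d as d tends to 0, with error at most d x^2 e^(d
    |x|) / 2. For d <= b / 2 the factor x^2 is absorbed by x^2 <= (16 / b^2) e^(b |x| / 2). Any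
    constant from 8 on could replace 64. *)
Lemma subexp_id : subexp id.
Proof.
move=> b b0; split; first by exists b^-1 => x; exact: norm_le_wt.
move=> e e0.
set c := 64 / b ^+ 2.
have c0 : 0 < c by rewrite divr_gt0// exprn_gt0.
set d := Num.min (b / 2) (e / c).
have d0 : 0 < d by rewrite lt_min; apply/andP; split; exact: divr_gt0.
have db : d <= b / 2 by rewrite ge_min lexx.
have dc : d * c <= e by rewrite -ler_pdivlMr// ge_min lexx orbT.
exists [:: (d^-1, d); (- d^-1, 0)] => x.
rewrite /expsum big_cons big_seq1 /= mul0r expR0 mulr1.
have -> : x - (d^-1 * expR (d * x) - d^-1) = - (d^-1 * (expR (d * x) - 1 - d * x)).
  by field; rewrite gt_eqF.
rewrite normrN normrM gtr0_norm ?invr_gt0//.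
have := expR_taylor (d * x) 2; rewrite !big_ord_recr big_ord0 /= add0r expr0 expr1.
rewrite fact0 (_ : 1`!%:R = 1 :> R)// !divr1 opprD addrA => h.
rewrite ler_pdivrMl//; apply: le_trans h _.
rewrite (_ : 2`!%:R = 2 :> R)// normrM (gtr0_norm d0).
have sq : `|x| ^+ 2 <= (16 / b ^+ 2) * expR (b / 2 * `|x|).
  have h1 : b / 4 * `|x| <= expR (b / 4 * `|x|).
    by apply: le_trans (expR_ge1Dx _); rewrite lerDr.
  have h2 : (b / 4 * `|x|) ^+ 2 <= expR (b / 4 * `|x|) ^+ 2.
    by rewrite lerXn2r ?nnegrE ?expR_ge0// mulr_ge0// divr_ge0// ltW.
  rewrite -expRM_natr in h2.
  rewrite mulrAC ler_pdivlMr ?exprn_gt0//.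
  rewrite (_ : b / 4 * `|x| * 2 = b / 2 * `|x|) in h2; last by field.
  move: h2; rewrite !exprMn; have -> : (4 : R)^-1 ^+ 2 = 16^-1 by field.
  lra.
have ed : expR (d * `|x|) <= expR (b / 2 * `|x|).
  by rewrite ler_expR ler_wpM2r.
have wx := expR_norm_le_wt x (ltW b0).
have ex : expR (b / 2 * `|x|) * expR (b / 2 * `|x|) = expR (b * `|x|).
  by rewrite -expRD; congr expR; field.
rewrite exprMn.
apply: (@le_trans _ _ (d ^+ 2 * (16 / b ^+ 2 * expR (b / 2 * `|x|)) / 2 *
   expR (b / 2 * `|x|))).
  apply: ler_pM; [|exact: expR_ge0| |exact: ed].
    by rewrite divr_ge0// mulr_ge0// sqr_ge0.
  by rewrite ler_pM2r ?invr_gt0// ler_wpM2l ?sqr_ge0.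
rewrite (_ : d ^+ 2 * _ / 2 * _ =
  d * (d * (8 / b ^+ 2) * (expR (b / 2 * `|x|) * expR (b / 2 * `|x|)))); last first.
  by field; rewrite gt_eqF.
rewrite ex ler_pM2l//; apply: ler_pM => //.
  by rewrite mulr_ge0 ?divr_ge0 ?exprn_ge0// ltW.
apply: le_trans dc; rewrite ler_pM2l// /c ler_pM2r ?invr_gt0 ?exprn_gt0//.
by rewrite ler_nat.
Qed.

Lemma subexp_monomial c k : subexp (fun x => c * x ^+ k).
Proof.
elim: k => [|k IH]; first by under eq_fun do rewrite expr0 mulr1; exact: subexp_cst.
rewrite (_ : (fun x => _) = fun x => c * x ^+ k * x); first exact: subexpM IH subexp_id.
by apply/funext => x; rewrite exprSr mulrA.
Qed.

Lemma approx_sum b n (g : nat -> R -> R) : (forall k, approx b (g k)) ->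
  approx b (fun x => \sum_(k < n) g k x).
Proof.
move=> ag; elim: n => [|n IH].
  by under eq_fun do rewrite big_ord0; exact: approx_cst.
under eq_fun do rewrite big_ord_recr /=.
exact: approxD.
Qed.

(** With y = |a x|, the remainder y^N e^y / N! equals 2^(- N) (2 y)^N e^y / N!, which is at most
    2^(- N) e^(3 y). This is where the rate 3 a comes from. *)
Lemma approx_sin a : 0 < a -> approx (3 * a) (fun x => sin (a * x)).
Proof.
move=> a0; apply: approx_limit => e e0.
have [N NE] : exists N : nat, 2^-1 ^+ N <= e.
  have := @cvg_geometric R 1 2^-1; rewrite ger0_norm// => /(_ _).
  have h1 : (2^-1 : R) < 1 by rewrite invf_lt1// ltr1n.
  move=> /(_ h1) /cvgr0Pnorm_le /(_ _ e0) [N _ /(_ N (leqnn N)) /=].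
  by rewrite /geometric /= mul1r ger0_norm ?exprn_ge0//; exists N.
exists (fun x => \sum_(k < N) sin_coeff (a * x) k).
  apply: (@approx_sum _ _ (fun k x => sin_coeff (a * x) k)) => k.
  have -> : (fun x => sin_coeff (a * x) k) =
      (fun x => ((odd k)%:R * (-1) ^+ k.-1./2 * a ^+ k / k`!%:R) * x ^+ k).
    by apply/funext => x; rewrite /sin_coeff /= exprMn; ring.
  have a30 : 0 < 3 * a by rewrite mulr_gt0.
  exact: (proj2 (subexp_monomial _ k a30)).
move=> x; apply: le_trans (sin_taylor _ _) _.
have h : (2 * `|a * x|) ^+ N / N`!%:R <= expR (2 * `|a * x|).
  have y0 : 0 <= 2 * `|a * x| by rewrite mulr_ge0.
  have := @expR_taylor R (2 * `|a * x|) 0.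
  have := @nondecreasing_cvgn_le R (series (exp_coeff (2 * `|a * x|))).
  move=> /(_ _ _ N.+1) H _.
  apply: (@le_trans _ _ (series (exp_coeff (2 * `|a * x|)) N.+1)).
    rewrite /series /= big_nat_recr //= lerDr sumr_ge0// => i _.
    exact: exp_coeff_ge0.
  apply: H; last exact: is_cvg_series_exp_coeff.
  apply/nondecreasing_seqP => k; rewrite /series /= big_nat_recr//= lerDl.
  exact: exp_coeff_ge0.
rewrite (_ : `|a * x| ^+ N = 2^-1 ^+ N * (2 * `|a * x|) ^+ N); last first.
  by rewrite -exprMn mulrA mulVf ?mul1r.
rewrite -!mulrA; apply: ler_pM => //; rewrite mulrA.
apply: (@le_trans _ _ (expR (2 * `|a * x|) * expR `|a * x|)).
  by rewrite ler_wpM2r ?expR_ge0.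
rewrite -expRD; apply: le_trans (expR_norm_le_wt x _); last by rewrite mulr_ge0// ltW.
by rewrite ler_expR normrM (gtr0_norm a0); lra.
Qed.

End exponential_sums.

(** * Bernstein polynomials *)

Section bernstein.
Context {R : realType}.
Implicit Types (phi : nat -> R) (u : R) (N : nat).

(* [(bernstein N phi).[u]] is the expectation of [phi] under the binomial law
   with parameters [N] and [u]; the recursion conditions on the first trial. *)
Fixpoint bernstein N phi : {poly R} :=
  if N is N'.+1 then
    'X * bernstein N' (fun k => phi k.+1) + (1 - 'X) * bernstein N' phi
  else (phi 0%N)%:P.

Lemma bernsteinS N phi u : (bernstein N.+1 phi).[u] =
  u * (bernstein N (fun k => phi k.+1)).[u] + (1 - u) * (bernstein N phi).[u].
Proof. by rewrite /= !hornerE. Qed.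

Lemma bernstein_le N phi psi u : 0 <= u <= 1 ->
  (forall k, (k <= N)%N -> phi k <= psi k) ->
  (bernstein N phi).[u] <= (bernstein N psi).[u].
Proof.
move=> u01; elim: N phi psi => [|N IH] phi psi h; first by rewrite /= !hornerC h.
move/andP: (u01) => [u0 u1].
rewrite !bernsteinS lerD// ler_wpM2l ?subr_ge0//; apply: IH => k kN; apply: h => //.
exact: leqW.
Qed.

Lemma bernstein_lin N phi psi (c : R) u :
  (bernstein N (fun k => phi k + c * psi k)).[u] =
  (bernstein N phi).[u] + c * (bernstein N psi).[u].
Proof.
elim: N phi psi => [|N IH] phi psi; first by rewrite /= !hornerC.
by rewrite !bernsteinS !IH; ring.
Qed.

Lemma bernstein_cst N (c : R) u : (bernstein N (fun=> c)).[u] = c.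
Proof. by elim: N => [|N IH]; [rewrite /= hornerC|rewrite bernsteinS IH; ring]. Qed.

(** The second moment is taken about an arbitrary c because conditioning on the first trial shifts c
    by 1. *)
Lemma bernstein_var N (c : R) u :
  (bernstein N (fun k => (k%:R - c) ^+ 2)).[u] =
  N%:R * u * (1 - u) + (N%:R * u - c) ^+ 2.
Proof.
elim: N c => [|N IH] c; first by rewrite /= hornerC; ring.
rewrite bernsteinS IH.
have -> : (fun k : nat => (k.+1%:R - c) ^+ 2) = (fun k => (k%:R - (c - 1)) ^+ 2).
  by apply/funext => k; rewrite -natr1; congr (_ ^+ 2); ring.
rewrite IH -natr1; ring.
Qed.

Lemma bernstein_norm_le N phi u : 0 <= u <= 1 ->
  `|(bernstein N phi).[u]| <= (bernstein N (fun k => `|phi k|)).[u].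
Proof.
move=> u01; rewrite ler_norml; apply/andP; split; last first.
  by apply: bernstein_le => // k _; exact: ler_norm.
rewrite lerNl -mulN1r -[leLHS]add0r -(bernstein_cst N 0 u) -bernstein_lin.
by apply: bernstein_le => // k _; rewrite add0r mulN1r -normrN ler_norm.
Qed.

(** Chebyshev's argument: where k / N is within d of u, continuity gives e; elsewhere 2 M is at most
    2 M / d^2 times the squared distance, whose binomial mean is u (1 - u) / N. *)
Lemma bernstein_approx (G : R -> R) (J : set R) (M e : R) : 0 < e ->
  (forall v, `|G v| <= M) ->
  (exists2 d, 0 < d & forall u v, J u -> `|u - v| <= d -> `|G u - G v| <= e) ->
  exists N, forall u, 0 <= u <= 1 -> J u ->
    `|(bernstein N (fun k => G (k%:R / N%:R))).[u] - G u| <= 2 * e.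
Proof.
move=> e0 GM [d d0 dE].
have M0 : 0 <= M := le_trans (normr_ge0 _) (GM 0).
pose c := 2 * M / d ^+ 2.
have c0 : 0 <= c by rewrite divr_ge0 ?sqr_ge0// mulr_ge0.
pose N := (truncn (c / e)).+1.
have N0 : 0 < N%:R :> R by rewrite ltr0n.
have cN : c / N%:R <= e.
  rewrite ler_pdivrMr// mulrC -ler_pdivrMr//; apply: ltW; exact: truncnS_gt.
exists N => u u01 Ju; rewrite -[G u](bernstein_cst N (G u) u).
rewrite -[X in _ - X]mul1r -mulNr -bernstein_lin.
apply: le_trans (bernstein_norm_le _ _ u01) _.
apply: (@le_trans _ _ (bernstein N (fun k => e + c / N%:R ^+ 2 * (k%:R - N%:R * u) ^+ 2)).[u]).
  apply: bernstein_le => // k _; rewrite mulN1r distrC.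
  have [h|h] := leP `|u - k%:R / N%:R| d.
    apply: le_trans (dE _ _ Ju h) _; rewrite lerDl mulr_ge0 ?sqr_ge0//.
    by rewrite divr_ge0 ?sqr_ge0.
  apply: (@le_trans _ _ (2 * M)).
    apply: le_trans (ler_normB _ _) _; have := GM u; have := GM (k%:R / N%:R); lra.
  rewrite -[leLHS]add0r lerD// ?(ltW e0)//.
  have -> : k%:R - N%:R * u = - (N%:R * (u - k%:R / N%:R)).
    by field; rewrite gt_eqF.
  rewrite sqrrN exprMn mulrA divfK ?gt_eqF ?exprn_gt0// /c.
  rewrite mulrAC ler_pdivlMr ?exprn_gt0//.
  rewrite ler_wpM2l ?mulr_ge0// -[leRHS]real_normK ?num_real//.
  by rewrite lerXn2r ?nnegrE ?(ltW h) ?(ltW d0).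
rewrite bernstein_lin bernstein_cst bernstein_var subrr expr0n addr0.
rewrite mulr2n mulrDl mul1r lerD2l.
apply: le_trans cN.
rewrite (_ : c / N%:R ^+ 2 * _ = c / N%:R * (u * (1 - u))); last first.
  by field; rewrite gt_eqF.
have u1u : u * (1 - u) <= 1.
  by move/andP: u01 => [u0 u1]; nra.
by apply: ler_piMr => //; rewrite divr_ge0.
Qed.

Lemma clamp_uniform (G : R -> R) (a b e : R) : a <= b -> 0 < e -> continuous G ->
  exists2 d, 0 < d & forall u v, a <= u <= b -> `|u - v| <= d -> `|G u - G v| <= e.
Proof.
move=> ab e0 cG.
have e2 : 0 < e / 2 by rewrite divr_gt0.
have /compact_near_coveringP := @segment_compact R a b.
move=> /(_ R 0^'+ (fun d u => forall v, `|u - v| <= d -> `|G u - G v| <= e)).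
move=> /(_ _) [|d /= d0 dE].
  move=> x _; have /cvgrPdist_le /(_ _ e2) /nbhs_ballP [del /= del0 delE] := cG x.
  have del2 : 0 < del / 2 by rewrite divr_gt0.
  near=> y d => v yv.
  have xy : `|x - y| < del / 2.
    by near: y; exists (del / 2).
  have dd : d < del / 2 by near: d; exact: nbhs_right_lt.
  have h1 : `|G x - G y| <= e / 2 by apply: delE; rewrite /ball /=; lra.
  have h2 : `|G x - G v| <= e / 2.
    apply: delE; rewrite /ball /= -(subrK y x) -addrA.
    by move: yv => /= yv; apply: le_lt_trans (ler_normD _ _) _; lra.
  rewrite /= -(subrK (G x) (G y)) -addrA; apply: le_trans (ler_normD _ _) _.
  by rewrite distrC; lra.
have d20 : 0 < d / 2 by rewrite divr_gt0.
have bd : ball_ [eta normr] 0 d (d / 2).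
  by rewrite /ball_ /= sub0r normrN gtr0_norm// ltr_pdivrMr// ltr_pMr// ltr1n.
by exists (d / 2) => // u v uab uv; apply: (dE _ bd d20 u); rewrite //= in_itv.
Unshelve. all: by end_near.
Qed.

End bernstein.

(** * Approximation by polynomials in a sine *)

Section sine_polynomials.
Context {R : realType}.
Implicit Types (f g h : R -> R) (k M e : R).

Definition lipschitz_by k g := forall x y : R, `|g x - g y| <= k * `|x - y|.

Lemma sin_lipschitz : lipschitz_by 1 (@sin R).
Proof.
move=> x y; wlog xy : x y / y <= x.
  move=> H; have [/H//|/ltW /H] := leP y x.
  by rewrite distrC (distrC y x).
have [|c _ ->] := @MVT_segment R sin cos y x xy (fun x _ => is_derive_sin x).
  by apply: continuous_subspaceT => z; exact: continuous_sin.
by rewrite normrM ler_wpM2r// cos_max.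
Qed.

(** Laplace transforms determine the expectation of g through [approx], while the Lipschitz bound
    lets g tolerate an L1 error in its argument. Nonconstant exponential sums are not Lipschitz;
    polynomials in a sine have all these properties. *)
Definition tame g := exists c k b,
  [/\ 0 <= b, forall x, `|g x| <= c, lipschitz_by k g & approx b g].

Lemma tame_cst c : tame (cst c).
Proof.
exists `|c|, 0, 0; split => //; last exact: approx_cst.
by move=> x y; rewrite subrr normr0 mul0r.
Qed.

Lemma tameD g h : tame g -> tame h -> tame (fun x => g x + h x).
Proof.
move=> [c [k [b [b0 gc gk ga]]]] [c' [k' [b' [b0' hc hk ha]]]].
exists (c + c'), (k + k'), (b + b'); split; first exact: addr_ge0.
- by move=> x; apply: le_trans (ler_normD _ _) _; exact: lerD.
- move=> x y; rewrite opprD addrACA mulrDl.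
  by apply: le_trans (ler_normD _ _) _; exact: lerD.
- by apply: approxD; [apply: (approx_le b0 _ ga)|apply: (approx_le b0' _ ha)];
    rewrite ?lerDl ?lerDr.
Qed.

Lemma tameM g h : tame g -> tame h -> tame (fun x => g x * h x).
Proof.
move=> [c [k [b [b0 gc gk ga]]]] [c' [k' [b' [b0' hc hk ha]]]].
have c0 : 0 <= c := le_trans (normr_ge0 _) (gc 0).
have c0' : 0 <= c' := le_trans (normr_ge0 _) (hc 0).
have wt1 b1 x : 1 <= wt b1 x by apply: le_trans (wt_ge2 _ _); rewrite ler1n.
exists (c * c'), (c * k' + k * c'), (b + b'); split; first exact: addr_ge0.
- by move=> x; rewrite normrM ler_pM.
- move=> x y.
  have -> : g x * h x - g y * h y = g x * (h x - h y) + (g x - g y) * h y by ring.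
  apply: le_trans (ler_normD _ _) _; rewrite !normrM mulrDl lerD//.
    by rewrite -mulrA ler_pM.
  by rewrite mulrAC ler_pM.
- apply: (@approxM _ _ _ _ _ c c') => // x.
    by apply: le_trans (gc x) _; rewrite ler_peMr.
  by apply: le_trans (hc x) _; rewrite ler_peMr.
Qed.

Lemma tame_sin a : 0 < a -> tame (fun x => sin (a * x)).
Proof.
move=> a0; exists 1, a, (3 * a); split; last exact: approx_sin.
- by rewrite mulr_ge0// ltW.
- by move=> x; exact: sin_max.
- move=> x y; apply: le_trans (sin_lipschitz _ _) _.
  by rewrite mul1r -mulrBr normrM gtr0_norm.
Qed.

Lemma tame_horner (p : {poly R}) g : tame g -> tame (fun x => p.[g x]).
Proof.
move=> tg; elim/poly_ind: p => [|p c IH].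
  by under eq_fun do rewrite horner0; exact: tame_cst.
by under eq_fun do rewrite hornerMXaddC; apply: tameD (tame_cst c); exact: tameM.
Qed.

Lemma continuous_clamp (s : R) : continuous (fun t : R => Num.max (- s) (Num.min s t)).
Proof.
move=> t; apply: (@continuous_max _ _ (cst (- s)) (fun t => Num.min s t)).
  exact: cst_continuous.
apply: (@continuous_min _ _ (cst s) id); first exact: cst_continuous.
exact: id.
Qed.

Lemma sin_le : {in `[(- (pi / 2)) : R, pi / 2] &, {homo @sin R : x y / x <= y}}.
Proof.
move=> x y xI yI; rewrite le_eqVlt => /predU1P[->//|xy].
by apply: ltW; rewrite ltr_sin.
Qed.

(* On [- K, K], f is close to a Bernstein polynomial in
   (1 + sin (x / (2 K))) / 2; elsewhere 2 M <= e K <= e |x|. *)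
Lemma tame_dense f M e : continuous f -> (forall x, `|f x| <= M) -> 0 < e ->
  exists2 g, tame g & forall x, `|f x - g x| <= e * (1 + `|x|).
Proof.
move=> cf fM e0; have M0 : 0 <= M := le_trans (normr_ge0 _) (fM 0).
set K := 2 * M / e + 1.
have K0 : 0 < K by rewrite ltr_wpDl// divr_ge0 ?mulr_ge0// ltW.
have K20 : 0 < 2 * K by rewrite mulr_gt0.
set s := sin (2^-1 : R).
have hpi : 1 <= (pi : R) / 2 := pihalf_ge1 R.
have s1 : s < 1.
  rewrite -[ltRHS](@sin_pihalf R) ltr_sin ?in_itv/=; lra.
have s0 : 0 < s by apply: sin_gt0_pihalf; lra.
(* Since s < 1, clamping keeps the argument of [asin] inside (-1, 1), where it is continuous; it
   changes nothing when |x| <= K. *)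
pose clamp (t : R) := Num.max (- s) (Num.min s t).
have clampP t : -1 < clamp t < 1.
  rewrite /clamp lt_max gt_max; apply/andP; split; first by apply/orP; left; lra.
  by apply/andP; split; [lra|rewrite gt_min s1].
pose G u := f (2 * K * asin (clamp (2 * u - 1))).
have cG : continuous G.
  move=> u; rewrite /G.
  have h1 : {for u, continuous (fun u : R => clamp (2 * u - 1))}.
    apply: (@continuous_comp _ _ _ (fun u : R => 2 * u - 1) clamp).
      by apply: cvgB; [apply: cvgMr; exact: cvg_id|exact: cvg_cst].
    exact: continuous_clamp.
  have h2 : {for u, continuous (fun u : R => asin (clamp (2 * u - 1)))}.
    by apply: (@continuous_comp _ _ _ (fun u : R => clamp (2 * u - 1)) asin) => //;
      exact: continuous_asin.
  apply: (@continuous_comp _ _ _ (fun u : R => 2 * K * asin (clamp (2 * u - 1))) f).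
    by apply: cvgMr; exact: h2.
  exact: cf.
have [N NE] := @bernstein_approx R G `[0, 1] M (e / 2) (divr_gt0 e0 (ltr0Sn _ 1))
  (fun v => fM _) (clamp_uniform ler01 (divr_gt0 e0 (ltr0Sn _ 1)) cG).
set p := bernstein N _ in NE.
pose q (x : R) := 2^-1 + 2^-1 * sin ((2 * K)^-1 * x).
have q01 x : 0 <= q x <= 1.
  have := sin_geN1 ((2 * K)^-1 * x); have := sin_le1 ((2 * K)^-1 * x).
  rewrite /q; lra.
exists (fun x => p.[q x]).
  apply: tame_horner; apply: (tameD (tame_cst 2^-1)); apply: (tameM (tame_cst 2^-1)).
  by apply: tame_sin; rewrite invr_gt0.
move=> x; have [xK|xK] := leP `|x| K.
  have zE : - 2^-1 <= (2 * K)^-1 * x <= 2^-1.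
    move: xK; rewrite -ler_norml normrM gtr0_norm ?invr_gt0// => xK.
    by rewrite ler_pdivrMl// mulrAC divff// mul1r.
  have sE : - s <= sin ((2 * K)^-1 * x) <= s.
    by move/andP : zE => [z1 z2]; rewrite /s -sinN !sin_le ?in_itv/=//; lra.
  have Gq : G (q x) = f x.
    rewrite /G /q (_ : 2 * _ - 1 = sin ((2 * K)^-1 * x)); last by field.
    move/andP : sE => [sE1 sE2].
    rewrite /clamp (min_idPr sE2) (max_idPr sE1) sinK ?in_itv/=; last by lra.
    by rewrite mulrA divff ?mul1r// gt_eqF.
  have := NE (q x) (q01 x); rewrite /= in_itv /= q01 => /(_ isT).
  rewrite Gq distrC mulrCA divff// mulr1 => /le_trans; apply.
  by rewrite ler_peMr ?(ltW e0)// lerDl.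
have pM : `|p.[q x]| <= M.
  apply: le_trans (bernstein_norm_le _ _ (q01 x)) _.
  by rewrite -[leRHS](bernstein_cst N M (q x)); apply: bernstein_le => // k _; exact: fM.
apply: le_trans (ler_normB _ _) _; have := fM x.
have : 2 * M <= e * K by rewrite /K mulrDr mulrCA divff ?gt_eqF// !mulr1 lerDl ltW.
have : e * K <= e * (1 + `|x|) by rewrite ler_pM2l//; lra.
lra.
Qed.

End sine_polynomials.

(** * Positive functionals and convergence from Laplace transforms *)

Section positive_functionals.
Context {R : realType}.
Implicit Types (f g h : R -> R) (D : set (R -> R)) (T L : (R -> R) -> R).

Definition expbounded g :=
  continuous g /\ exists b c, 0 <= b /\ forall x, `|g x| <= c * wt b x.

Definition linbounded g :=
  continuous g /\ exists c, forall x, `|g x| <= c * (1 + `|x|).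

(** Treats alike expectations under a density and Gaussian integrals, D being a class of functions
    on which they are finite. *)
Definition positive_functional D T :=
  (forall g h, D g -> D h -> (forall x, g x <= h x) -> T g <= T h) /\
  (forall a g h, D g -> D h -> T (fun x => g x + a * h x) = T g + a * T h).

Lemma positive_functional_abs D T g h h' :
  positive_functional D T -> D g -> D h -> D h' -> D (fun x => g x + -1 * h x) ->
  D (fun x => h x + -1 * g x) ->
  (forall x, `|g x - h x| <= h' x) -> `|T g - T h| <= T h'.
Proof.
move=> [mon lin] Dg Dh Dh' D1 D2 H.
rewrite ler_norml; apply/andP; split.
  rewrite lerNl opprB -[_ - _]/(T h + - T g) -mulN1r -lin//; apply: mon => // x.
  by rewrite mulN1r; apply: le_trans (H x); rewrite distrC ler_norm.
rewrite -mulN1r -lin//; apply: mon => // x.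
by rewrite mulN1r; apply: le_trans (H x); rewrite ler_norm.
Qed.

Lemma expbounded_expR a : expbounded (fun x => expR (a * x)).
Proof.
split.
  move=> x; apply: (@continuous_comp _ _ _ (fun x => a * x) expR).
    by apply: cvgMr; exact: cvg_id.
  exact: continuous_expR.
exists `|a|, 1; split => // x; rewrite mul1r ger0_norm ?expR_ge0//.
apply: le_trans (expR_norm_le_wt x (normr_ge0 a)).
by rewrite ler_expR -normrM ler_norm.
Qed.

Lemma expboundedD a g h : expbounded g -> expbounded h ->
  expbounded (fun x => g x + a * h x).
Proof.
move=> [cg [b [k [b0 gE]]]] [ch [b' [k' [b0' hE]]]]; split.
  by move=> x; apply: cvgD; [exact: cg|apply: cvgMr; exact: ch].
have k0 : 0 <= k by rewrite -(pmulr_lge0 _ (wt_gt0 b 0)) (le_trans _ (gE 0)).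
have k0' : 0 <= k' by rewrite -(pmulr_lge0 _ (wt_gt0 b' 0)) (le_trans _ (hE 0)).
exists (b + b'), (2 * k + 2 * `|a| * k'); split; first exact: addr_ge0.
move=> x; apply: le_trans (ler_normD _ _) _; rewrite normrM mulrDl lerD//.
  apply: le_trans (gE x) _; rewrite (mulrC 2) -mulrA ler_wpM2l//.
  by apply: wt_le; rewrite ?lerDl.
apply: le_trans (ler_wpM2l (normr_ge0 a) (hE x)) _.
rewrite (_ : 2 * `|a| * k' * _ = `|a| * (k' * (2 * wt (b + b') x))); last by ring.
by rewrite !ler_wpM2l//; apply: wt_le; rewrite ?lerDr.
Qed.

Lemma linboundedD a g h : linbounded g -> linbounded h ->
  linbounded (fun x => g x + a * h x).
Proof.
move=> [cg [k gE]] [ch [k' hE]]; split.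
  by move=> x; apply: cvgD; [exact: cg|apply: cvgMr; exact: ch].
exists (k + `|a| * k') => x; apply: le_trans (ler_normD _ _) _.
rewrite normrM mulrDl lerD//.
by rewrite -mulrA ler_wpM2l.
Qed.

Lemma linbounded_exp g : linbounded g -> expbounded g.
Proof.
move=> [cg [k gE]]; split=> //; exists 1, k; split => // x.
have k0 : 0 <= k.
  by have := le_trans (normr_ge0 _) (gE 0); rewrite normr0 addr0 mulr1.
apply: le_trans (gE x) _; rewrite ler_wpM2l//.
apply: le_trans (expR_norm_le_wt x ler01); rewrite mul1r.
exact: expR_ge1Dx.
Qed.

Lemma expbounded_cst a : expbounded (cst a).
Proof.
apply: linbounded_exp; split; first exact: cst_continuous.
by exists `|a| => x; rewrite ler_peMr// lerDl.
Qed.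

Lemma expbounded_expsum l : expbounded (expsum l).
Proof.
elim: l => [|p l IH].
  rewrite (_ : expsum [::] = cst 0); first exact: expbounded_cst.
  by apply/funext => x; rewrite /expsum big_nil.
rewrite (_ : expsum _ = fun x => expsum l x + p.1 * expR (p.2 * x)).
  exact: expboundedD IH (expbounded_expR _).
by apply/funext => x; rewrite /expsum big_cons addrC.
Qed.

Lemma expbounded_wt b : expbounded (wt b).
Proof.
rewrite (_ : wt b = fun x => expR (b * x) + 1 * expR (- b * x)).
  by apply: expboundedD; exact: expbounded_expR.
by apply/funext => x; rewrite /wt mul1r mulNr.
Qed.

Lemma positive_functional_expsum T l : positive_functional expbounded T ->
  T (expsum l) = \sum_(p <- l) p.1 * T (fun x => expR (p.2 * x)).
Proof.
move=> [_ lin]; elim: l => [|p l IH].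
  have -> : expsum [::] = fun x : R => (cst 0 x) + -1 * (cst 0 x).
    by apply/funext => x; rewrite /expsum big_nil /= mulr0 addr0.
  by rewrite lin ?big_nil; [ring|exact: expbounded_cst|exact: expbounded_cst].
rewrite (_ : expsum _ = fun x => expsum l x + p.1 * expR (p.2 * x)); last first.
  by apply/funext => x; rewrite /expsum big_cons addrC.
rewrite lin; [|exact: expbounded_expsum|exact: expbounded_expR].
by rewrite big_cons IH addrC.
Qed.

Lemma positive_functional_wt T b : positive_functional expbounded T ->
  T (wt b) = T (fun x => expR (b * x)) + T (fun x => expR (- b * x)).
Proof.
move=> [_ lin]; rewrite -[X in _ + X]mul1r -lin; try exact: expbounded_expR.
by congr T; apply/funext => x; rewrite /wt mul1r mulNr.
Qed.

Lemma positive_functionalZ D T a g : positive_functional D T -> D (cst 0) -> D g ->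
  T (fun x => a * g x) = a * T g.
Proof.
move=> [_ lin] D0 Dg; have h0 : T (cst 0) = 0.
  have := lin 1 _ _ D0 D0; rewrite mul1r.
  have -> : (fun x : R => cst (0 : R) x + 1 * cst 0 x) = cst 0.
    by apply/funext => x /=; rewrite mulr0 addr0.
  by move=> h; apply: (addrI (T (cst 0))); rewrite addr0.
rewrite -[RHS]add0r -h0 -lin//; congr T; apply/funext => x /=.
by rewrite add0r.
Qed.

(** The weight [wt b] is itself an exponential sum, so its image under [T n] converges and stays
    bounded; this makes the approximation error uniform in n. *)
Lemma cvg_approx (T : nat -> (R -> R) -> R) L b g :
  (forall n, positive_functional expbounded (T n)) ->
  positive_functional expbounded L ->
  (forall s, T ^~ (fun x => expR (s * x)) @ \oo --> L (fun x => expR (s * x))) ->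
  expbounded g -> approx b g -> T ^~ g @ \oo --> L g.
Proof.
move=> posT posL TL eg ag; apply/cvgrPdist_le => e e0.
have wtcv : T ^~ (wt b) @ \oo --> L (wt b).
  under eq_fun do rewrite (positive_functional_wt _ (posT _)).
  by rewrite (positive_functional_wt _ posL); apply: cvgD; exact: TL.
set w := L (wt b).
have e4 : 0 < e / (3 * (`|w| + 1)).
  by rewrite divr_gt0// mulr_gt0// ltr_wpDl.
have [l lE] := ag _ e4.
have key U : positive_functional expbounded U ->
    `|U g - U (expsum l)| <= e / (3 * (`|w| + 1)) * U (wt b).
  move=> posU; rewrite -(positive_functionalZ _ posU); first last.
  - exact: expbounded_wt.
  - exact: expbounded_cst.
  apply: (positive_functional_abs posU) => //.
  - exact: expbounded_expsum.
  - rewrite (_ : (fun x => _) = fun x => cst 0 x + e / (3 * (`|w| + 1)) * wt b x).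
      by apply: expboundedD; [exact: expbounded_cst|exact: expbounded_wt].
    by apply/funext => x; rewrite add0r.
  - by apply: expboundedD => //; exact: expbounded_expsum.
  - by apply: expboundedD => //; exact: expbounded_expsum.
have sumcv : T ^~ (expsum l) @ \oo --> L (expsum l).
  under eq_fun do rewrite (positive_functional_expsum _ (posT _)).
  rewrite (positive_functional_expsum _ posL).
  apply: cvg_big => [|p _]; first exact: add_continuous.
  by apply: cvgMr; exact: TL.
have e3 : 0 < e / 3 by rewrite divr_gt0.
near=> n.
have h1 := key _ (posT n); have h2 := key _ posL.
have h3 : `|L (expsum l) - T n (expsum l)| <= e / 3.
  by near: n; move/cvgrPdist_le : sumcv => /(_ _ e3).
have h4 : T n (wt b) <= `|w| + 1.
  have : `|w - T n (wt b)| <= 1.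
    by near: n; move/cvgrPdist_le : wtcv => /(_ _ ltr01).
  by rewrite ler_norml => /andP[+ _]; have := ler_norm w; lra.
have h5 : e / (3 * (`|w| + 1)) * (`|w| + 1) = e / 3.
  by field; rewrite gt_eqF// ltr_wpDl.
have h6 : e / (3 * (`|w| + 1)) * T n (wt b) <= e / 3.
  by rewrite -h5 ler_wpM2l// ltW.
have h7 : e / (3 * (`|w| + 1)) * w <= e / 3.
  rewrite -h5 ler_wpM2l// ?ltW//; have := ler_norm w; lra.
have -> : L g - T n g = (L g - L (expsum l)) + (L (expsum l) - T n (expsum l))
  - (T n g - T n (expsum l)) by ring.
apply: le_trans (ler_normB _ _) _.
have := ler_normD (L g - L (expsum l)) (L (expsum l) - T n (expsum l)).
move: h2; rewrite -/w; lra.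
Unshelve. all: by end_near.
Qed.

Lemma lipschitz_continuous k g : lipschitz_by k g -> continuous g.
Proof.
move=> gk x; apply/cvgrPdist_le => e e0.
have k1 : 0 < `|k| + 1 by rewrite ltr_wpDl.
near=> y; apply: le_trans (gk _ _) _.
have : `|x - y| <= e / (`|k| + 1).
  by near: y; apply: (@cvgrPdist_le _ _ _ _ _ id x).1 => //; exact: divr_gt0.
rewrite ler_pdivlMr// mulrC; apply: le_trans.
by rewrite ler_wpM2r// (le_trans (ler_norm _))// lerDl.
Unshelve. all: by end_near.
Qed.

(* The limit law [L] is characterized by its Laplace transform; passing from
   [T] to [S] is Slutsky's lemma in the L1 form. *)
Lemma cvg_mgf (T S : nat -> (R -> R) -> R) L (dl : nat -> R) f :
  (forall n, positive_functional expbounded (T n)) ->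
  positive_functional expbounded L ->
  (forall n, positive_functional linbounded (S n)) ->
  (forall s, T ^~ (fun x => expR (s * x)) @ \oo --> L (fun x => expR (s * x))) ->
  (forall n g k, lipschitz_by k g -> `|S n g - T n g| <= k * dl n) ->
  dl @ \oo --> 0 -> continuous f -> (exists c, forall x, `|f x| <= c) ->
  S ^~ f @ \oo --> L f.
Proof.
move=> posT posL posS TL ST dl0 cf [M fM]; apply/cvgrPdist_le => e e0.
have wtcv : T ^~ (wt 1) @ \oo --> L (wt 1).
  under eq_fun do rewrite (positive_functional_wt _ (posT _)).
  by rewrite (positive_functional_wt _ posL); apply: cvgD; exact: TL.
set W := L (wt 1) in wtcv *.
(* Eventually [S n h] is at most |W| + 2: one unit is for the convergence of [T n (wt 1)], the other
   for [dl n]. The 4 counts the pieces into which e is divided. *)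
have W20 : 0 < `|W| + 2 by rewrite ltr_wpDl.
have e10 : 0 < e / (4 * (`|W| + 2)) by rewrite divr_gt0// mulr_gt0.
have [g [cg [k [b [b0 gc gk ga]]]] gE] := tame_dense cf fM e10.
set e1 := e / (4 * (`|W| + 2)) in e10 gE.
have contg := lipschitz_continuous gk.
have lf : linbounded f.
  split=> //; exists M => x; apply: le_trans (fM x) _.
  by rewrite ler_peMr ?lerDl// (le_trans _ (fM 0)).
have lg : linbounded g.
  split=> //; exists cg => x; apply: le_trans (gc x) _.
  by rewrite ler_peMr ?lerDl// (le_trans _ (gc 0)).
pose h (x : R) := 1 + `|x|.
have lh : linbounded h.
  split; last by exists 1 => x; rewrite mul1r ger0_norm// addr_ge0.
  by move=> x; apply: cvgD; [exact: cvg_cst|exact: norm_continuous].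
have l0 : linbounded (cst 0).
  by split; [exact: cst_continuous|exists 0 => x; rewrite normr0 mul0r].
have leh : linbounded (fun x => e1 * h x).
  by rewrite (_ : (fun x => _) = fun x => cst 0 x + e1 * h x);
    [exact: linboundedD|apply/funext => x; rewrite add0r].
have hwt x : h x <= wt 1 x.
  apply: le_trans (expR_norm_le_wt x ler01); rewrite mul1r.
  exact: expR_ge1Dx.
have Lfg : `|L f - L g| <= e1 * L h.
  rewrite -(positive_functionalZ _ posL); [|exact: expbounded_cst|exact: linbounded_exp].
  apply: (positive_functional_abs posL) => //; apply: linbounded_exp => //;
    exact: linboundedD.
have Sfg n : `|S n f - S n g| <= e1 * S n h.
  rewrite -(positive_functionalZ _ (posS n))//.
  by apply: (positive_functional_abs (posS n)) => //; exact: linboundedD.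
have Lh : L h <= W.
  by apply: (proj1 posL) => //; [exact: linbounded_exp|exact: expbounded_wt].
have Sh n : S n h <= T n (wt 1) + dl n.
  have h1 : lipschitz_by 1 h.
    by move=> x y; rewrite mul1r /h opprD addrACA subrr add0r ler_dist_dist.
  have := ST n _ _ h1; rewrite mul1r ler_norml => /andP[_].
  have : T n h <= T n (wt 1).
    by apply: (proj1 (posT n)) => //; [exact: linbounded_exp|exact: expbounded_wt].
  lra.
have Tg := cvg_approx posT posL TL (linbounded_exp lg) ga.
have kd : (fun n => k * dl n) @ \oo --> 0.
  by rewrite -[X in _ --> X](mulr0 k); apply: cvgMr.
have e4 : 0 < e / 4 by rewrite divr_gt0.
near=> n.
have h1 : `|L g - T n g| <= e / 4.
  by near: n; move/cvgrPdist_le : Tg => /(_ _ e4).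
have h2 : `|0 - k * dl n| <= e / 4.
  by near: n; move/cvgrPdist_le : kd => /(_ _ e4).
have h3 : `|W - T n (wt 1)| <= 1.
  by near: n; move/cvgrPdist_le : wtcv => /(_ _ ltr01).
have h4 : `|0 - dl n| <= 1.
  by near: n; move/cvgrPdist_le : dl0 => /(_ _ ltr01).
have eE : e1 * (`|W| + 2) = e / 4 by rewrite /e1; field; rewrite gt_eqF.
have h5 : e1 * S n h <= e / 4.
  rewrite -eE ler_pM2l//; apply: le_trans (Sh n) _.
  move: h3 h4; rewrite !ler_norml => /andP[h3 _] /andP[h4 _].
  have := ler_norm W; lra.
have h6 : e1 * L h <= e / 4.
  rewrite -eE ler_pM2l//; have := ler_norm W; lra.
have h7 : `|S n g - T n g| <= e / 4.
  apply: le_trans (ST n g k gk) _; move: h2; rewrite ler_norml => /andP[]; lra.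
have -> : L f - S n f = (L f - L g) + (L g - T n g) - (S n g - T n g) - (S n f - S n g)
  by ring.
have := Sfg n; have := ler_normB (L f - L g + (L g - T n g) - (S n g - T n g)) (S n f - S n g).
have := ler_normB (L f - L g + (L g - T n g)) (S n g - T n g).
have := ler_normD (L f - L g) (L g - T n g).
lra.
Unshelve. all: by end_near.
Qed.

End positive_functionals.

(** * Mixing *)

Section nonmeasurable_integrand.
Context {R : realType} {d} {T : measurableType d}.
Variable mu : {measure set T -> \bar R}.
Local Open Scope ereal_scope.

(** The integral of a nonnegative function is a supremum over the simple functions below it, hence
    monotone without any measurability. *)
Lemma ge0_le_integral_any (D : set T) (f g : T -> \bar R) :
  (forall x, D x -> 0 <= f x) -> (forall x, D x -> f x <= g x) ->
  \int[mu]_(x in D) f x <= \int[mu]_(x in D) g x.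
Proof.
move=> f0 fg; rewrite !ge0_integralE//; last first.
  by move=> x Dx; exact: le_trans (f0 _ Dx) (fg _ Dx).
apply: le_ereal_sup => _ [h /= hf <-]; exists h => // x.
apply: le_trans (hf x) _; rewrite !patchE; case: ifPn => // /set_mem.
exact: fg.
Qed.

(** The integral of f lies between those of g altered to 0 and to +oo on the exceptional null set,
    and both of these equal the integral of g. *)
Lemma ge0_ae_eq_integral_any (D : set T) (f g : T -> \bar R) :
  measurable D -> measurable_fun D g ->
  (forall x, D x -> 0 <= f x) -> (forall x, D x -> 0 <= g x) ->
  ae_eq mu D f g -> \int[mu]_(x in D) f x = \int[mu]_(x in D) g x.
Proof.
move=> mD mg f0 g0 [N [mN N0 subN]].
have fgN x : D x -> ~ N x -> f x = g x.
  by move=> Dx Nx; apply: contrapT => h; apply: Nx; apply: subN => /= /(_ Dx).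
have Nae h : (forall x, D x -> ~ N x -> h x = g x) -> ae_eq mu D h g.
  move=> hE; exists N; split => // x /= /not_implyP[Dx hx].
  by apply: contrapT => Nx; apply: hx; exact: hE.
pose l x := if x \in N then 0 else g x.
pose u x := if x \in N then +oo else g x.
have mN' : measurable_fun D (fun x => x \in N).
  apply: (@measurable_fun_bool _ _ _ _ true).
  have -> : (fun x => x \in N) @^-1` [set true] = N by apply/seteqP; split => x /=; [move/set_mem|move/mem_set].
  exact: measurableI.
have ml : measurable_fun D l.
  apply: measurable_fun_if => //; apply: measurable_funS mg => //; exact: subIsetl.
have mu' : measurable_fun D u.
  apply: measurable_fun_if => //; apply: measurable_funS mg => //; exact: subIsetl.
have hl : \int[mu]_(x in D) l x = \int[mu]_(x in D) g x.
  apply: ge0_ae_eq_integral => //.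
    by move=> x Dx; rewrite /l; case: ifP => // _; exact: g0.
  by apply: Nae => x _ Nx; rewrite /l memNset.
have hu : \int[mu]_(x in D) u x = \int[mu]_(x in D) g x.
  apply: ge0_ae_eq_integral => //.
    by move=> x Dx; rewrite /u; case: ifP => // _; exact: g0.
  by apply: Nae => x _ Nx; rewrite /u memNset.
apply/eqP; rewrite eq_le; apply/andP; split.
  rewrite -hu; apply: ge0_le_integral_any => // x Dx; rewrite /u.
  by have [Nx|Nx] := pselect (N x); [rewrite mem_set// leey|rewrite memNset// fgN].
rewrite -hl; apply: ge0_le_integral_any => x Dx; rewrite /l.
  by case: ifP => // _; exact: g0.
by have [Nx|Nx] := pselect (N x); [rewrite mem_set// f0|rewrite memNset// fgN].
Qed.

(* f need not be measurable: L_ is only almost surely equal to a measurable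
   function. *)
Lemma ae_eq_integral_any (D : set T) (f g : T -> \bar R) :
  measurable D -> measurable_fun D g -> ae_eq mu D f g ->
  \int[mu]_(x in D) f x = \int[mu]_(x in D) g x.
Proof.
move=> mD mg /ae_eq_funeposneg[fgp fgn].
rewrite integralE [in RHS]integralE; congr (_ - _).
  by apply: ge0_ae_eq_integral_any => //; exact: measurable_funepos.
by apply: ge0_ae_eq_integral_any => //; exact: measurable_funeneg.
Qed.

End nonmeasurable_integrand.

Section integrable_bounded.
Context {R : realType} {d} {T : measurableType d}.

Lemma integrable_bounded (mu : {finite_measure set T -> \bar R}) (D : set T)
    (f : T -> R) (K : R) : measurable D -> measurable_fun D f ->
  (forall x, D x -> `|f x| <= K) -> mu.-integrable D (EFin \o f).
Proof.
move=> mD mf fK; apply: measurable_bounded_integrable => //.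
  by rewrite ltey_eq fin_num_measure.
by exists K; split; [exact: num_real|move=> y Ky x Dx; exact: le_trans (fK _ Dx) (ltW Ky)].
Qed.

(* Renyi's mixing argument: [V m] sums terms [+- W n] chosen almost orthogonal to
   the previous ones, each contributing at least [e] to the integral over [H],
   while the second moment grows only linearly in [m]. *)
Lemma mixing_decorrelation (P : probability T R) (W : nat -> T -> R) (C : R) :
  (forall n, measurable_fun setT (W n)) -> (forall n w, `|W n w| <= C) ->
  (forall k, (fun n => \int[P]_w (W n w * W k w)) @ \oo --> (0 : R)) ->
  forall H, measurable H -> (fun n => \int[P]_(w in H) W n w) @ \oo --> (0 : R).
Proof.
move=> mW WC Worth H mH; apply/cvgrPdist_lt => e e0.
have C0 : 0 <= C by exact: le_trans (normr_ge0 _) (WC 0%N point).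
have PT : fine (P setT) = 1 by have -> : P setT = 1%E by exact: probability_setT.
apply: contrapT => nH.
have freq N : exists2 n, (N <= n)%N & e <= `|\int[P]_(w in H) W n w|.
  apply: contrapT => nN; apply: nH; exists N => // n /= Nn.
  rewrite sub0r normrN ltNge; apply/negP => en; apply: nN; by exists n.
(* [C ^+ 2 + 2] bounds the growth of the second moment in one step: C^2 from the square of [W n],
   and 2 from the cross term, n being so large that the integral of [W n * V] is below 1 in absolute
   value. *)
pose good m (V : T -> R) := [/\ measurable_fun setT V,
  (exists B, forall w, `|V w| <= B),
  m%:R * e <= \int[P]_(w in H) V w,
  \int[P]_w (V w ^+ 2) <= m%:R * (C ^+ 2 + 2) &
  (fun n => \int[P]_w (W n w * V w)) @ \oo --> (0 : R)].
have intb (D : set T) (f : T -> R) (B : R) : measurable D -> measurable_fun setT f -> (forall w, `|f w| <= B) ->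
    P.-integrable D (EFin \o f).
  move=> mD mf fB; apply: (integrable_bounded _ mD _ (fun x _ => fB x)).
  exact: measurable_funTS.
have WV n (V : T -> R) (B : R) : measurable_fun setT V -> (forall w, `|V w| <= B) ->
    P.-integrable setT (EFin \o (fun w => W n w * V w)).
  move=> mV VB; apply: (intb _ _ (C * B)) => //; first exact: measurable_funM.
  by move=> w; rewrite normrM ler_pM.
have step m : exists V, good m V.
  elim: m => [|m [V [mV [B VB] Ve V2 VW]]].
    exists (cst 0); split.
    - exact: measurable_cst.
    - by exists 0 => w; rewrite normr0.
    - by rewrite mul0r Rintegral_ge0.
    - by under eq_Rintegral do rewrite expr0n; rewrite Rintegral_cst// !mul0r.
    - by under eq_fun do under eq_Rintegral do rewrite mulr0;
        under eq_fun do rewrite Rintegral_cst// mul0r; exact: cvg_cst.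
  have /cvgrPdist_lt /(_ _ ltr01) [N _ NE] := VW.
  have [n Nn ne] := freq N.
  have VWn : `|\int[P]_w (W n w * V w)| < 1 by have := NE n Nn; rewrite sub0r normrN.
  have [s s1 sE] : exists2 s : R, s ^+ 2 = 1 & s * \int[P]_(w in H) W n w = `|\int[P]_(w in H) W n w|.
    case: (ger0P (\int[P]_(w in H) W n w)) => _; first by exists 1; rewrite ?mul1r ?expr1n.
    by exists (-1); rewrite ?mulN1r// sqrrN expr1n.
  have s1' : `|s| = 1.
    by apply/eqP; rewrite -sqrp_eq1// real_normK ?num_real// s1.
  have sW w : `|s * W n w| <= C by rewrite normrM s1' mul1r.
  have msW : measurable_fun setT (fun w => s * W n w) by exact: measurable_funM.
  exists (fun w => V w + s * W n w); split.
  - exact: measurable_funD.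
  - by exists (B + C) => w; apply: le_trans (ler_normD _ _) _; exact: lerD.
  - rewrite RintegralD//; [|exact: intb VB|exact: intb sW].
    rewrite RintegralZl//; last exact: intb (WC n).
    by rewrite sE -natr1 mulrDl mul1r lerD.
  - have -> : \int[P]_w ((V w + s * W n w) ^+ 2) =
        \int[P]_w (V w ^+ 2 + (2 * s * (W n w * V w) + W n w ^+ 2)).
      apply: eq_Rintegral => w _.
      have e1 : W n w ^+ 2 = s ^+ 2 * W n w ^+ 2 by rewrite s1 mul1r.
      by rewrite [X in _ + (_ + X)]e1; ring.
    have i2 (f : T -> R) B' : measurable_fun setT f -> (forall w, `|f w| <= B') ->
        P.-integrable setT (EFin \o (fun w => f w ^+ 2)).
      move=> mf fB; apply: (intb _ _ (B' ^+ 2)) => //; first exact: measurable_funX.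
      by move=> w; rewrite normrX lerXn2r ?nnegrE// (le_trans _ (fB w)).
    have i3 : P.-integrable setT (EFin \o (fun w => 2 * s * (W n w * V w))).
      apply: (@eq_integrable _ _ _ P _ _ (fun w => (2 * s)%:E * (W n w * V w)%:E)%E) => //.
      by apply: integrableZl => //; exact: (WV n V B).
    have i4 : P.-integrable setT (EFin \o (fun w => 2 * s * (W n w * V w) + W n w ^+ 2)).
      apply: (@eq_integrable _ _ _ P _ _
        (fun w => (2 * s * (W n w * V w))%:E + (W n w ^+ 2)%:E)%E) => //.
      by apply: integrableD => //; exact: (i2 _ C).
    rewrite RintegralD//; last exact: (i2 _ B).
    rewrite RintegralD//; last exact: (i2 _ C).
    rewrite RintegralZl//; last exact: (WV n V B).
    have h1 : `|2 * s * \int[P]_w (W n w * V w)| <= 2.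
      by rewrite !normrM s1' mulr1 ger0_norm// ler_piMr// ltW.
    have h2 : \int[P]_w (W n w ^+ 2) <= C ^+ 2.
      apply: (@le_trans _ _ (\int[P]_w (C ^+ 2))).
        apply: le_Rintegral => //; first exact: (i2 _ C).
        - apply: (intb _ _ `|C ^+ 2|) => //.
        - by move=> w _; rewrite -real_normK ?num_real// lerXn2r ?nnegrE.
      by rewrite Rintegral_cst// PT mulr1.
    have h3 := ler_norm (2 * s * \int[P]_w (W n w * V w)).
    by rewrite -natr1 mulrDl mul1r; lra.
  - have -> : (fun k => \int[P]_w (W k w * (V w + s * W n w))) =
        (fun k => \int[P]_w (W k w * V w) + s * \int[P]_w (W k w * W n w)).
      apply/funext => k; rewrite -RintegralZl//; last exact: (WV k (W n) C).
      rewrite -RintegralD//; [|exact: (WV k V B)|].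
        by apply: eq_Rintegral => w _; ring.
      apply: (@eq_integrable _ _ _ P _ _ (fun w => s%:E * (W k w * W n w)%:E)%E) => //.
      by apply: integrableZl => //; exact: (WV k (W n) C).
    have -> : (0 : R) = 0 + s * 0 by rewrite mulr0 addr0.
    by apply: cvgD => //; apply: cvgMr; exact: Worth.
pose C' := C ^+ 2 + 2.
have C'0 : 0 < C' by rewrite ltr_wpDl// sqr_ge0.
have l0 : 0 < C' / e by rewrite divr_gt0.
have [V [mV [B VB] Ve V2 _]] := step (truncn (C' / e ^+ 2)).+1.
set m := (truncn _).+1 in Ve V2.
have mC : C' / e ^+ 2 < m%:R by exact: truncnS_gt.
have B0 : 0 <= B by exact: le_trans (normr_ge0 _) (VB point).
have iV2 : P.-integrable setT (EFin \o (fun w => V w ^+ 2)).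
  apply: (intb _ _ (B ^+ 2)) => //; first exact: measurable_funX.
  by move=> w; rewrite normrX lerXn2r ?nnegrE.
have iV2' : P.-integrable setT (EFin \o (fun w => V w ^+ 2 / (2 * (C' / e)))).
  apply: (@eq_integrable _ _ _ P _ _ (fun w => (V w ^+ 2)%:E * ((2 * (C' / e))^-1)%:E)%E) => //.
  exact: integrableZr.
have ic : P.-integrable setT (EFin \o (fun w : T => C' / e / 2)).
  exact: (intb _ _ `|C' / e / 2|).
have iq : P.-integrable setT (EFin \o (fun w => V w ^+ 2 / (2 * (C' / e)) + C' / e / 2)).
  apply: (@eq_integrable _ _ _ P _ _
    (fun w => (V w ^+ 2 / (2 * (C' / e)))%:E + (C' / e / 2)%:E)%E) => //.
  exact: integrableD.
(* This is V <= V^2 / (2 l) + l / 2 with l = C' / e. Together with the bounds on V it gives m e <= m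
   e / 2 + C' / (2 e), which contradicts m > C' / e^2. *)
have h1 : \int[P]_(w in H) V w <= \int[P]_w (V w ^+ 2 / (2 * (C' / e)) + C' / e / 2).
  rewrite Rintegral_mkcond; apply: le_Rintegral => //.
    rewrite -restrict_EFin; apply/(integrable_mkcond _ mH); exact: (intb _ _ _ mH mV VB).
  move=> w _; rewrite patchE; case: ifP => _; last first.
    have le2 : 0 <= 2 * (C' / e) by rewrite mulr_ge0// ltW.
    by rewrite addr_ge0// divr_ge0 ?sqr_ge0 ?(ltW l0).
  rewrite -subr_ge0.
  rewrite (_ : _ - V w = (V w - C' / e) ^+ 2 / (2 * (C' / e))).
    by rewrite divr_ge0 ?sqr_ge0// mulr_ge0// ltW.
  by field; rewrite !gt_eqF.
have h2 : \int[P]_w (V w ^+ 2 / (2 * (C' / e)) + C' / e / 2) <= m%:R * e / 2 + C' / e / 2.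
  rewrite RintegralD// (RintegralZr _ measurableT iV2) Rintegral_cst// PT mulr1 lerD2r.
  have l20 : 0 < 2 * (C' / e) by rewrite mulr_gt0.
  rewrite ler_pdivrMr//; apply: le_trans V2 _.
  rewrite le_eqVlt; apply/orP; left; apply/eqP.
  by rewrite /C'; field; rewrite gt_eqF.
have h3 : C' / e < m%:R * e.
  move: mC; rewrite expr2 invfM mulrA ltr_pdivrMr//.
by have := le_trans Ve (le_trans h1 h2); lra.
Qed.

End integrable_bounded.

(** * The Laplace transform of the Gaussian law *)

Section gaussian.
Context {R : realType}.
Implicit Types (v s x : R) (g : R -> R).
Let leb := @lebesgue_measure R.

(** Completing the square: exponential tilting by s moves the mean to s v. *)
Lemma expR_normal_pdf v s x : 0 < v ->
  expR (s * x) * normal_pdf 0 (Num.sqrt v) x =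
  expR (s ^+ 2 * v / 2) * normal_pdf (s * v) (Num.sqrt v) x.
Proof.
move=> v0; have sv : Num.sqrt v != 0 by rewrite gt_eqF// sqrtr_gt0.
rewrite !normal_pdfE// /normal_fun sqr_sqrtr ?ltW// mulrCA [RHS]mulrCA -!expRD.
by congr (_ * expR _); rewrite subr0 -mulr_natl; field; rewrite gt_eqF.
Qed.

Lemma integrable_expR_normal v s : 0 < v ->
  leb.-integrable setT (EFin \o (fun x => expR (s * x) * normal_pdf 0 (Num.sqrt v) x)).
Proof.
move=> v0; apply: (@eq_integrable _ _ _ leb _ _
  (fun x => (expR (s ^+ 2 * v / 2))%:E * (normal_pdf (s * v) (Num.sqrt v) x)%:E)%E) => //.
  by move=> x _ /=; rewrite expR_normal_pdf// EFinM.
by apply: integrableZl => //; exact: integrable_normal_pdf.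
Qed.

Lemma gauss_int_expR v s : 0 <= v ->
  gauss_int v (fun x => expR (s * x)) = expR (s ^+ 2 * v / 2).
Proof.
rewrite le_eqVlt /gauss_int => /predU1P[<-|v0].
  by rewrite eqxx !mulr0 mul0r.
rewrite gt_eqF//; under eq_integral do rewrite expR_normal_pdf// EFinM.
rewrite ge0_integralZl//.
- by rewrite integral_normal_pdf mule1.
- by apply/measurable_EFinP; exact: measurable_normal_pdf.
- by move=> x _; rewrite lee_fin normal_pdf_ge0.
Qed.

Lemma integrable_expbounded_normal v g : 0 < v -> expbounded g ->
  leb.-integrable setT (EFin \o (fun x => g x * normal_pdf 0 (Num.sqrt v) x)).
Proof.
move=> v0 [cg [b [k [b0 gk]]]].
have pdf0 := normal_pdf_ge0 (0 : R) (Num.sqrt v).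
have k0 : 0 <= k by rewrite -(pmulr_lge0 _ (wt_gt0 b 0)) (le_trans _ (gk 0)).
apply: (@le_integrable _ _ _ leb _ _ _ (fun x =>
  k%:E * ((expR (b * x) * normal_pdf 0 (Num.sqrt v) x)%:E +
          (expR (- b * x) * normal_pdf 0 (Num.sqrt v) x)%:E))%E) => //.
- apply/measurable_EFinP; apply: measurable_funM; last exact: measurable_normal_pdf.
  exact: continuous_measurable_fun.
- move=> x _; rewrite -EFinD -EFinM /= lee_fin -mulrDl mulNr -/(wt b x).
  rewrite normrM (ger0_norm (pdf0 x)) [leRHS]ger0_norm; last first.
    by rewrite !mulr_ge0// ltW// wt_gt0.
  by rewrite mulrA ler_wpM2r.
- apply: integrableZl => //; apply: integrableD => //; exact: integrable_expR_normal.
Qed.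

Lemma positive_gauss_int v (c : R) : 0 <= v -> 0 <= c ->
  positive_functional expbounded (fun g => c * gauss_int v g).
Proof.
rewrite /gauss_int le_eqVlt => /predU1P[<-|v0] c0.
  rewrite eqxx; split; first by move=> g h _ _ gh; rewrite ler_wpM2l.
  by move=> a g h _ _; ring.
have ig := fun g => @integrable_expbounded_normal v g v0.
rewrite gt_eqF//; split.
  move=> g h eg eh gh; rewrite ler_wpM2l//.
  apply: (@le_Rintegral _ _ _ leb setT) => //; [exact: ig|exact: ig|].
  by move=> x _; rewrite ler_wpM2r// normal_pdf_ge0.
move=> a g h eg eh; rewrite mulrCA -mulrDr; congr (_ * _).
rewrite -[a * _](@RintegralZl _ _ _ leb setT)//; last exact: ig.
rewrite -[RHS](@RintegralD _ _ _ leb setT)//; [|exact: ig|].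
  by apply: eq_Rintegral => x _; ring.
apply: (@eq_integrable _ _ _ leb _ _
  (fun x => a%:E * (h x * normal_pdf 0 (Num.sqrt v) x)%:E)%E) => //.
by apply: integrableZl => //; exact: ig.
Qed.

End gaussian.

(** * The Gamma function and the growth of the compensator *)

Section gamma.
Context {R : realType}.
Implicit Types (x y z s t : R).
Let mu := @lebesgue_measure R.

(** The tangent at 1 to the concave t^s. After division by t^s it follows from 1 + x <= e^x at - s
    ln t and (1 - s) ln t, taken with weights 1 - s and s, under which these points average to 0. *)
Lemma powR_le_tangent t s : 0 < t -> 0 <= s <= 1 -> powR t s <= 1 - s + s * t.
Proof.
move=> t0 /andP[s0 s1]; rewrite /powR gt_eqF//.
have h1 := expR_ge1Dx (- (s * ln t)).
have h2 := expR_ge1Dx ((1 - s) * ln t).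
have h : 1 <= (1 - s) * expR (- (s * ln t)) + s * expR ((1 - s) * ln t).
  have : (1 - s) * (1 - s * ln t) <= (1 - s) * expR (- (s * ln t)).
    by rewrite ler_wpM2l// subr_ge0.
  have : s * (1 + (1 - s) * ln t) <= s * expR ((1 - s) * ln t).
    by rewrite ler_wpM2l.
  lra.
have := ler_wpM2r (expR_ge0 (s * ln t)) h; rewrite mul1r => /le_trans; apply.
rewrite mulrDl -!mulrA -!expRD addNr expR0 mulr1.
rewrite (_ : (1 - s) * ln t + s * ln t = ln t); last by ring.
by rewrite lnK.
Qed.

(** From ln x <= x at x = t / (2 s). The exponent t / 2 leaves an integrable e^(- t / 2) in
    [gamma_density_le]. *)
Lemma powR_le_expR t s : 0 < t -> 0 < s ->
  powR t s <= expR (s * ln (2 * s)) * expR (t / 2).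
Proof.
move=> t0 s0; rewrite /powR gt_eqF// -expRD ler_expR.
have s20 : 0 < 2 * s by rewrite mulr_gt0.
have := ln_sublinear (divr_gt0 t0 s20); rewrite ln_div ?posrE// => h.
have : s * (ln t - ln (2 * s)) <= s * (t / (2 * s)) by rewrite ler_pM2l// ltW.
rewrite (_ : s * (t / (2 * s)) = t / 2); last by field; rewrite gt_eqF.
lra.
Qed.

Definition gamma_density x t : R := powR t (x - 1) * expR (- t).

Lemma gamma_density_ge0 x t : 0 <= gamma_density x t.
Proof. by rewrite mulr_ge0 ?powR_ge0 ?expR_ge0. Qed.

Lemma is_derive_gamma_density z t : 0 < t ->
  is_derive t 1 (gamma_density (z + 1)) (z * gamma_density z t - gamma_density (z + 1) t).
Proof.
move=> t0; rewrite /gamma_density addrK.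
have hp : is_derive t 1 (fun y : R => powR y z) (z * powR t (z - 1)) by exact: is_derive1_powR.
have he : is_derive t 1 (fun y : R => expR (- y)) (- expR (- t)).
  have hN : is_derive t 1 (fun y : R => - y) (-1) by exact: is_deriveN.
  have := @is_derive1_comp R expR (fun y : R => - y) t _ _ (is_derive_expR (- t)) hN.
  by rewrite mulrN1.
apply: is_derive_eq; rewrite /GRing.scale /=; ring.
Qed.

Lemma continuous_gamma_density z t : 0 < t -> {for t, continuous (gamma_density z)}.
Proof.
move=> t0; have := is_derive_gamma_density (z - 1) t0; rewrite subrK => h.
by apply: differentiable_continuous; apply/derivable1_diffP; exact: ex_derive.
Qed.

Lemma within_continuous_gamma_density z a b : 0 < a ->
  {within `[a, b], continuous (gamma_density z)}.
Proof.
move=> a0; apply: continuous_in_subspaceT => t; move/set_mem; rewrite /= in_itv /= => /andP[at_ _].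
by apply: continuous_gamma_density; exact: lt_le_trans at_.
Qed.

Lemma measurable_gamma_density z : measurable_fun [set t : R | 0 < t] (gamma_density z).
Proof.
rewrite (_ : [set t : R | 0 < t] = `]0, +oo[%classic); last by rewrite set_itvE.
apply: open_continuous_measurable_fun; first exact: interval_open.
by move=> t; move/set_mem; rewrite /= in_itv /= andbT; exact: continuous_gamma_density.
Qed.

(** [Gamma] takes [fine], which sends an infinite integral to 0; the functional equation is proved
    for the extended value, and finiteness comes afterwards. *)
Definition Gammae x : \bar R :=
  (\int[mu]_(t in [set t : R | (0 < t)%R]) (gamma_density x t)%:E)%E.

Lemma measurable_pos : measurable [set t : R | 0 < t].
Proof.
rewrite (_ : [set t : R | 0 < t] = `]0, +oo[%classic) ?set_itvE//.
by rewrite -set_itvE.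
Qed.

Lemma Gammae_ge0 x : (0 <= Gammae x)%E.
Proof. by apply: integral_ge0 => t _; rewrite lee_fin gamma_density_ge0. Qed.

(** Compact intervals exhausting the half-line, on which integration by parts is legitimate; n.+2
    makes them nondegenerate from n = 0 on. *)
Let J n : set R := `[n.+2%:R^-1, n.+2%:R]%classic.

Let bigcupJ : \bigcup_n J n = [set t : R | 0 < t].
Proof.
apply/seteqP; split => [t [n _]|t /= t0].
  rewrite /J /= in_itv /= => /andP[h _]; apply: lt_le_trans h.
  by rewrite invr_gt0.
exists (maxn (truncn t) (truncn t^-1)) => //; rewrite /J /= in_itv /=; apply/andP; split.
  rewrite -[leRHS]invrK lef_pV2 ?posrE ?invr_gt0//.
  apply: le_trans (ltW (truncnS_gt _)) _; rewrite ler_nat ltnW// !ltnS.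
  exact: leq_maxr.
apply: le_trans (ltW (truncnS_gt _)) _; rewrite ler_nat ltnW// !ltnS.
exact: leq_maxl.
Qed.

Let cvg_Gammae x :
  (\int[mu]_(t in J n) (gamma_density x t)%:E)%E @[n --> \oo] --> Gammae x.
Proof.
rewrite /Gammae -bigcupJ; apply: ge0_nondecreasing_set_cvg_integral.
- apply/nondecreasing_seqP => n; rewrite subsetEset /J; apply: subset_itv.
    by rewrite leBSide /= lef_pV2 ?posrE// ler_nat.
  by rewrite leBSide /= ler_nat.
- by move=> n; exact: measurable_itv.
- move=> n; apply/measurable_EFinP; apply: measurable_funS (measurable_gamma_density x).
    exact: measurable_pos.
  by rewrite -bigcupJ; exact: bigcup_sup.
- by move=> n t _; rewrite lee_fin gamma_density_ge0.
Qed.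

Let integrable_J x n : mu.-integrable (J n) (EFin \o gamma_density x).
Proof.
apply: continuous_compact_integrable; first exact: segment_compact.
by apply: within_continuous_gamma_density; rewrite invr_gt0.
Qed.

Let parts_J z n : (z%:E * \int[mu]_(t in J n) (gamma_density z t)%:E =
  (gamma_density (z + 1) n.+2%:R - gamma_density (z + 1) n.+2%:R^-1)%:E +
  \int[mu]_(t in J n) (gamma_density (z + 1) t)%:E)%E.
Proof.
have i2 : 0 < n.+2%:R^-1 :> R by rewrite invr_gt0.
have lt2 : n.+2%:R^-1 < n.+2%:R :> R.
  by rewrite (@lt_trans _ _ 1)// ?ltr1n// invf_lt1// ltr1n.
have dint : mu.-integrable (J n)
    (EFin \o (fun t => z * gamma_density z t - gamma_density (z + 1) t)).
  apply: (@eq_integrable _ _ _ mu _ _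
     (fun t => z%:E * (gamma_density z t)%:E - (gamma_density (z + 1) t)%:E)%E) => //.
    exact: measurable_itv.
  apply: integrableB; [exact: measurable_itv| |exact: integrable_J].
  by apply: integrableZl; [exact: measurable_itv|exact: integrable_J].
have FTC := @continuous_FTC2 R (fun t => z * gamma_density z t - gamma_density (z + 1) t)
  (gamma_density (z + 1)) n.+2%:R^-1 n.+2%:R lt2.
rewrite EFinB -FTC.
- have mJ : @measurable _ (measurableTypeR R) (J n) by exact: measurable_itv.
  have HZ := integralZl mJ (integrable_J z n) z.
  have HD := integralD mJ dint (integrable_J (z + 1) n).
  rewrite /= in HZ HD; rewrite -HZ -[X in (X + _)%E]/(\int[mu]_(x in J n) _)%E -HD.
  apply: eq_integral => t _ /=; rewrite -EFinD -EFinM; congr EFin; ring.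
- apply: continuous_in_subspaceT => t; move/set_mem; rewrite /= in_itv /= => /andP[at_ _].
  have t0 := lt_le_trans i2 at_.
  apply: cvgB; last exact: continuous_gamma_density.
  by apply: cvgMr; exact: continuous_gamma_density.
- split.
  + move=> t; rewrite in_itv /= => /andP[at_ _].
    by have h := is_derive_gamma_density z (lt_trans i2 at_); exact: ex_derive.
  + by apply: cvg_at_right_filter; exact: continuous_gamma_density.
  + by apply: cvg_at_left_filter; exact: continuous_gamma_density.
- move=> t; rewrite in_itv /= => /andP[at_ _]; rewrite derive1E.
  by have h := is_derive_gamma_density z (lt_trans i2 at_); exact: derive_val.
Qed.

Let gamma_density_le z t : 0 < z -> 0 < t ->
  gamma_density (z + 1) t <= expR (z * ln (2 * z)) * expR (- (t / 2)).
Proof.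
move=> z0 t0; rewrite /gamma_density addrK.
apply: le_trans (ler_wpM2r (expR_ge0 _) (powR_le_expR t0 z0)) _.
set A := expR (z * _); rewrite -mulrA -expRD ler_wpM2l ?expR_ge0// ler_expR; lra.
Qed.

Let cvg_gamma_density_infty z : 0 < z ->
  gamma_density (z + 1) n.+2%:R @[n --> \oo] --> 0.
Proof.
move=> z0; apply: (@squeeze_cvgr _ _ _ _ (cst 0)
  (fun n => expR (z * ln (2 * z)) * expR (- (n.+2%:R / 2)))).
- near=> n; rewrite gamma_density_ge0 /=; exact: gamma_density_le.
- exact: cvg_cst.
- rewrite -[X in _ --> X](mulr0 (expR (z * ln (2 * z)))); apply: cvgMr.
  apply: (@cvg_comp _ _ _ (fun n : nat => n.+2%:R / 2 : R) (fun x => expR (- x)) _ +oo%R).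
    apply/cvgryPge => A; near=> n; rewrite ler_pdivlMr//.
    apply: le_trans (_ : n%:R <= _); last by rewrite ler_nat ltnW.
    by near: n; exact: nbhs_infty_ger.
  exact: cvgr_expR.
Unshelve. all: by end_near.
Qed.

Let cvg_gamma_density_zero z : 0 < z ->
  gamma_density (z + 1) n.+2%:R^-1 @[n --> \oo] --> 0.
Proof.
move=> z0; apply: (@squeeze_cvgr _ _ _ _ (cst 0) (fun n => powR n.+2%:R^-1 z)).
- near=> n; rewrite gamma_density_ge0 /= /gamma_density addrK ler_piMr ?powR_ge0//.
- exact: cvg_cst.
- have := powR_cvg0 z0; apply: cvg_comp => A [e /= e0 eA].
  have h : (n.+1%:R^-1 : R) @[n --> \oo] --> 0 by exact: cvg_harmonic.
  move: h => /cvgr0Pnorm_lt /(_ _ e0) [N _ NE]; exists N => // n /= Nn.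
  apply: eA; rewrite ?invr_gt0//= sub0r normrN.
  by apply: (NE n.+1); rewrite /= (leq_trans Nn).
Unshelve. all: by end_near.
Qed.

(** Integration by parts on [J n], whose boundary terms vanish in the limit. Being an identity of
    extended reals, it carries finiteness in [Gammae_lty] from z + 1, where the density is dominated
    by an exponential one, down to z. *)
Lemma GammaeS z : 0 < z -> Gammae (z + 1) = (z%:E * Gammae z)%E.
Proof.
move=> z0.
have h1 : (z%:E * \int[mu]_(t in J n) (gamma_density z t)%:E)%E @[n --> \oo] -->
    (z%:E * Gammae z)%E.
  by apply: cvgeZl => //; exact: (@cvg_Gammae z).
apply: (cvg_unique (@ereal_hausdorff R) _ h1).
rewrite /=; under eq_fun do rewrite parts_J.
rewrite -(add0e (Gammae (z + 1))); apply: cvgeD.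
- by rewrite ge0_adde_def// ?inE ?Gammae_ge0.
- apply/cvg_EFin; first by near=> n.
  rewrite -(subr0 (0 : R)); apply: cvgB.
    exact: cvg_gamma_density_infty.
  exact: cvg_gamma_density_zero.
- exact: (@cvg_Gammae (z + 1)).
Unshelve. all: by end_near.
Qed.

Lemma Gammae_lty z : 0 < z -> (Gammae z < +oo)%E.
Proof.
move=> z0.
suff h : (Gammae (z + 1) < +oo)%E.
  have := GammaeS z0; have := Gammae_ge0 z.
  case: (Gammae z) => [x _ _|_ h1|//]; first by rewrite ltry.
  by move: h; rewrite h1 gt0_muley ?lte_fin// ltxx.
set C := expR (z * ln (2 * z)).
apply: (@le_lt_trans _ _ (\int[mu]_t ((2 * C)%:E * (exponential_pdf 2^-1 t)%:E))%E).
  rewrite /Gammae [leLHS]integral_mkcond; apply: ge0_le_integral => //.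
  - by move=> t _; apply: erestrict_ge0 => {}t _; rewrite lee_fin gamma_density_ge0.
  - apply/(measurable_restrictT _ _).1 => //; first exact: measurable_pos.
    by apply/measurable_EFinP; exact: measurable_gamma_density.
  - apply/measurable_EFinP; apply: measurable_funM => //.
    exact: measurable_exponential_pdf.
  - move=> t _; rewrite patchE; case: ifPn => [|_]; last first.
      by rewrite mule_ge0// ?lee_fin ?mulr_ge0 ?expR_ge0// exponential_pdf_ge0.
    move=> /set_mem /= t0; rewrite -EFinM lee_fin exponential_pdfE; last exact: ltW.
    apply: le_trans (gamma_density_le z0 t0) _.
    rewrite (_ : - 2^-1 * t = - (t / 2)); last by ring.
    by rewrite (_ : 2 * C * _ = C * expR (- (t / 2)))// /C; field.
rewrite ge0_integralZl//.
- by rewrite integral_exponential_pdf// mule1 ltry.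
- by apply/measurable_EFinP; exact: measurable_exponential_pdf.
- by move=> t _; rewrite lee_fin exponential_pdf_ge0.
- by rewrite lee_fin mulr_ge0// expR_ge0.
Qed.

Lemma Gammae_gt0 z : 0 < z -> (0 < Gammae z)%E.
Proof.
move=> z0.
have h : (\int[mu]_(t in `[(1 : R)%R, (2 : R)%R]%classic) (expR (- (2 * `|z - 1|) - 2))%:E <= Gammae z)%E.
  apply: (@le_trans _ _ (\int[mu]_(t in `[(1 : R)%R, (2 : R)%R]%classic) (gamma_density z t)%:E)%E).
    apply: ge0_le_integral => //.
    - apply/measurable_EFinP; apply: measurable_funS (measurable_gamma_density z) => //.
        exact: measurable_pos.
      by move=> t; rewrite /= in_itv /= => /andP[t1 _]; apply: lt_le_trans t1.
    - move=> t; rewrite /= in_itv /= => /andP[t1 t2]; rewrite lee_fin.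
      have t0 : 0 < t by apply: lt_le_trans t1.
      rewrite /gamma_density /powR gt_eqF// -expRD ler_expR lerD//; last by rewrite lerN2.
      have l0 := ln_ge0 t1; have l2 : ln t <= 2.
        by apply: le_trans (ltW (ln_sublinear t0)) t2.
      have : `|(z - 1) * ln t| <= 2 * `|z - 1|.
        by rewrite normrM (ger0_norm l0) mulrC ler_wpM2r.
      by rewrite ler_norml => /andP[].
  apply: ge0_subset_integral => //.
  - exact: measurable_pos.
  - by apply/measurable_EFinP; exact: measurable_gamma_density.
  - by move=> t _; rewrite lee_fin gamma_density_ge0.
  - by move=> t; rewrite /= in_itv /= => /andP[t1 _]; apply: lt_le_trans t1.
apply: lt_le_trans h; rewrite integral_cst//= lebesgue_measure_itv /= lte_fin ltr1n.
by rewrite mule_gt0// lte_fin ?expR_gt0// subr_gt0 ltr1n.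
Qed.

Lemma Gamma_fine z : 0 < z -> (Gamma z)%:E = Gammae z.
Proof.
move=> z0; rewrite /Gamma -/(Gammae z) fineK// fin_num_abs gee0_abs ?Gammae_ge0//.
exact: Gammae_lty.
Qed.

Lemma Gamma_gt0 z : 0 < z -> 0 < Gamma z.
Proof. by move=> z0; rewrite -lte_fin Gamma_fine// Gammae_gt0. Qed.

Lemma GammaS z : 0 < z -> Gamma (z + 1) = z * Gamma z.
Proof.
move=> z0; apply: EFin_inj; rewrite EFinM !Gamma_fine// ?addr_gt0//.
exact: GammaeS.
Qed.

(* Integrate t^s <= z^s (1 - s + s t / z) against t^(z - 1) e^(- t). *)
Lemma Gamma_add_le z s : 0 < z -> 0 <= s <= 1 -> Gamma (z + s) <= powR z s * Gamma z.
Proof.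
move=> z0 s01; have zs0 : 0 < z + s by case/andP: s01 => *; rewrite ltr_wpDr.
have zs : z = z ->  powR z s * Gamma z =
    (powR z s * (1 - s)) * Gamma z + (powR z s * (s / z)) * Gamma (z + 1).
  by rewrite GammaS// => _; field; rewrite gt_eqF.
have c1 : 0 <= powR z s * (1 - s).
  by case/andP: s01 => *; rewrite mulr_ge0 ?powR_ge0// subr_ge0.
have c2 : 0 <= powR z s * (s / z).
  by case/andP: s01 => *; rewrite mulr_ge0 ?powR_ge0// divr_ge0// ltW.
rewrite zs// -lee_fin EFinD (EFinM _ (Gamma z)) (EFinM _ (Gamma (z + 1))) !Gamma_fine ?(addr_gt0 z0 ltr01)//.
have mg x : measurable_fun [set t : R | 0 < t] (EFin \o gamma_density x).
  by apply/measurable_EFinP; exact: measurable_gamma_density.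
rewrite /Gammae -!ge0_integralZl//; try exact: measurable_pos; try exact: mg;
  try by move=> t _; rewrite lee_fin gamma_density_ge0.
rewrite -ge0_integralD//; last first.
- apply: emeasurable_funM; [exact: measurable_cst|exact: mg].
- by move=> t _; rewrite -EFinM lee_fin mulr_ge0// gamma_density_ge0.
- apply: emeasurable_funM; [exact: measurable_cst|exact: mg].
- by move=> t _; rewrite -EFinM lee_fin mulr_ge0// gamma_density_ge0.
- exact: measurable_pos.
apply: ge0_le_integral => //.
- exact: measurable_pos.
- by move=> *; rewrite lee_fin gamma_density_ge0.
- exact: mg.
- apply: emeasurable_funD; apply: emeasurable_funM => //; exact: mg.
move=> t /= t0; rewrite -!EFinM -EFinD lee_fin /gamma_density addrK.
rewrite (_ : z + s - 1 = z - 1 + s); last by ring.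
rewrite powRD; last by rewrite (gt_eqF t0) implybT.
have tz : powR t s <= powR z s * (1 - s + s * (t / z)).
  rewrite -{1}(divfK (lt0r_neq0 z0) t) mulrC powRM ?(ltW z0) ?(ltW (divr_gt0 t0 z0))//.
  by rewrite ler_wpM2l ?powR_ge0//; apply: powR_le_tangent => //; exact: divr_gt0.
have tt : powR t z = powR t (z - 1) * t.
  by rewrite mulrC mulr_powRB1// ltW.
apply: (@le_trans _ _ (powR t (z - 1) * (powR z s * (1 - s + s * (t / z))) * expR (- t))).
  by rewrite ler_wpM2r ?expR_ge0// ler_wpM2l ?powR_ge0.
by rewrite le_eqVlt; apply/orP; left; apply/eqP; rewrite tt; ring.
Qed.

End gamma.

(** * Sums of powers *)

Section power_sums.
Context {R : realType}.
Implicit Types (x y p s b : R).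

Lemma powR_ratio p x y : 0 < x -> 0 < y -> powR y p = powR x p * expR (p * ln (y / x)).
Proof.
move=> x0 y0; rewrite /powR !gt_eqF// -expRD ln_div ?posrE//.
by congr expR; ring.
Qed.

Lemma powRB1 p x : 0 < x -> powR x (p - 1) = powR x p / x.
Proof.
by move=> x0; rewrite powRB ?powRr1 ?ltW// (gt_eqF x0) implybT.
Qed.

Lemma ln_le_subr1 x : 0 < x -> ln x <= x - 1.
Proof.
by move=> x0; have := @le_ln1Dx R (x - 1); rewrite addrCA subrr addr0; apply; lra.
Qed.

(** The mean value bound for the convex t^(- s), with the derivative at the left end, drawn from e^q
    >= 1 + q and ln q <= q - 1. [powRN_sub_ge] uses the right end. *)
Lemma powRN_sub_le s x y : 0 <= s -> 0 < x -> x <= y ->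
  powR x (- s) - powR y (- s) <= s * powR x (- s - 1) * (y - x).
Proof.
move=> s0 x0 xy; have y0 := lt_le_trans x0 xy.
rewrite (powR_ratio (- s) x0 y0) powRB1//.
have h1 := expR_ge1Dx (- s * ln (y / x)).
have h2 := ln_le_subr1 (divr_gt0 y0 x0).
have h3 : s * ln (y / x) <= s * (y / x - 1) by rewrite ler_wpM2l.
have h4 : 1 - s * (y / x - 1) <= expR (- s * ln (y / x)) by lra.
have := ler_wpM2l (powR_ge0 x (- s)) h4.
rewrite (_ : s * (powR x (- s) / x) * (y - x) = powR x (- s) * (s * (y / x - 1))).
  lra.
by field; rewrite gt_eqF.
Qed.

Lemma powRN_sub_ge s x y : 0 <= s -> 0 < x -> x <= y ->
  s * powR y (- s - 1) * (y - x) <= powR x (- s) - powR y (- s).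
Proof.
move=> s0 x0 xy; have y0 := lt_le_trans x0 xy.
rewrite (powR_ratio (- s) y0 x0) powRB1//.
have h1 := expR_ge1Dx (- s * ln (x / y)).
have h2 := ln_le_subr1 (divr_gt0 x0 y0).
have h3 : s * ln (x / y) <= s * (x / y - 1) by rewrite ler_wpM2l.
have h4 : 1 - s * (x / y - 1) <= expR (- s * ln (x / y)) by lra.
have := ler_wpM2l (powR_ge0 y (- s)) h4.
rewrite (_ : s * (powR y (- s) / y) * (y - x) = powR y (- s) * (s * (1 - x / y))).
  lra.
by field; rewrite gt_eqF.
Qed.

Lemma le_powRN p b x : 0 <= p -> 0 < b -> b <= x -> powR x (- p) <= powR b (- p).
Proof.
move=> p0 b0 bx; have x0 := lt_le_trans b0 bx.
by rewrite !powRN lef_pV2 ?posrE ?powR_gt0// ge0_ler_powR ?nnegrE// ltW.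
Qed.

Lemma powRN_dist s b x y : 0 <= s -> 0 < b -> b <= x -> b <= y ->
  `|powR x (- s) - powR y (- s)| <= s * powR b (- s - 1) * `|x - y|.
Proof.
move=> s0 b0; wlog xy : x y / x <= y => [H bx by_|bx _].
  have [xy|/ltW yx] := leP x y; first exact: H.
  by rewrite distrC (distrC x); exact: H.
have x0 := lt_le_trans b0 bx.
have h0 : 0 <= powR x (- s) - powR y (- s) by rewrite subr_ge0 le_powRN.
rewrite ger0_norm// distrC ger0_norm ?subr_ge0//.
apply: le_trans (powRN_sub_le s0 x0 xy) _.
rewrite ler_wpM2r ?subr_ge0// ler_wpM2l// -opprD le_powRN// addr_ge0//.
Qed.

(** By [powRN_sub_ge] the term at k + 1 is at most (k^(- s) - (k + 1)^(- s)) / s, and these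
    differences telescope. *)
Lemma sum_powR_summable s n : 0 < s ->
  \sum_(1 <= k < n) powR k%:R (- s - 1) <= 1 + s^-1.
Proof.
move=> s0.
have [n0|n0] := posnP n; first by rewrite n0 big_geq// addr_ge0// invr_ge0 ltW.
(* With the last term moved to the left, this bounds the sum up to and including n, the form in
   which the induction closes. *)
suff : \sum_(1 <= k < n) powR k%:R (- s - 1) <= 1 + s^-1 * (1 - powR n%:R (- s)) - powR n%:R (- s - 1).
  move=> /le_trans; apply; have := powR_ge0 (n%:R : R) (- s - 1).
  have : 0 <= s^-1 * powR n%:R (- s) by rewrite mulr_ge0 ?powR_ge0// invr_ge0 ltW.
  lra.
case: n n0 => // n _; elim: n => [|n IH]; first by rewrite big_geq// !powR1; lra.
rewrite big_nat_recr//=; have := IH.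
have := @powRN_sub_ge s n.+1%:R n.+2%:R (ltW s0) (ltr0Sn _ _); rewrite ler_nat leqnSn.
move=> /(_ isT); rewrite -[n.+2%:R]natr1 (addrC n.+1%:R 1) addrK mulr1 (addrC 1).
rewrite -ler_pdivlMl// mulrBr; lra.
Qed.

(** An antiderivative of t^(b - 1), so that the logarithmic and the power form of [a_] are treated
    together. *)
Definition log_power b (n : nat) : R :=
  if b == 0 then ln n%:R else powR n%:R b / b.

(** The integral of the nonincreasing t^(b - 1) over [n, n + 1] lies between its end values; instead
    of integrating, the proof uses ln x <= x - 1 for b = 0 and [powR_le_tangent] for b > 0. *)
Lemma log_power_step b n : 0 <= b <= 1 -> (0 < n)%N ->
  powR n.+1%:R (b - 1) <= log_power b n.+1 - log_power b n <= powR n%:R (b - 1).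
Proof.
move=> /andP[b0 b1] n0.
have x0 : 0 < n%:R :> R by rewrite ltr0n.
have y0 : 0 < n.+1%:R :> R by rewrite ltr0n.
have yx : n.+1%:R = n%:R + 1 :> R by rewrite natr1.
rewrite /log_power; case: ifPn => [/eqP ->|bn].
  rewrite sub0r !powR_inv1 ?(ltW x0) ?(ltW y0)// -ln_div ?posrE//; apply/andP; split.
    have := ln_le_subr1 (divr_gt0 x0 y0); rewrite !ln_div ?posrE//.
    rewrite (_ : n%:R / n.+1%:R - 1 = - n.+1%:R^-1); first by move: (n.+1%:R^-1) => q; lra.
    by rewrite yx; field; rewrite -yx gt_eqF.
  apply: le_trans (ln_le_subr1 (divr_gt0 y0 x0)) _.
  rewrite (_ : n.+1%:R / n%:R - 1 = n%:R^-1)//.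
  by rewrite yx; field; rewrite gt_eqF.
have bp : 0 < b by rewrite lt_neqAle eq_sym bn.
have b01 : 0 <= b <= 1 by rewrite b0 b1.
have hx := powR_le_tangent (divr_gt0 y0 x0) b01.
have hy := powR_le_tangent (divr_gt0 x0 y0) b01.
rewrite -mulrBl ler_pdivlMr// ler_pdivrMr// !powRB1//.
have ex : powR n.+1%:R b = powR n%:R b * powR (n.+1%:R / n%:R) b :> R.
  by rewrite -powRM ?(ltW x0) ?(ltW y0) ?(ltW (divr_gt0 x0 y0)) ?(ltW (divr_gt0 y0 x0))// mulrCA divff ?mulr1 ?gt_eqF.
have ey : powR n%:R b = powR n.+1%:R b * powR (n%:R / n.+1%:R) b :> R.
  by rewrite -powRM ?(ltW x0) ?(ltW y0) ?(ltW (divr_gt0 x0 y0)) ?(ltW (divr_gt0 y0 x0))// mulrCA divff ?mulr1 ?gt_eqF.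
apply/andP; split.
  have := ler_wpM2l (powR_ge0 (n.+1%:R : R) b) hy; rewrite -ey.
  rewrite (_ : powR n.+1%:R b * (1 - b + b * (n%:R / n.+1%:R)) =
    powR n.+1%:R b - powR n.+1%:R b / n.+1%:R * b).
    by rewrite !lerBrDr addrC.
  by rewrite yx; field; rewrite -yx gt_eqF.
have := ler_wpM2l (powR_ge0 (n%:R : R) b) hx; rewrite -ex.
rewrite (_ : powR n%:R b * (1 - b + b * (n.+1%:R / n%:R)) =
  powR n%:R b + powR n%:R b / n%:R * b).
  by rewrite lerBlDl.
by rewrite yx; field; rewrite gt_eqF.
Qed.

Lemma sum_powR_log_power b n : 0 <= b <= 1 -> (0 < n)%N ->
  0 <= \sum_(1 <= k < n) powR k%:R (b - 1) - (log_power b n - log_power b 1) <= 1.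
Proof.
move=> b01 n0; suff :
    0 <= \sum_(1 <= k < n) powR k%:R (b - 1) - (log_power b n - log_power b 1) <=
    1 - powR n%:R (b - 1).
  by have := powR_ge0 (n%:R : R) (b - 1); lra.
case: n n0 => // n _; elim: n => [|n IH]; first by rewrite big_geq// powR1; lra.
rewrite big_nat_recr//=; have := log_power_step b01 (ltn0Sn n); move: IH; lra.
Qed.

End power_sums.

(** * Growth of the compensator along a path *)

Section growth.
Context {R : realType}.
Variables (alpha beta c u r : R).
Hypotheses (alpha_gt0 : 0 < alpha) (beta_ge0 : 0 <= beta) (beta_lt1 : beta < 1).
Hypotheses (cbeta : 0 < c + beta) (u_gt0 : 0 < u) (ur : u <= r).
Variable K : R.
Hypothesis KE : K = alpha * Gamma (c + 1) / Gamma (c + beta).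
Implicit Types (S : nat -> R) (k n : nat).

Let s := 1 - beta.
Let s_gt0 : 0 < s. Proof. by rewrite subr_gt0. Qed.
Let s_le1 : s <= 1. Proof. by rewrite lerBlDr lerDl. Qed.
Let b01 : 0 <= beta <= 1. Proof. by rewrite beta_ge0 ltW. Qed.
Let r_gt0 : 0 < r. Proof. exact: lt_le_trans ur. Qed.
Let Ns : - s = beta - 1. Proof. by rewrite opprB. Qed.

Let a (n : nat) : R := a_ beta n.
Let hb : R := if beta == 0 then 1 else beta.
Let hb_gt0 : 0 < hb.
Proof. by rewrite /hb; case: ifPn => // b0; rewrite lt_neqAle eq_sym b0. Qed.

Let a_log_power n : a n = hb * log_power beta n.
Proof.
rewrite /a /a_ /hb /log_power; case: ifPn => b0; first by rewrite mul1r.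
by rewrite mulrC divfK.
Qed.

Let hb_le1 : hb <= 1.
Proof. by rewrite /hb; case: ifP => // _; exact: ltW. Qed.

Lemma a_ge0 n : 0 <= a_ beta n.
Proof.
rewrite /a_; case: ifP => _; last exact: powR_ge0.
by case: n => [|n]; [rewrite ln0|rewrite ln_ge0// ler1n].
Qed.

Lemma a_step n : a_ beta n <= a_ beta n.+1 <= a_ beta n + 1.
Proof.
have [->|n0] := posnP n.
  rewrite /a_; case: ifPn => b0; first by rewrite ln0// ln1 lexx add0r ler01.
  by rewrite powR1 powR0// add0r ler01 lexx.
rewrite -!/(a _) !a_log_power; have := log_power_step b01 n0.
move=> /andP[h1 h2].
have p1 : powR n%:R (beta - 1) <= 1 :> R.
  have := @le_powRN R s 1 n%:R (ltW s_gt0) ltr01; rewrite powR1 /= Ns; apply.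
  by rewrite ler1n.
have p0 := powR_ge0 (n.+1%:R : R) (beta - 1).
have := hb_gt0; have := hb_le1 => q1 q2.
have h3 : 0 <= hb * (log_power beta n.+1 - log_power beta n).
  by rewrite mulr_ge0 ?(ltW q2)//; lra.
have h4 : hb * (log_power beta n.+1 - log_power beta n) <= 1.
  by apply: mulr_ile1; lra.
lra.
Qed.

Lemma a_nd : nondecreasing_seq (a_ beta).
Proof. by apply/nondecreasing_seqP => n; case/andP: (a_step n). Qed.

Lemma a_gt0 n : (2 <= n)%N -> 0 < a_ beta n.
Proof.
move=> n2; rewrite /a_; case: ifP => _; first by rewrite ln_gt0// ltr1n.
by rewrite powR_gt0// ltr0n ltnW.
Qed.

Lemma a_oo : a_ beta @ \oo --> +oo.
Proof.
apply/cvgryPge => A; rewrite /a_; have [b0|b0] := eqVneq beta 0.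
  near=> n; rewrite -[leLHS]expRK ler_ln ?posrE ?expR_gt0//.
    by near: n; exact: nbhs_infty_ger.
  by rewrite ltr0n; near: n; exact: nbhs_infty_gt.
have bp : 0 < beta by rewrite lt_neqAle eq_sym b0.
near=> n; have n0 : 0 < n%:R :> R by rewrite ltr0n; near: n; exact: nbhs_infty_gt.
apply: (@le_trans _ _ (powR (powR (`|A| + 1) beta^-1) beta)).
  rewrite -powRrM mulVf// powRr1 ?addr_ge0//.
  by rewrite (le_trans (ler_norm _))// lerDl.
rewrite ge0_ler_powR ?nnegrE ?powR_ge0 ?(ltW n0)//.
by near: n; exact: nbhs_infty_ger.
Unshelve. all: by end_near.
Qed.

Let c1_gt0 : 0 < c + 1. Proof. by move: cbeta beta_lt1; lra. Qed.
Let K_gt0 : 0 < K.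
Proof. by rewrite KE divr_gt0 ?mulr_gt0 ?Gamma_gt0. Qed.

(** [Lambda] as a function of a deterministic path S of partial sums, because the estimates are
    pathwise and uniform over the paths in [path_ge]. *)
Definition hazard_rate S n : R := if n == 0%N then alpha else
  alpha * (Gamma (c + 1) * Gamma (c + beta + S n)) /
    (Gamma (c + beta) * Gamma (c + 1 + S n)).

Let z S n := c + beta + S n.

Section one_path.
Variable S : nat -> R.
Hypothesis S_ge : forall k, (1 <= k)%N -> u * k%:R <= S k.

Let uk_gt0 k : (1 <= k)%N -> 0 < u * k%:R :> R.
Proof. by move=> k1; rewrite mulr_gt0// ltr0n. Qed.

Let z_ge k : (1 <= k)%N -> u * k%:R <= z S k.
Proof. by move=> k1; apply: le_trans (S_ge k1) _; rewrite lerDr ltW. Qed.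

Let z_gt0 k : (1 <= k)%N -> 0 < z S k.
Proof. by move=> k1; exact: lt_le_trans (uk_gt0 k1) (z_ge k1). Qed.

Let hazard_rateE k : (1 <= k)%N ->
  hazard_rate S k = K * (Gamma (z S k) / Gamma (z S k + s)).
Proof.
move=> k1; rewrite /hazard_rate gt_eqF// (_ : c + 1 + S k = z S k + s).
  have g1 := Gamma_gt0 cbeta.
  have g2 : 0 < Gamma (z S k + s) by rewrite Gamma_gt0// addr_gt0// z_gt0.
  rewrite KE -/(z S k); move: (Gamma (c + beta)) (Gamma (z S k + s)) g1 g2 => G1 G2 g1 g2.
  by field; rewrite !gt_eqF.
by rewrite /z /s; ring.
Qed.

(** Both bounds are [Gamma_add_le]: with exponent s at z for the lower one, and with exponent 1 - s
    at z + s, together with Gamma(z + 1) = z Gamma(z), for the upper one. *)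
Let Gamma_ratio k : (1 <= k)%N ->
  powR (z S k) (- s) <= Gamma (z S k) / Gamma (z S k + s) <=
  powR (z S k) (- s) + powR (z S k) (- s - 1).
Proof.
move=> k1; have z0 := z_gt0 k1; have zs0 : 0 < z S k + s by rewrite addr_gt0.
have G0 := Gamma_gt0 z0; have Gs0 := Gamma_gt0 zs0.
apply/andP; split.
  rewrite ler_pdivlMr// powRN ler_pdivrMl ?powR_gt0//.
  by apply: Gamma_add_le; rewrite // (ltW s_gt0).
have h : z S k * Gamma (z S k) <= powR (z S k + s) (1 - s) * Gamma (z S k + s).
  rewrite -GammaS// (_ : z S k + 1 = z S k + s + (1 - s)); last by ring.
  by apply: Gamma_add_le => //; rewrite subr_ge0 s_le1 lerBlDr lerDl ltW.
rewrite ler_pdivrMr//.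
apply: (@le_trans _ _ (powR (z S k + s) (1 - s) / z S k * Gamma (z S k + s))).
  by rewrite mulrAC ler_pdivlMr// mulrC.
rewrite ler_pM2r// ler_pdivrMr//.
have -> : powR (z S k + s) (1 - s) = powR (z S k) (1 - s) * powR (1 + s / z S k) (1 - s).
  rewrite -powRM ?(ltW z0)//; last by rewrite addr_ge0// divr_ge0// ltW.
  by congr powR; field; rewrite gt_eqF.
have t1 : powR (1 + s / z S k) (1 - s) <= 1 + s / z S k.
  by apply: ler1_powR; [rewrite lerDl divr_ge0// ltW|rewrite lerBlDr lerDl ltW].
apply: le_trans (ler_wpM2l (powR_ge0 _ _) t1) _.
rewrite powRB1// (_ : 1 - s = - s + 1); last by ring.
rewrite powRD; last by rewrite (gt_eqF z0) implybT.
rewrite powRr1 ?(ltW z0)//.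
rewrite (_ : powR (z S k) (- s) * z S k * (1 + s / z S k) =
  powR (z S k) (- s) * z S k + s * powR (z S k) (- s)); last first.
  by field; rewrite gt_eqF.
rewrite [leRHS]mulrDl divfK; last by rewrite gt_eqF.
by rewrite lerD2l ler_piMl ?powR_ge0.
Qed.

Lemma hazard_rate_le k : (1 <= k)%N ->
  hazard_rate S k <= K * powR u (- s) * (1 + u^-1) * powR k%:R (beta - 1).
Proof.
move=> k1; rewrite hazard_rateE// -!mulrA ler_pM2l//.
have /andP[_ /le_trans] := Gamma_ratio k1; apply.
have k0 : 0 < k%:R :> R by rewrite ltr0n.
have h1 : powR (z S k) (- s) <= powR (u * k%:R) (- s).
  by apply: le_powRN; [exact: ltW|exact: uk_gt0|exact: z_ge].
have h2 : (z S k)^-1 <= u^-1.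
  rewrite lef_pV2 ?posrE ?z_gt0//; apply: le_trans (z_ge k1).
  by rewrite ler_peMr ?(ltW u_gt0)// ler1n.
rewrite (powRB1 (- s) (z_gt0 k1)).
have -> : powR (z S k) (- s) + powR (z S k) (- s) / z S k =
  powR (z S k) (- s) * (1 + (z S k)^-1) by rewrite mulrDr mulr1.
rewrite (mulrC (1 + _)) mulrA -Ns -powRM ?(ltW u_gt0) ?(ltW k0)//.
apply: ler_pM; rewrite ?powR_ge0 ?lerD2l//.
by rewrite addr_ge0// invr_ge0 ltW// z_gt0.
Qed.

(** Two errors add up: the Gamma ratio against z^(- s), and z against r k. The first one and the
    constant c + beta in z contribute multiples of the summable k^(- s - 1); the rest is the
    deviation of S k / k from r. *)
Lemma hazard_rate_dist k : (1 <= k)%N ->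
  `|hazard_rate S k - K * powR r (- s) * powR k%:R (beta - 1)| <=
  K * powR u (- s - 1) * ((1 + (c + beta)) * powR k%:R (- s - 1) +
    powR k%:R (beta - 1) * `|S k / k%:R - r|).
Proof.
move=> k1; have k0 : 0 < k%:R :> R by rewrite ltr0n.
rewrite hazard_rateE// -!mulrA -mulrBr normrM (gtr0_norm K_gt0) ler_pM2l//.
have z0 := z_gt0 k1.
have -> : powR r (- s) * powR k%:R (beta - 1) = powR (r * k%:R) (- s).
  by rewrite -Ns powRM ?(ltW r_gt0) ?(ltW k0).
rewrite -(subrK (powR (z S k) (- s)) (Gamma _ / _)) -addrA.
apply: le_trans (ler_normD _ _) _.
have h1 : `|Gamma (z S k) / Gamma (z S k + s) - powR (z S k) (- s)| <=
    powR (u * k%:R) (- s - 1).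
  have /andP[g1 g2] := Gamma_ratio k1.
  rewrite ger0_norm ?subr_ge0// lerBlDl (le_trans g2)// lerD2l.
  by rewrite -opprD le_powRN ?z_ge ?uk_gt0// addr_ge0// ltW.
have h2 : `|powR (z S k) (- s) - powR (r * k%:R) (- s)| <=
    s * powR (u * k%:R) (- s - 1) * `|z S k - r * k%:R|.
  apply: powRN_dist; [exact: ltW|exact: uk_gt0|exact: z_ge|].
  by rewrite ler_wpM2r// ltW.
have h3 : `|z S k - r * k%:R| <= (c + beta) + k%:R * `|S k / k%:R - r|.
  rewrite /z -addrA; apply: le_trans (ler_normD _ _) _.
  rewrite (gtr0_norm cbeta) lerD2l.
  have -> : S k - r * k%:R = k%:R * (S k / k%:R - r) by field; rewrite gt_eqF.
  by rewrite normrM gtr0_norm.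
have h4 : s * powR (u * k%:R) (- s - 1) * `|z S k - r * k%:R| <=
    powR (u * k%:R) (- s - 1) * ((c + beta) + k%:R * `|S k / k%:R - r|).
  apply: ler_pM => //; first by rewrite mulr_ge0 ?powR_ge0 ?(ltW s_gt0).
  by rewrite ler_piMl ?powR_ge0.
apply: le_trans (lerD h1 (le_trans h2 h4)) _.
have -> : powR (u * k%:R) (- s - 1) = powR u (- s - 1) * powR k%:R (- s - 1).
  by rewrite powRM ?(ltW u_gt0) ?(ltW k0).
have -> : powR k%:R (beta - 1) = powR k%:R (- s - 1) * k%:R.
  by rewrite (powRB1 (- s) k0) divfK ?gt_eqF// Ns.
rewrite le_eqVlt; apply/orP; left; apply/eqP; ring.
Qed.

Let lamE : lambda_ alpha c r beta = K * powR r (- s) / hb.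
Proof.
rewrite /lambda_ /hb KE; case: ifPn => b0.
  move/eqP in b0; rewrite /s b0 subr0 addr0 powRN powRr1 ?(ltW r_gt0)//.
  have c0 : 0 < c by move: cbeta; rewrite b0 addr0.
  by rewrite GammaS// invr1 mulr1; field; rewrite !gt_eqF ?Gamma_gt0.
have g0 := Gamma_gt0 cbeta; have p0 : 0 < powR r (1 - beta) by rewrite powR_gt0.
by rewrite powRN; field; rewrite b0 !gt_eqF.
Qed.

(** In the constant, alpha is the rate at 0, the next term is the cost of replacing the sum of
    k^(beta - 1) by [log_power], and 1 + 1 / s is the bound of [sum_powR_summable]. *)
Lemma sum_hazard_rate_dist n : (1 <= n)%N ->
  `|\sum_(i < n) hazard_rate S i - lambda_ alpha c r beta * a_ beta n| <=
  (alpha + K * powR r (- s) * (1 + `|log_power beta 1|) +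
     K * powR u (- s - 1) * (1 + (c + beta)) * (1 + s^-1)) +
  K * powR u (- s - 1) *
    \sum_(1 <= k < n) powR k%:R (beta - 1) * `|S k / k%:R - r|.
Proof.
move=> n1.
have -> : lambda_ alpha c r beta * a_ beta n = K * powR r (- s) * log_power beta n.
  by rewrite -/(a n) a_log_power lamE mulrA divfK// gt_eqF.
rewrite -(big_mkord xpredT (hazard_rate S)) big_ltn// {1}/hazard_rate eqxx.
set D := \sum_(1 <= k < n) powR k%:R (beta - 1).
set E := \sum_(1 <= k < n) powR k%:R (- s - 1).
set T := \sum_(1 <= k < n) _ * `|_|.
have h1 : `|\sum_(1 <= k < n) hazard_rate S k - K * powR r (- s) * D| <=
    K * powR u (- s - 1) * ((1 + (c + beta)) * E + T).
  rewrite !mulr_sumr -big_split/= mulr_sumr -sumrB.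
  apply: le_trans (ler_norm_sum _ _ _) _.
  by apply: ler_sum_nat => k /andP[k1 _]; exact: hazard_rate_dist.
have h2 := sum_powR_log_power b01 n1; rewrite -/D in h2.
have h3 : E <= 1 + s^-1 := sum_powR_summable n s_gt0.
have Kr : 0 <= K * powR r (- s) by rewrite mulr_ge0 ?powR_ge0// ltW.
have h4 : `|K * powR r (- s) * D - K * powR r (- s) * log_power beta n| <=
    K * powR r (- s) * (1 + `|log_power beta 1|).
  rewrite -mulrBr normrM (ger0_norm Kr) ler_wpM2l//.
  rewrite (_ : D - _ = (D - (log_power beta n - log_power beta 1)) - log_power beta 1).
    by apply: le_trans (ler_normB _ _) _; rewrite lerD2r ger0_norm; case/andP: h2.
  by ring.
have Ku : 0 <= K * powR u (- s - 1) * (1 + (c + beta)).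
  apply: mulr_ge0; first by rewrite mulr_ge0 ?powR_ge0// ltW.
  by rewrite addr_ge0// ltW.
have h5 := ler_wpM2l Ku h3.
set L := \sum_(1 <= k < n) hazard_rate S k in h1 *.
have -> : alpha + L - K * powR r (- s) * log_power beta n = alpha +
  (L - K * powR r (- s) * D) + (K * powR r (- s) * D - K * powR r (- s) * log_power beta n).
  by ring.
apply: le_trans (ler_normD _ _) _.
have := ler_normD alpha (L - K * powR r (- s) * D).
rewrite (gtr0_norm alpha_gt0).
move: h1; rewrite mulrDr mulrA; lra.
Qed.

End one_path.

Definition path_ge S := forall k, (1 <= k)%N -> u * k%:R <= S k.

Lemma hazard_rate_bounded :
  exists C, forall S, path_ge S -> forall n, hazard_rate S n <= C.
Proof.
have Ku : 0 <= K * powR u (- s) * (1 + u^-1).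
  by rewrite mulr_ge0 ?addr_ge0 ?invr_ge0 ?(ltW u_gt0)// mulr_ge0 ?powR_ge0// ltW.
exists (alpha + K * powR u (- s) * (1 + u^-1)) => S S_ge n.
have [->|n0] := posnP n; first by rewrite /hazard_rate eqxx lerDl.
apply: le_trans (hazard_rate_le S_ge n0) _; rewrite ler_wpDl ?(ltW alpha_gt0)//.
rewrite ler_piMr// -Ns; have := @le_powRN R s 1 n%:R (ltW s_gt0) ltr01.
by rewrite powR1 /=; apply; rewrite ler1n.
Qed.

Lemma sum_hazard_rate_le : exists2 C, 0 < C & forall S, path_ge S ->
  forall n, (2 <= n)%N -> \sum_(i < n) hazard_rate S i <= C * a_ beta n.
Proof.
have Ku : 0 <= K * powR u (- s) * (1 + u^-1).
  by rewrite mulr_ge0 ?addr_ge0 ?invr_ge0 ?(ltW u_gt0)// mulr_ge0 ?powR_ge0// ltW.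
set C0 := K * powR u (- s) * (1 + u^-1) in Ku *.
have a2 : 0 < a_ beta 2 by exact: a_gt0.
(* For n >= 2 the constant alpha + C0 is absorbed by means of a_n >= a_2 > 0; at n = 1 this fails
   for beta = 0, since ln 1 = 0. *)
exists ((alpha + C0) / a_ beta 2 + C0 / hb).
  by rewrite ltr_pwDl ?divr_gt0 ?divr_ge0 ?(ltW hb_gt0)// ltr_pwDl.
move=> S S_ge n n2; have n1 : (1 <= n)%N by exact: ltnW.
rewrite -(big_mkord xpredT (hazard_rate S)) big_ltn// {1}/hazard_rate eqxx.
have h1 : \sum_(1 <= k < n) hazard_rate S k <= C0 * \sum_(1 <= k < n) powR k%:R (beta - 1).
  rewrite mulr_sumr; apply: ler_sum_nat => k /andP[k1 _]; exact: hazard_rate_le.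
have /andP[_ h2] := sum_powR_log_power b01 n1.
have lp1 : 0 <= log_power beta 1.
  rewrite /log_power; case: ifP => _; first by rewrite ln_ge0.
  by rewrite divr_ge0// powR_ge0.
have h3 : \sum_(1 <= k < n) powR k%:R (beta - 1) <= 1 + a n / hb.
  by rewrite a_log_power mulrAC divff ?mul1r ?gt_eqF//; lra.
have h4 := ler_wpM2l Ku h3.
have h5 : alpha + C0 <= (alpha + C0) / a_ beta 2 * a n.
  rewrite mulrAC ler_pdivlMr// ler_wpM2l ?addr_ge0 ?(ltW alpha_gt0)//.
  exact: a_nd.
rewrite mulrDl -/(a n); move: h4; rewrite mulrDr mulr1 mulrA (mulrAC C0); lra.
Qed.

Lemma sum_hazard_rate_error : exists C1 C2, [/\ 0 <= C1, 0 <= C2 & forall S, path_ge S ->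
  forall n, (1 <= n)%N ->
  `|\sum_(i < n) hazard_rate S i - lambda_ alpha c r beta * a_ beta n| <=
  C1 + C2 * \sum_(1 <= k < n) powR k%:R (beta - 1) * `|S k / k%:R - r|].
Proof.
exists (alpha + K * powR r (- s) * (1 + `|log_power beta 1|) +
     K * powR u (- s - 1) * (1 + (c + beta)) * (1 + s^-1)), (K * powR u (- s - 1)).
have K0 := ltW K_gt0; have s0 : 0 <= s^-1 by rewrite invr_ge0 ltW.
split; last by move=> S S_ge n n1; exact: sum_hazard_rate_dist.
  have := ltW cbeta; have := ltW alpha_gt0 => h1 h2.
  have p1 := powR_ge0 r (- s); have p2 := powR_ge0 u (- s - 1).
  have q1 : 0 <= K * powR r (- s) by exact: mulr_ge0.
  have q2 : 0 <= K * powR u (- s - 1) by exact: mulr_ge0.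
  have q3 : 0 <= (1 + `|log_power beta 1|) :> R by exact: addr_ge0.
  have q4 : 0 <= (1 + (c + beta)) :> R by exact: addr_ge0.
  have q5 : 0 <= 1 + s^-1 by exact: addr_ge0.
  apply: addr_ge0; first by apply: addr_ge0 => //; exact: mulr_ge0.
  by apply: mulr_ge0 => //; exact: mulr_ge0.
by rewrite mulr_ge0// powR_ge0.
Qed.

(** Cesaro's argument: the weights k^(beta - 1) have partial sums of the order of [a_], which
    diverges, so any initial block is negligible. *)
Lemma weighted_cesaro (x : nat -> R) : x @ \oo --> 0 ->
  (fun n => (\sum_(1 <= k < n) powR k%:R (beta - 1) * `|x k|) / a_ beta n) @ \oo --> 0.
Proof.
move=> x0; apply/cvgr0Pnorm_le => e e0.
have hb0 := hb_gt0.
(* Chosen so that d times [log_power beta n] is e / 2 times [a_ beta n]. *)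
pose d := e * hb / 2.
have d0 : 0 < d by rewrite divr_gt0// mulr_gt0.
move/cvgr0Pnorm_le : x0 => /(_ _ d0) [N _ NE].
set A := \sum_(1 <= k < N.+1) powR k%:R (beta - 1) * `|x k|.
have lp1 : 0 <= log_power beta 1.
  rewrite /log_power; case: ifP => _; first by rewrite ln_ge0.
  by rewrite divr_ge0// powR_ge0.
have key n : (N.+1 <= n)%N ->
    \sum_(1 <= k < n) powR k%:R (beta - 1) * `|x k| <= A + d + e / 2 * a_ beta n.
  move=> Nn; rewrite (@big_cat_nat _ _ _ N.+1)//= -/A -addrA lerD2l.
  apply: (@le_trans _ _ (d * \sum_(1 <= k < n) powR k%:R (beta - 1))).
    apply: (@le_trans _ _ (d * \sum_(N.+1 <= k < n) powR k%:R (beta - 1))).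
      rewrite mulr_sumr; apply: ler_sum_nat => k /andP[k1 _].
      by rewrite mulrC ler_wpM2r ?powR_ge0//; apply: NE; exact: ltnW.
    rewrite ler_pM2l// [leRHS](@big_cat_nat _ _ _ N.+1)//= lerDr.
    by apply: sumr_ge0 => k _; exact: powR_ge0.
  have /andP[_ h2] := sum_powR_log_power b01 (leq_trans (ltn0Sn N) Nn).
  have h3 : \sum_(1 <= k < n) powR k%:R (beta - 1) <= 1 + log_power beta n by lra.
  apply: le_trans (ler_wpM2l (ltW d0) h3) _.
  rewrite mulrDr mulr1 lerD2l -/(a n) a_log_power /d.
  by rewrite le_eqVlt; apply/orP; left; apply/eqP; field.
have e2 : 0 < e / 2 by rewrite divr_gt0.
have /cvgryPge /(_ ((A + d) / (e / 2))) aoo := a_oo.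
near=> n.
have n2 : (2 <= n)%N by near: n; exact: nbhs_infty_ge.
have an := a_gt0 n2.
have S0 : 0 <= \sum_(1 <= k < n) powR k%:R (beta - 1) * `|x k|.
  by apply: sumr_ge0 => k _; rewrite mulr_ge0 ?powR_ge0.
rewrite ger0_norm ?divr_ge0 ?(ltW an)// ler_pdivrMr//.
apply: le_trans (key n _) _; first by near: n; exact: nbhs_infty_ge.
have : (A + d) / (e / 2) <= a_ beta n by near: n.
rewrite ler_pdivrMr// (mulrC (a_ _ _)); lra.
Unshelve. all: by end_near.
Qed.

Lemma sum_hazard_rate_cvg S : path_ge S -> (fun k => S k / k%:R) @ \oo --> r ->
  (fun n => (\sum_(i < n) hazard_rate S i) / a_ beta n) @ \oo --> lambda_ alpha c r beta.
Proof.
move=> S_ge Sr; have [C1 [C2 [C10 C20 CE]]] := sum_hazard_rate_error.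
have x0 : (fun k => S k / k%:R - r) @ \oo --> 0.
  by rewrite -(subrr r); apply: cvgB => //; exact: cvg_cst.
have h := weighted_cesaro x0.
have ainv : (fun n => (a_ beta n)^-1) @ \oo --> 0.
  apply/gtr0_cvgV0; last exact: a_oo.
  by near=> n; apply: a_gt0; near: n; exact: nbhs_infty_ge.
have bnd : (fun n => C1 * (a_ beta n)^-1 + C2 *
    ((\sum_(1 <= k < n) powR k%:R (beta - 1) * `|S k / k%:R - r|) / a_ beta n)) @ \oo --> C1 * 0 + C2 * 0.
  by apply: cvgD; apply: cvgMr.
rewrite !mulr0 addr0 in bnd.
apply/cvgrPdist_le => e e0.
move/cvgr0Pnorm_le : bnd => /(_ _ e0) bnd.
near=> n.
have n2 : (2 <= n)%N by near: n; exact: nbhs_infty_ge.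
have an := a_gt0 n2.
rewrite distrC.
have -> : (\sum_(i < n) hazard_rate S i) / a_ beta n - lambda_ alpha c r beta =
    (\sum_(i < n) hazard_rate S i - lambda_ alpha c r beta * a_ beta n) / a_ beta n.
  by rewrite mulrBl mulfK// gt_eqF.
rewrite normrM [X in _ * X]gtr0_norm ?invr_gt0//.
apply: le_trans (_ : _ <= `|C1 * (a_ beta n)^-1 + C2 *
    ((\sum_(1 <= k < n) powR k%:R (beta - 1) * `|S k / k%:R - r|) / a_ beta n)|) _; last by near: n.
apply: le_trans (ler_norm _); rewrite mulrA -mulrDl ler_pM2r ?invr_gt0//.
exact: CE (ltnW n2).
Unshelve. all: by end_near.
Qed.

End growth.

(** * The stable limit *)

Section stable_clt.
Context {R : realType} {d} {T : measurableType d} (P : probability T R).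
Variable G : nat -> set (set T).
Hypothesis Gsub : forall n, <<s G n >> `<=` measurable.
Hypothesis Gmono : forall n, <<s G n >> `<=` <<s G n.+1 >>.
Local Notation TG n := (g_sigma_algebraType (G n)).
Variables (N lam : nat -> T -> R).
Hypothesis mN : forall n, measurable_fun [set: TG n.+1] (N n).
Hypothesis mlam : forall n, measurable_fun [set: TG n] (lam n).
Hypothesis lam_ge0 : forall n w, 0 <= lam n w.
Hypothesis N_mgf : forall n t H, @measurable _ (TG n) H ->
  (\int[P]_(w in H) (expR (t * N n w))%:E =
   \int[P]_(w in H) (expR (lam n w * (expR t - 1)))%:E)%E.
Local Notation total := (total N).
Local Notation compensator := (compensator lam).
Local Notation emart := (emart N lam).

Variables (a : nat -> R) (K v : R).
Hypothesis N_ge0 : forall n w, 0 <= N n w.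
Hypothesis a_gt0 : forall n, (2 <= n)%N -> 0 < a n.
Hypothesis a_nd : forall i j, (i <= j)%N -> a i <= a j.
Hypothesis a_oo : a @ \oo --> +oo.
Hypothesis v_ge0 : 0 <= v.
Hypothesis comp_le : forall n w, (2 <= n)%N -> compensator n w <= K * a n.
Hypothesis comp_cvg : {ae P, forall w, compensator n w / a n @[n --> \oo] --> v}.

Let b n := Num.sqrt (a n).

Let b_gt0 n : (2 <= n)%N -> 0 < b n. Proof. by move=> n2; rewrite sqrtr_gt0 a_gt0. Qed.

Let b_sqr n : (2 <= n)%N -> b n ^+ 2 = a n.
Proof. by move=> n2; rewrite sqr_sqrtr// ltW// a_gt0. Qed.

Let b_ge n : (2 <= n)%N -> b 2 <= b n.
Proof. by move=> n2; rewrite ler_wsqrtr// a_nd. Qed.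

Let b_oo : b @ \oo --> +oo.
Proof.
apply/cvgryPge => A; move/cvgryPge : a_oo => /(_ (A ^+ 2)) h; near=> n.
apply: le_trans (ler_norm A) _; rewrite -sqrtr_sqr ler_wsqrtr//.
by near: n.
Unshelve. all: by end_near.
Qed.

Let mtot n : measurable_fun [set: T] (total n) := mT_total Gsub Gmono mN n.
Let mcmp n : measurable_fun [set: T] (compensator n) := mT_comp Gsub Gmono mlam n.
Let memart t n : measurable_fun [set: T] (emart t n) := mT_emart Gsub Gmono mN mlam t n.

Let cge0 n w : 0 <= compensator n w := comp_ge0 lam_ge0 n w.
Let tge0 n w : 0 <= total n w. Proof. by apply: sumr_ge0 => i _. Qed.

Let ege0 t n w : 0 <= emart t n w := ltW (emart_gt0 N lam t n w).

Lemma integrable_emart t n : P.-integrable setT (EFin \o emart t n).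
Proof.
apply/integrableP; split; first by apply/measurable_EFinP; exact: memart.
under eq_integral do rewrite /= ger0_norm ?ege0//.
by rewrite (emart_integral1 Gsub Gmono mN mlam N_mgf) ltry.
Qed.

Let Rint_emart1 t n : \int[P]_w emart t n w = 1.
Proof. by rewrite /Rintegral (emart_integral1 Gsub Gmono mN mlam N_mgf). Qed.

Let integrable_dom (f g : T -> R) : measurable_fun setT f ->
  (forall w, `|f w| <= g w) -> P.-integrable setT (EFin \o g) ->
  P.-integrable setT (EFin \o f).
Proof.
move=> mf fg ig; apply: le_integrable ig => //; first exact/measurable_EFinP.
by move=> w _ /=; rewrite lee_fin (le_trans (fg w))// ler_norm.
Qed.

Let integrableZ (c : R) (f : T -> R) : P.-integrable setT (EFin \o f) ->
  P.-integrable setT (EFin \o (fun w => c * f w)).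
Proof.
move=> fi; apply: (@eq_integrable _ _ _ P _ _ (fun w => c%:E * (f w)%:E)%E) => //.
exact: integrableZl.
Qed.

Let integrableA (f g : T -> R) : P.-integrable setT (EFin \o f) ->
  P.-integrable setT (EFin \o g) -> P.-integrable setT (EFin \o (fun w => f w + g w)).
Proof.
move=> fi gi; apply: (@eq_integrable _ _ _ P _ _ (fun w => (f w)%:E + (g w)%:E)%E) => //.
exact: integrableD.
Qed.

Let integrableC (c : R) : P.-integrable setT (EFin \o (fun=> c : R)).
Proof. by apply: (@integrable_bounded _ _ _ P setT _ `|c|). Qed.

Let PT1 : fine (P setT) = 1.
Proof. by have -> : P setT = 1%E by exact: probability_setT. Qed.

Let phi (t : R) : R := expR t - 1 - t.

Let phi_ge0 t : 0 <= phi t.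
Proof. by rewrite /phi; have := expR_ge1Dx t; lra. Qed.

Let phi_le t : phi t <= t ^+ 2 * expR `|t|.
Proof.
apply: le_trans (ler_norm _) _.
have := expR_taylor t 2; rewrite !big_ord_recr big_ord0 /= add0r expr0 expr1.
rewrite fact0 (_ : 1`!%:R = 1 :> R)// !divr1 opprD addrA => /le_trans; apply.
rewrite real_normK ?num_real// ler_wpM2r ?expR_ge0// ler_piMr ?sqr_ge0//.
by rewrite invf_le1// ler1n.
Qed.

Let phi_dist t : `|phi t - t ^+ 2 / 2| <= `|t| ^+ 3 * expR `|t|.
Proof.
have := expR_taylor t 3; rewrite !big_ord_recr big_ord0 /= add0r expr0 expr1.
rewrite fact0 (_ : 1`!%:R = 1 :> R)// !divr1 (_ : 2`!%:R = 2 :> R)// /phi.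
rewrite (_ : expR t - (1 + t + t ^+ 2 / 2) = expR t - 1 - t - t ^+ 2 / 2); last by ring.
move=> /le_trans; apply.
rewrite ler_wpM2r ?expR_ge0// ler_piMr ?exprn_ge0//.
by rewrite invf_le1 ?ltr0n ?fact_gt0// ler1n fact_gt0.
Qed.

Let expR1_le (t : R) : `|expR t - 1| <= `|t| * expR `|t|.
Proof.
have := expR_taylor t 1; rewrite big_ord_recr big_ord0 /= add0r expr0 expr1.
by rewrite fact0 (_ : 1`!%:R = 1 :> R)// !divr1.
Qed.

(** The martingales give the Laplace transform of this variable; [normalized], the variable of the
    theorem, differs from it by an error controlled in L1. *)
Definition centered n w : R := (total n w - compensator n w) / b n.
Definition normalized n w : R := (total n w - v * a n) / b n.

Let mcen n : measurable_fun [set: T] (centered n).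
Proof. by apply: measurable_funM => //; exact: measurable_funB. Qed.

Let mnor n : measurable_fun [set: T] (normalized n).
Proof. by apply: measurable_funM => //; exact: measurable_funB. Qed.

Lemma expR_scaled s n w : expR (s * centered n w) =
  emart (s / b n) n w * expR (phi (s / b n) * compensator n w).
Proof. by rewrite /emart -expRD; congr expR; rewrite /centered /phi; ring. Qed.

Section scale.
Variable s : R.
Let t n := s / b n.
Let tau := `|s| / b 2.

Let tau_ge0 : 0 <= tau. Proof. by rewrite divr_ge0// ltW// b_gt0. Qed.

Let t_le n : (2 <= n)%N -> `|t n| <= tau.
Proof.
move=> n2; rewrite normrM normfV (gtr0_norm (b_gt0 n2)) ler_wpM2l//.
by rewrite lef_pV2 ?posrE ?b_gt0// b_ge.
Qed.

Let t_sqr n : (2 <= n)%N -> t n ^+ 2 * a n = s ^+ 2.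
Proof. by move=> n2; rewrite -(b_sqr n2) -exprMn divfK// gt_eqF// b_gt0. Qed.

Let t_cvg : t @ \oo --> 0.
Proof.
rewrite -(mulr0 s); apply: cvgMr; apply/gtr0_cvgV0; last exact: b_oo.
by near=> n; apply: b_gt0; near: n; exact: nbhs_infty_ge.
Unshelve. all: by end_near.
Qed.

Let correction n w := expR (phi (t n) * compensator n w).
Let Cphi := expR (s ^+ 2 * expR tau * K).

Lemma correction_le n w : (2 <= n)%N -> correction n w <= Cphi.
Proof.
move=> n2; rewrite ler_expR.
apply: (@le_trans _ _ (t n ^+ 2 * expR tau * (K * a n))); last first.
  have -> : t n ^+ 2 * expR tau * (K * a n) = t n ^+ 2 * a n * expR tau * K by ring.
  by rewrite t_sqr.
apply: ler_pM => //; last exact: comp_le.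
by apply: le_trans (phi_le _) _; rewrite ler_wpM2l ?sqr_ge0// ler_expR t_le.
Qed.

(** As phi(t) = t^2 / 2 + O(|t|^3) and t^2 a_n = s^2, the exponent is s^2 / 2 times the quotient of
    the compensator by a_n, up to a multiple of |t|, which tends to 0. *)
Lemma correction_cvg : {ae P, forall w, correction n w @[n --> \oo] --> expR (s ^+ 2 * v / 2)}.
Proof.
apply: filterS comp_cvg => w cv.
apply: continuous_cvg; first exact: continuous_expR.
have h1 : (fun n => s ^+ 2 / 2 * (compensator n w / a n)) @ \oo --> s ^+ 2 * v / 2.
  by rewrite (_ : s ^+ 2 * v / 2 = s ^+ 2 / 2 * v); [exact: cvgMr|ring].
have h2 : (fun n => `|t n| * (s ^+ 2 * expR tau * K)) @ \oo --> 0.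
  rewrite -(mul0r (s ^+ 2 * expR tau * K)) -(normr0 R); apply: cvgMl.
  by apply: (cvg_norm t_cvg).
apply/cvgrPdist_le => e e0.
have e2 : 0 < e / 2 by rewrite divr_gt0.
move/cvgrPdist_le : h1 => /(_ _ e2) h1; move/cvgr0Pnorm_le : h2 => /(_ _ e2) h2.
near=> n; have n2 : (2 <= n)%N by near: n; exact: nbhs_infty_ge.
have an := a_gt0 n2.
have H1 : `|s ^+ 2 * v / 2 - s ^+ 2 / 2 * (compensator n w / a n)| <= e / 2 by near: n.
have H2 : `| `|t n| * (s ^+ 2 * expR tau * K)| <= e / 2 by near: n.
have H3 : `|phi (t n) * compensator n w - s ^+ 2 / 2 * (compensator n w / a n)| <=
    `|t n| * (s ^+ 2 * expR tau * K).
  rewrite -(t_sqr n2).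
  rewrite (_ : _ - _ = (phi (t n) - t n ^+ 2 / 2) * compensator n w); last first.
    by field; rewrite gt_eqF.
  rewrite normrM (ger0_norm (cge0 _ _)).
  apply: (@le_trans _ _ (`|t n| ^+ 3 * expR tau * (K * a n))).
    apply: ler_pM => //; last exact: comp_le.
    by apply: le_trans (phi_dist _) _; rewrite ler_wpM2l ?exprn_ge0// ler_expR t_le.
  rewrite exprS real_normK ?num_real//.
  by rewrite le_eqVlt; apply/orP; left; apply/eqP; ring.
have := ler_norm (`|t n| * (s ^+ 2 * expR tau * K)).
rewrite -(subrK (s ^+ 2 / 2 * (compensator n w / a n)) (s ^+ 2 * v / 2)) -addrA.
have := ler_normD (s ^+ 2 * v / 2 - s ^+ 2 / 2 * (compensator n w / a n))
  (s ^+ 2 / 2 * (compensator n w / a n) - phi (t n) * compensator n w).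
rewrite [X in _ <= _ + X -> _]distrC; lra.
Unshelve. all: by end_near.
Qed.

Let mcor n : measurable_fun [set: T] (correction n).
Proof. by apply: measurableT_comp => //; exact: measurable_funM. Qed.

Lemma emart_sqr u n w : emart u n w ^+ 2 =
  emart (2 * u) n w * expR ((expR u - 1) ^+ 2 * compensator n w).
Proof.
rewrite /emart -expRM_natr -expRD; congr expR.
have -> : expR (2 * u) = expR u ^+ 2 by rewrite -expRM_natr mulrC.
ring.
Qed.

Let C2 := expR (s ^+ 2 * expR tau ^+ 2 * K).

Let sqr_corr_le n w : (2 <= n)%N -> expR ((expR (t n) - 1) ^+ 2 * compensator n w) <= C2.
Proof.
move=> n2; rewrite ler_expR.
apply: (@le_trans _ _ ((t n * expR tau) ^+ 2 * (K * a n))); last first.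
  have -> : (t n * expR tau) ^+ 2 * (K * a n) = t n ^+ 2 * a n * expR tau ^+ 2 * K by ring.
  by rewrite t_sqr.
apply: ler_pM => //; rewrite ?sqr_ge0//; last exact: comp_le.
rewrite -[leLHS]real_normK ?num_real// -[leRHS]real_normK ?num_real//.
rewrite lerXn2r ?nnegrE// normrM [X in _ * X]ger0_norm ?expR_ge0//.
by apply: le_trans (expR1_le _) _; rewrite ler_wpM2l// ler_expR t_le.
Qed.

(** The square of the martingale at t is the martingale at 2 t, of integral 1, times a factor
    bounded uniformly in n because t^2 a_n = s^2. *)
Lemma emart_sqr_le n : (2 <= n)%N ->
  P.-integrable setT (EFin \o (fun w => emart (t n) n w ^+ 2)) /\
  \int[P]_w (emart (t n) n w ^+ 2) <= C2.
Proof.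
move=> n2.
have le w : emart (t n) n w ^+ 2 <= C2 * emart (2 * t n) n w.
  by rewrite emart_sqr mulrC ler_wpM2r// sqr_corr_le.
have i1 : P.-integrable setT (EFin \o (fun w => C2 * emart (2 * t n) n w)).
  by apply: integrableZ; exact: integrable_emart.
have i2 : P.-integrable setT (EFin \o (fun w => emart (t n) n w ^+ 2)).
  apply: integrable_dom i1; first exact: measurable_funX.
  by move=> w; rewrite ger0_norm ?sqr_ge0.
split => //; apply: (@le_trans _ _ (\int[P]_w (C2 * emart (2 * t n) n w))).
  exact: le_Rintegral.
by rewrite RintegralZl ?Rint_emart1 ?mulr1//; exact: integrable_emart.
Qed.

Lemma integrable_expR_centered n : (2 <= n)%N ->
  P.-integrable setT (EFin \o (fun w => expR (s * centered n w))).
Proof.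
move=> n2; apply: (@integrable_dom _ (fun w => Cphi * emart (t n) n w)).
- by apply: measurableT_comp => //; exact: measurable_funM.
- move=> w; rewrite ger0_norm ?expR_ge0// expR_scaled mulrC.
  by rewrite ler_wpM2r// correction_le.
- by apply: integrableZ; exact: integrable_emart.
Qed.

Section tested.
Variables (k : nat) (Y : T -> R) (C : R).
Hypotheses (k2 : (2 <= k)%N) (mY : measurable_fun [set: TG k] Y).
Hypotheses (Y_ge0 : forall w, 0 <= Y w) (Y_le : forall w, Y w <= C).

Let C_ge0 : 0 <= C := le_trans (Y_ge0 point) (Y_le point).
Let mTY : measurable_fun [set: T] Y := measurable_fun_sub (@Gsub k) mY.
Let nk2 n : (2 <= n + k)%N. Proof. by rewrite (leq_trans k2)// leq_addl. Qed.

Let integrableY (f : T -> R) : P.-integrable setT (EFin \o f) ->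
  P.-integrable setT (EFin \o (fun w => Y w * f w)).
Proof.
move=> fi; have mf : measurable_fun setT f by apply/measurable_EFinP; exact: measurable_int fi.
apply: (@integrable_dom _ (fun w => C * `|f w|)); first exact: measurable_funM.
  by move=> w; rewrite normrM (ger0_norm (Y_ge0 w)) ler_wpM2r.
by apply: integrableZ; exact: integrable_norm.
Qed.

(** Y is known at time k, so the martingale property brings the time back to k; there the parameter
    t tends to 0 and the martingale to 1, under domination. *)
Lemma tested_emart_cvg :
  (fun n => \int[P]_w (Y w * emart (t (n + k)) (n + k) w)) @ \oo --> \int[P]_w Y w.
Proof.
have -> : (fun n => \int[P]_w (Y w * emart (t (n + k)) (n + k) w)) =
    (fun n => \int[P]_w (Y w * emart (t (n + k)) k w)).
  apply/funext => n; congr fine.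
  by rewrite (emart_integral Gsub Gmono mN mlam N_mgf _ (leq_addl n k) mY Y_ge0).
have iY : P.-integrable setT (EFin \o Y).
  by apply: (@integrable_bounded _ _ _ P _ _ C) => // w _; rewrite ger0_norm.
apply: fine_cvg; rewrite fineK ?integrable_fin_num//.
(* For |t| <= tau the martingale at time k is at most exp(tau total + compensator), which is
   [emart tau k] times exp(e^tau compensator). *)
pose D w := C * (expR (expR tau * (K * a k)) * emart tau k w).
have [] := @dominated_convergence _ _ _ P setT measurableT
  (fun n w => (Y w * emart (t (n + k)) k w)%:E) (EFin \o Y) (EFin \o D).
- by move=> n; apply/measurable_EFinP; apply: measurable_funM.
- exact/measurable_EFinP.
- apply: aeW => w _; apply: cvg_EFin; first by near=> n.
  rewrite -[X in _ --> X]mulr1; apply: cvgMr; rewrite -[X in _ --> X]expR0.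
  apply: continuous_cvg; first exact: continuous_expR.
  have tk : (fun n => t (n + k)) @ \oo --> 0 by have := t_cvg; rewrite -(cvg_shiftn k).
  have -> : (0 : R) = 0 * total k w - (expR 0 - 1) * compensator k w.
    by rewrite expR0 subrr !mul0r subrr.
  apply: cvgB; first by apply: cvgMl.
  apply: cvgMl; apply: cvgB; last exact: cvg_cst.
  by apply: continuous_cvg => //; exact: continuous_expR.
- by do 2 apply: integrableZ; exact: integrable_emart.
- apply: aeW => w n _ /=; rewrite lee_fin normrM !ger0_norm//.
  apply: ler_pM => //; rewrite /emart -expRD ler_expR.
  have h1 : t (n + k) * total k w <= tau * total k w.
    by rewrite ler_wpM2r// (le_trans (ler_norm _))// t_le.
  have h2 : - ((expR (t (n + k)) - 1) * compensator k w) <= compensator k w.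
    by rewrite -mulNr ler_piMl//; have := expR_ge0 (t (n + k)); lra.
  have h3 : expR tau * compensator k w <= expR tau * (K * a k).
    by rewrite ler_wpM2l ?expR_ge0// comp_le.
  by lra.
by [].
Unshelve. all: by end_near.
Qed.

(** By [expR_scaled] the integrand is Y times the martingale times [correction]; once the latter is
    replaced by its limit, [tested_emart_cvg] concludes. *)
Lemma tested_mgf_cvg :
  (fun n => \int[P]_w (Y w * expR (s * centered (n + k) w))) @ \oo -->
  (\int[P]_w Y w) * expR (s ^+ 2 * v / 2).
Proof.
set kap := expR (s ^+ 2 * v / 2).
have C20 : 0 < C2 by exact: expR_gt0.
pose dlt n w := (correction (n + k) w - kap) ^+ 2.
have mdlt n : measurable_fun setT (dlt n).
  by apply: measurable_funX; exact: measurable_funB.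
have dlt_le n w : `|dlt n w| <= (Cphi + kap) ^+ 2.
  rewrite ger0_norm ?sqr_ge0// -[leLHS]real_normK ?num_real//.
  rewrite lerXn2r ?nnegrE ?addr_ge0 ?expR_ge0//.
  apply: le_trans (ler_normB _ _) _; rewrite !ger0_norm ?expR_ge0// lerD2r.
  exact: correction_le.
have idlt n : P.-integrable setT (EFin \o dlt n).
  by apply: (@integrable_bounded _ _ _ P _ _ ((Cphi + kap) ^+ 2)).
have dlt_cvg : (fun n => \int[P]_w dlt n w) @ \oo --> (0 : R).
  have := @bounded_convergence R _ _ P setT dlt (cst 0) ((Cphi + kap) ^+ 2) measurableT
    mdlt (measurable_cst _) _ (fun n x _ => dlt_le n x).
  have z0 : (\int[P]_x (@cst T R 0 x)%:E = 0)%E by exact: integral0.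
  move=> H; suff H' : (\int[P]_x (dlt n x)%:E)%E @[n --> \oo] --> (\int[P]_x (@cst T R 0 x)%:E)%E.
    by rewrite -[0]/(fine 0%E); apply: fine_cvg; rewrite z0 in H'.
  apply: H.
  apply: filterS correction_cvg => w cw _.
  have -> : cst 0 w = (kap - kap) ^+ 2 :> R by rewrite subrr expr0n.
  have cw' : (fun n => correction (n + k) w) @ \oo --> kap.
    by have := cw; rewrite -(cvg_shiftn k).
  rewrite expr2.
  have -> : (fun n => dlt n w) =
      (fun n => (correction (n + k) w - kap) * (correction (n + k) w - kap)).
    by apply/funext => n; rewrite /dlt expr2.
  by apply: cvgM; apply: cvgB => //; exact: cvg_cst.
have em := tested_emart_cvg.
have emk : (fun n => \int[P]_w (Y w * emart (t (n + k)) (n + k) w) * kap) @ \oo -->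
    \int[P]_w Y w * kap by exact: cvgMl.
(* AM-GM separates the second moment of emart, which is bounded, from that of
   [correction - kap], which vanishes. *)
have main n eta : 0 < eta ->
    `|\int[P]_w (Y w * emart (t (n + k)) (n + k) w) * kap -
      \int[P]_w (Y w * expR (s * centered (n + k) w))| <=
    C * (eta * C2 + (4 * eta)^-1 * \int[P]_w dlt n w).
  move=> eta0; have [i2 e2] := emart_sqr_le (nk2 n).
  have i1 := integrableY (integrable_emart (t (n + k)) (n + k)).
  have i3 := integrableY (integrable_expR_centered (nk2 n)).
  rewrite -RintegralZr//.
  have i1' : P.-integrable setT (EFin \o (fun w => Y w * emart (t (n + k)) (n + k) w * kap)).
    apply: (@eq_integrable _ _ _ P _ _ (EFin \o (fun w => kap * (Y w * emart (t (n + k)) (n + k) w)))) => //.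
      by move=> w _ /=; rewrite mulrC.
    exact: integrableZ.
  rewrite -RintegralB//.
  have i4 : P.-integrable setT (EFin \o (fun w => Y w * emart (t (n + k)) (n + k) w * kap -
      Y w * expR (s * centered (n + k) w))).
    apply: (@eq_integrable _ _ _ P _ _ (fun w => (Y w * emart (t (n + k)) (n + k) w * kap)%:E -
      (Y w * expR (s * centered (n + k) w))%:E)%E) => //.
    exact: integrableB.
  apply: le_trans (le_normr_Rintegral _ i4) _ => //.
  have i5 : P.-integrable setT (EFin \o (fun w => eta * emart (t (n + k)) (n + k) w ^+ 2 +
      (4 * eta)^-1 * dlt n w)) by apply: integrableA; exact: integrableZ.
  apply: (@le_trans _ _ (\int[P]_w (C * (eta * emart (t (n + k)) (n + k) w ^+ 2 +
      (4 * eta)^-1 * dlt n w)))).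
    apply: le_Rintegral => //; [exact: integrable_norm|exact: integrableZ|].
    move=> w _; rewrite expR_scaled -/(t (n + k)) -/(correction (n + k) w).
    set z := emart _ _ w.
    rewrite (_ : _ - _ = Y w * (z * (kap - correction (n + k) w))); last by ring.
    rewrite normrM (ger0_norm (Y_ge0 w)); apply: ler_pM => //.
    have -> : eta * z ^+ 2 + (4 * eta)^-1 * dlt n w =
        (4 * eta)^-1 * ((2 * eta * z) ^+ 2 + (kap - correction (n + k) w) ^+ 2).
      by rewrite /dlt; field; rewrite gt_eqF.
    rewrite ler_pdivlMl ?mulr_gt0//.
    set q := kap - _; have -> : 4 * eta * `|z * q| = 2 * `|(2 * eta * z) * q|.
      by rewrite !normrM (gtr0_norm eta0) normr_nat; ring.
    case: (ger0P (2 * eta * z * q)) => _.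
      by have := sqr_ge0 (2 * eta * z - q); lra.
    by have := sqr_ge0 (2 * eta * z + q); lra.
  rewrite RintegralZl// ler_wpM2l// RintegralD//; try exact: integrableZ.
  rewrite RintegralZl// RintegralZl//.
  by rewrite lerD2r ler_pM2l.
apply/cvgrPdist_le => e e0.
have e3 : 0 < e / 3 by rewrite divr_gt0.
have C1 : 0 < C + 1 by rewrite ltr_wpDl.
(* Makes the martingale term equal to e / 3, uniformly in n; C + 1 stands for C, which may be 0. *)
pose eta := e / (3 * (C + 1) * C2).
have eta0 : 0 < eta by rewrite divr_gt0// !mulr_gt0.
have etaE : (C + 1) * (eta * C2) = e / 3 by rewrite /eta; field; rewrite !gt_eqF.
have dlt_cvg' : (fun n => (C + 1) * ((4 * eta)^-1 * \int[P]_w dlt n w)) @ \oo --> (0 : R).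
  rewrite -(mulr0 (C + 1)) -(mulr0 (4 * eta)^-1).
  by apply: cvgMr; apply: cvgMr.
move/cvgr0Pnorm_le : dlt_cvg' => /(_ _ e3) h1.
move/cvgrPdist_le : emk => /(_ _ e3) h2.
near=> n.
have H1 : `|(C + 1) * ((4 * eta)^-1 * \int[P]_w dlt n w)| <= e / 3 by near: n.
have H2 : `|\int[P]_w Y w * kap - \int[P]_w (Y w * emart (t (n + k)) (n + k) w) * kap| <= e / 3.
  by near: n.
have H3 := main n _ eta0.
have d0 : 0 <= \int[P]_w dlt n w by apply: Rintegral_ge0 => w _; exact: sqr_ge0.
have q0 : 0 <= eta * C2 + (4 * eta)^-1 * \int[P]_w dlt n w.
  have q1 : 0 <= eta * C2 by rewrite mulr_ge0// ltW.
  have q2 : 0 <= (4 * eta)^-1 by rewrite invr_ge0 mulr_ge0// ltW.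
  by rewrite addr_ge0// mulr_ge0.
have H4 : C * (eta * C2 + (4 * eta)^-1 * \int[P]_w dlt n w) <= e / 3 + e / 3.
  apply: (@le_trans _ _ ((C + 1) * (eta * C2 + (4 * eta)^-1 * \int[P]_w dlt n w))).
    by rewrite ler_wpM2r// lerDl.
  by rewrite mulrDr etaE lerD2l (le_trans (ler_norm _)).
set A := \int[P]_w Y w * kap in H2 *.
set B := \int[P]_w (Y w * emart _ _ w) * kap in H2 H3.
set D := \int[P]_w (Y w * expR _) in H3 *.
rewrite -(subrK B A) -addrA; apply: le_trans (ler_normD _ _) _; lra.
Unshelve. all: by end_near.
Qed.

End tested.

End scale.

Hypothesis comp_error : (fun n => (\int[P]_w `|compensator n w - v * a n|) / b n) @ \oo --> (0 : R).

Let normalizedE n w : normalized n w = centered n w + (compensator n w - v * a n) / b n.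
Proof. by rewrite /normalized /centered -mulrDl; congr (_ / _); ring. Qed.

Let comp_dist_le n w : (2 <= n)%N -> `|compensator n w - v * a n| <= K * a n + v * a n.
Proof.
move=> n2; apply: le_trans (ler_normB _ _) _.
rewrite !ger0_norm ?cge0 ?mulr_ge0 ?(ltW (a_gt0 n2))//.
by rewrite lerD2r comp_le.
Qed.

Let integrable_comp_dist n : (2 <= n)%N ->
  P.-integrable setT (EFin \o (fun w => `|compensator n w - v * a n|)).
Proof.
move=> n2; apply: (@integrable_bounded _ _ _ P setT _ (K * a n + v * a n)) => //.
  by apply: measurableT_comp => //; exact: measurable_funB.
by move=> w _; rewrite normr_id comp_dist_le.
Qed.

Let integrable_wt_centered c n : (2 <= n)%N ->
  P.-integrable setT (EFin \o (fun w => wt c (centered n w))).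
Proof.
move=> n2; have -> : (fun w => wt c (centered n w)) =
    (fun w => expR (c * centered n w) + expR (- c * centered n w)).
  by apply/funext => w; rewrite /wt mulNr.
by apply: integrableA; exact: integrable_expR_centered.
Qed.

Let integrable_expbounded g n : (2 <= n)%N -> expbounded g ->
  P.-integrable setT (EFin \o (fun w => g (centered n w))).
Proof.
move=> n2 [cg [c [k [c0 gk]]]].
apply: (@integrable_dom _ (fun w => k * wt c (centered n w))) => //.
  by apply: measurableT_comp => //; exact: continuous_measurable_fun.
by apply: integrableZ; exact: integrable_wt_centered.
Qed.

Let integrable_linbounded g n : (2 <= n)%N -> linbounded g ->
  P.-integrable setT (EFin \o (fun w => g (normalized n w))).
Proof.
move=> n2 [cg [k gk]].
have k0 : 0 <= k.
  by have := le_trans (normr_ge0 _) (gk 0); rewrite normr0 addr0 mulr1.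
set E := (K * a n + v * a n) / b n.
apply: (@integrable_dom _ (fun w => k * (wt 1 (centered n w) + E))) => //.
- by apply: measurableT_comp => //; exact: continuous_measurable_fun.
- move=> w; apply: le_trans (gk _) _; rewrite ler_wpM2l// normalizedE.
  apply: le_trans (lerD (lexx 1) (ler_normD _ _)) _; rewrite addrA lerD//.
    apply: le_trans (expR_norm_le_wt _ ler01); rewrite mul1r; exact: expR_ge1Dx.
  rewrite normrM [X in _ * X]gtr0_norm ?invr_gt0 ?b_gt0//.
  by rewrite ler_pM2r ?invr_gt0 ?b_gt0// comp_dist_le.
- apply: integrableZ; apply: integrableA; last exact: integrableC.
  exact: integrable_wt_centered.
Qed.

Section weak_limit.
Variables (k : nat) (Y : T -> R) (C : R).
Hypotheses (k2 : (2 <= k)%N) (mY : measurable_fun [set: TG k] Y).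
Hypotheses (Y_ge0 : forall w, 0 <= Y w) (Y_le : forall w, Y w <= C).

Let C_ge0 : 0 <= C := le_trans (Y_ge0 point) (Y_le point).
Let mTY : measurable_fun [set: T] Y := measurable_fun_sub (@Gsub k) mY.
Let nk2 n : (2 <= n + k)%N. Proof. by rewrite (leq_trans k2)// leq_addl. Qed.

Let integrableY (f : T -> R) : P.-integrable setT (EFin \o f) ->
  P.-integrable setT (EFin \o (fun w => Y w * f w)).
Proof.
move=> fi; have mf : measurable_fun setT f by apply/measurable_EFinP; exact: measurable_int fi.
apply: (@integrable_dom _ (fun w => C * `|f w|)); first exact: measurable_funM.
  by move=> w; rewrite normrM (ger0_norm (Y_ge0 w)) ler_wpM2r.
by apply: integrableZ; exact: integrable_norm.
Qed.

Let positive_expectation D (X : T -> R) :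
  (forall g, D g -> P.-integrable setT (EFin \o (fun w => g (X w)))) ->
  positive_functional D (fun g => \int[P]_w (Y w * g (X w))).
Proof.
move=> iD; split=> [g h Dg Dh gh|c g h Dg Dh].
  apply: le_Rintegral => //; [exact: integrableY (iD _ Dg)|exact: integrableY (iD _ Dh)|].
  by move=> w _; rewrite ler_wpM2l.
have ig := integrableY (iD _ Dg); have ih := integrableY (iD _ Dh).
rewrite -RintegralZl// -RintegralD//; last exact: integrableZ.
by apply: eq_Rintegral => w _; ring.
Qed.

(** An instance of [cvg_mgf], with T built on [centered], S on [normalized], and [dl] their L1
    distance weighted by Y, which [comp_error] sends to 0. *)
Lemma tested_weak_cvg f : continuous f -> (exists c, forall x, `|f x| <= c) ->
  (fun n => \int[P]_w (Y w * f (normalized n w))) @ \oo -->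
  (\int[P]_w Y w) * gauss_int v f.
Proof.
move=> cf bf; rewrite -(cvg_shiftn k).
apply: (@cvg_mgf _ (fun n g => \int[P]_w (Y w * g (centered (n + k) w)))
  (fun n g => \int[P]_w (Y w * g (normalized (n + k) w)))
  (fun g => (\int[P]_w Y w) * gauss_int v g)
  (fun n => \int[P]_w (Y w * `|normalized (n + k) w - centered (n + k) w|))) => //.
- by move=> n; apply: positive_expectation => g; exact: integrable_expbounded.
- by apply: positive_gauss_int => //; apply: Rintegral_ge0 => w _.
- by move=> n; apply: positive_expectation => g; exact: integrable_linbounded.
- by move=> s; rewrite gauss_int_expR//; exact: (@tested_mgf_cvg s k Y C).
- move=> n g c gc.
  have lg : linbounded g.
    split; first exact: lipschitz_continuous gc.
    exists (`|g 0| + `|c|) => x; rewrite -[g x](subrK (g 0)) addrC.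
    apply: le_trans (ler_normD _ _) _.
    have := gc x 0; rewrite subr0 => gx.
    have h1 : c * `|x| <= `|c| * `|x| by rewrite ler_wpM2r// ler_norm.
    have h2 : 0 <= `|g 0| * `|x| by exact: mulr_ge0.
    have h3 : 0 <= `|c| by [].
    by rewrite mulrDl !mulrDr !mulr1; lra.
  have i1 := integrableY (integrable_linbounded (nk2 n) lg).
  have i2 := integrableY (integrable_expbounded (nk2 n) (linbounded_exp lg)).
  have i3 : P.-integrable setT (EFin \o (fun w => Y w * g (normalized (n + k) w) -
      Y w * g (centered (n + k) w))).
    apply: (@eq_integrable _ _ _ P _ _ (fun w => (Y w * g (normalized (n + k) w))%:E -
      (Y w * g (centered (n + k) w))%:E)%E) => //.
    exact: integrableB.
  have i4 : P.-integrable setT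
      (EFin \o (fun w => Y w * `|normalized (n + k) w - centered (n + k) w|)).
    apply: integrableY; apply: (@integrable_bounded _ _ _ P setT _
      ((K * a (n + k) + v * a (n + k)) / b (n + k))) => //.
      by apply: measurableT_comp => //; exact: measurable_funB.
    move=> w _; rewrite normr_id normalizedE addrC addKr normrM.
    rewrite [X in _ * X]gtr0_norm ?invr_gt0 ?b_gt0//.
    by rewrite ler_pM2r ?invr_gt0 ?b_gt0// comp_dist_le.
  rewrite -RintegralB// -RintegralZl//.
  apply: le_trans (le_normr_Rintegral _ i3) _ => //.
  apply: le_Rintegral => //; [exact: integrable_norm|exact: integrableZ|].
  move=> w _; rewrite -mulrBr normrM (ger0_norm (Y_ge0 w)) mulrCA ler_wpM2l//.
- apply: (@squeeze_cvgr _ _ _ _ (cst 0)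
    (fun n => C * ((\int[P]_w `|compensator (n + k) w - v * a (n + k)|) / b (n + k)))).
  + near=> n; apply/andP; split.
      by apply: Rintegral_ge0 => w _; exact: mulr_ge0.
    have ic := integrable_comp_dist (nk2 n).
    have e w : `|normalized (n + k) w - centered (n + k) w| =
        (b (n + k))^-1 * `|compensator (n + k) w - v * a (n + k)|.
      rewrite normalizedE addrC addKr normrM mulrC.
      by rewrite [X in X * _]gtr0_norm ?invr_gt0 ?b_gt0.
    rewrite [X in C * X]mulrC -RintegralZl// -RintegralZl//; last exact: integrableZ.
    apply: le_Rintegral => //.
    * by apply: integrableY; under eq_fun do rewrite e; exact: integrableZ.
    * by do 2 apply: integrableZ.
    * by move=> w _; rewrite e ler_wpM2r// mulr_ge0// invr_ge0 ltW// b_gt0.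
  + exact: cvg_cst.
  + rewrite -[X in _ --> X](mulr0 C); apply: cvgMr.
    by have := comp_error; rewrite -(cvg_shiftn k).
Unshelve. all: by end_near.
Qed.

End weak_limit.

(** Adding C to [W k] gives a nonnegative bounded density known at time k + 2. [tested_weak_cvg] for
    it and for the constant 1 yields the asymptotic orthogonality that [mixing_decorrelation] asks
    for. *)
Theorem total_stable_clt f H : continuous f -> (exists c, forall x, `|f x| <= c) ->
  measurable H -> (fun n => \int[P]_(w in H) f (normalized n w)) @ \oo -->
  gauss_int v f * fine (P H).
Proof.
move=> cf [M fM] mH; have M0 : 0 <= M by exact: le_trans (normr_ge0 _) (fM 0).
set g := gauss_int v f.
(* The shift by 2 starts the sequence where a is known to be positive. *)
pose W n w := f (normalized (n + 2)%N w) - g.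
pose C := M + `|g|.
have mf n : measurable_fun setT (fun w => f (normalized n w)).
  by apply: measurableT_comp => //; exact: continuous_measurable_fun.
have mW n : measurable_fun setT (W n) by exact: measurable_funB.
have WC n w : `|W n w| <= C.
  by apply: le_trans (ler_normB _ _) _; rewrite lerD2r.
have C0 : 0 <= C by rewrite addr_ge0.
have bnd n D : measurable D -> P.-integrable D (EFin \o (fun w => f (normalized n w))).
  move=> mD; apply: (@integrable_bounded _ _ _ P D _ M) => //.
  exact: measurable_funTS.
have orth k : (fun n => \int[P]_w (W n w * W k w)) @ \oo --> (0 : R).
  pose Y w := W k w + C.
  have mY : measurable_fun [set: TG (k + 2)%N] Y.
    apply: measurable_funD => //; apply: measurable_funB => //.
    apply: (measurableT_comp (continuous_measurable_fun cf)).
    apply: measurable_funM => //; apply: measurable_funB => //.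
    exact: (measurable_total Gmono mN).
  have Y0 w : 0 <= Y w by have := WC k w; rewrite ler_norml /Y => /andP[]; lra.
  have YC w : Y w <= 2 * C by have := WC k w; rewrite ler_norml /Y => /andP[]; lra.
  have k2 : (2 <= k + 2)%N by rewrite leq_addl.
  have h1 := tested_weak_cvg k2 mY Y0 YC cf (ex_intro _ M fM).
  have h2 := tested_weak_cvg (leqnn 2) (measurable_cst (1 : R)) (fun=> ler01) (fun=> lexx _)
    cf (ex_intro _ M fM).
  have mTY : measurable_fun [set: T] Y := measurable_fun_sub (@Gsub (k + 2)%N) mY.
  have iY : P.-integrable setT (EFin \o Y).
    by apply: (@integrable_bounded _ _ _ P setT _ (2 * C)) => // w _; rewrite ger0_norm.
  have iYf n : P.-integrable setT (EFin \o (fun w => Y w * f (normalized n w))).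
    apply: (@integrable_bounded _ _ _ P setT _ (2 * C * M)) => //.
      exact: measurable_funM.
    by move=> w _; rewrite normrM ler_pM// ger0_norm.
  have e n : \int[P]_w (W n w * W k w) =
      (\int[P]_w (Y w * f (normalized (n + 2)%N w)) - (\int[P]_w Y w) * g) -
      C * (\int[P]_w (1 * f (normalized (n + 2)%N w)) - g).
    have -> : \int[P]_w (1 * f (normalized (n + 2)%N w)) - g =
        \int[P]_w (f (normalized (n + 2)%N w) - g).
      rewrite RintegralB//; last exact: bnd.
      rewrite Rintegral_cst// PT1 mulr1; congr (_ - _).
      by apply: eq_Rintegral => w _; rewrite mul1r.
    have -> : (\int[P]_w Y w) * g = \int[P]_w (g * Y w) by rewrite RintegralZl// mulrC.
    have igY := integrableZ g iY.
    have iW : P.-integrable setT (EFin \o (fun w => f (normalized (n + 2)%N w) - g)).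
      exact: (integrable_bounded P measurableT (mW n) (fun w _ => WC n w)).
    have iYW : P.-integrable setT (EFin \o (fun w => Y w * f (normalized (n + 2)%N w) - g * Y w)).
      apply: (@eq_integrable _ _ _ P _ _ (fun w => (Y w * f (normalized (n + 2)%N w))%:E -
        (g * Y w)%:E)%E) => //.
      by apply: integrableB; [exact: measurableT|exact: iYf|exact: igY].
    rewrite -RintegralB// -RintegralZl// -RintegralB//; last exact: integrableZ.
    by apply: eq_Rintegral => w _; rewrite /Y /W; ring.
  under eq_fun do rewrite e.
  have l1 : (fun n => \int[P]_w (Y w * f (normalized (n + 2)%N w)) - (\int[P]_w Y w) * g)
      @ \oo --> (0 : R).
    rewrite -(subrr ((\int[P]_w Y w) * g)); apply: cvgB; last exact: cvg_cst.
    by have := h1; rewrite -(cvg_shiftn 2).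
  have l2 : (fun n => \int[P]_w (1 * f (normalized (n + 2)%N w)) - g) @ \oo --> (0 : R).
    rewrite -(subrr g); apply: cvgB; last exact: cvg_cst.
    by have := h2; rewrite Rintegral_cst// PT1 !mul1r -(cvg_shiftn 2).
  have -> : (0 : R) = 0 - C * 0 by rewrite mulr0 subrr.
  by apply: cvgB => //; exact: cvgMr.
have mix := mixing_decorrelation mW WC orth mH.
rewrite -(cvg_shiftn 2).
have -> : (fun n => \int[P]_(w in H) f (normalized (n + 2)%N w)) =
    (fun n => \int[P]_(w in H) W n w + g * fine (P H)).
  apply/funext => n; rewrite RintegralB//; first last.
  - exact: (@integrable_bounded _ _ _ P H _ `|g|).
  - exact: bnd.
  by rewrite Rintegral_cst// subrK.
have h : (fun n => \int[P]_(w in H) W n w + g * fine (P H)) @ \oo --> 0 + g * fine (P H).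
  by apply: cvgD => //; exact: cvg_cst.
by rewrite add0r in h.
Qed.

End stable_clt.

(** * The strong law and the stable limit in the model *)

Lemma ae_ex {R : realType} {d} {T : measurableType d} (P : probability T R)
    (Q : T -> Prop) : {ae P, forall w, Q w} -> exists w, Q w.
Proof.
move=> [N [mN N0 QN]]; apply: contrapT => nQ.
have : P setT = 1%E by exact: probability_setT.
rewrite (_ : setT = N); first by rewrite N0 => /eqP; rewrite eq_sym onee_eq0.
apply/seteqP; split => // w _; apply: QN => /= Qw; apply: nQ; by exists w.
Qed.

Theorem theorem7 (R : realType)
    (dO : measure_display) (Omega : measurableType dO) (P : probability Omega R)
    (d : measure_display) (X : measurableType d) (dist : X -> X -> R)
    (m : probability X R) (alpha beta c u : R)
    (M : nat -> Omega -> @Meas R d X) (Rv : nat -> Omega -> R)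
    (B : set X) (r : R) :
  separable_metric_Borel dist ->
  diffuse m ->
  0 < alpha -> 0 <= beta -> beta < 1 -> - beta < c ->
  Num.max beta 0 < u ->
  (forall n, (1 <= n)%N -> random_measure (M n)) ->
  (forall n, (1 <= n)%N -> measurable_fun setT (Rv n)) ->
  (forall n w, (1 <= n)%N -> u <= Rv n w) ->
  (forall n, (1 <= n)%N ->
     indep_sigma P (sigma_gen [set (fun w => (Rv n w)%:E)]) (G_ M Rv n)) ->
  (forall n, cond_BeP P (F_ M Rv n) (M n.+1) (nu_ m alpha beta c M Rv n)) ->
  measurable B ->
  {ae P, forall w, (fun n => Rbar Rv n w) @ \oo --> r} ->
  {ae P, forall w, (fun n => L_ M n B w / a_ beta n) @ \oo -->
                     fine (m B) * lambda_ alpha c r beta}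
  /\
  ((fun n => ((\sum_(1 <= j < n.+1)
                 (powR (j%:R) (beta - 1))%:E * \int[P]_w (`|Rbar Rv j w - r|)%:E)
              * ((Num.sqrt (a_ beta n))^-1)%:E)%E) @ \oo --> 0%E ->
   stably_to P
     (fun n w => Num.sqrt (a_ beta n) *
                 (L_ M n B w / a_ beta n - fine (m B) * lambda_ alpha c r beta))
     (fun _ f => gauss_int (fine (m B) * lambda_ alpha c r beta) f)).
Proof.
move=> sepX diff_m al0 be0 be1 cb ub mM mRv Ru _ condM mB Rcv.
have u0 : 0 < u by apply: le_lt_trans ub; rewrite le_max lexx orbT.
have cbeta : 0 < c + beta by move: cb; lra.
have [C [mC sepC]] := separating_sequence sepX.
have path w : path_ge u (fun k => sumR Rv k w).
  move=> k k1; rewrite /sumR.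
  apply: (@le_trans _ _ (\sum_(1 <= i < k.+1) u)).
    by rewrite sumr_const_nat subSS subn0 mulr_natr.
  by apply: ler_sum_nat => i /andP[i1 _]; exact: Ru.
(* As r is a constant, a single outcome along which the averages converge decides the inequality. *)
have ur : u <= r.
  have [w wr] := ae_ex Rcv.
  rewrite -(cvg_lim (@Rhausdorff R) wr); apply: limr_ge; first by apply/cvg_ex; exists r.
  near=> n; have n0 : (0 < n)%N by near: n; exact: nbhs_infty_gt.
  by rewrite /Rbar ler_pdivlMr ?ltr0n//; exact: path.
pose G n := gen_of (gens M Rv n).
have Gsub n : <<s G n >> `<=` measurable := @F_sub _ _ _ _ _ _ _ mM mRv n.
have Gmono n : <<s G n >> `<=` <<s G n.+1 >> := @F_mono _ _ _ _ _ _ _ n.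
have [CL bndL] := hazard_rate_bounded al0 be0 be1 cbeta u0 erefl.
have bndL' n : exists K, forall w, Lambda alpha beta c Rv n w <= K.
  by exists CL => w; exact: (bndL _ (path w)).
have al0' := ltW al0.
pose mb := fine (m B).
have mb0 : 0 <= mb by exact: fine_ge0.
have mb1 : mb <= 1.
  rewrite -lee_fin fineK ?fin_num_measure//; exact: probability_le1.
pose N n w := new_points M C B n w.
pose lam n w := Lambda alpha beta c Rv n w * mb.
have mN n : measurable_fun [set: g_sigma_algebraType (G n.+1)] (N n) by exact: new_points_FT.
have mlam n : measurable_fun [set: g_sigma_algebraType (G n)] (lam n).
  by apply: measurable_funM => //; exact: Lambda_FT.
have lam0 n w : 0 <= lam n w by rewrite mulr_ge0// Lambda_ge0.
have N_mgf n t H : @measurable _ (g_sigma_algebraType (G n)) H ->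
  (\int[P]_(w in H) (expR (t * N n w))%:E =
   \int[P]_(w in H) (expR (lam n w * (expR t - 1)))%:E)%E.
  exact: (new_points_mgf mM mRv al0' diff_m condM mC sepC bndL' mB).
have LE := ae_L_new_points mM mRv al0' diff_m condM mC sepC bndL' mB.
have N0 n w : 0 <= N n w by exact: new_points_ge0.
have [K K0 sumK] := sum_hazard_rate_le al0 be0 be1 cbeta u0 erefl.
have compE n w : compensator lam n w =
    (\sum_(i < n) hazard_rate alpha beta c (fun k => sumR Rv k w) i) * mb.
  by rewrite mulr_suml.
have sum0 n w : 0 <= \sum_(i < n) hazard_rate alpha beta c (fun k => sumR Rv k w) i.
  by apply: sumr_ge0 => i _; exact: (Lambda_ge0 beta c Rv al0').
have comp_le n w : (2 <= n)%N -> compensator lam n w <= K * a_ beta n.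
  by move=> n2; rewrite compE; apply: le_trans (sumK _ (path w) n n2); rewrite ler_piMr.
set v := fine (m B) * lambda_ alpha c r beta.
have comp_cvg : {ae P, forall w, compensator lam n w / a_ beta n @[n --> \oo] --> v}.
  apply: filterS Rcv => w wr.
  under eq_fun do rewrite compE mulrAC mulrC.
  by apply: cvgMr; exact: (sum_hazard_rate_cvg al0 be0 be1 cbeta u0 ur erefl (path w) wr).
have v0 : 0 <= v.
  have [w wv] := ae_ex comp_cvg.
  rewrite -(cvg_lim (@Rhausdorff R) wv); apply: limr_ge; first by apply/cvg_ex; exists v.
  by near=> n; rewrite divr_ge0 ?a_ge0// compE mulr_ge0.
have ang := @a_gt0 R beta.
have and_ := a_nd be0 be1.
have aoo := a_oo be0.
split.
  have H := total_slln Gsub Gmono mN mlam lam0 N_mgf N0 (a_ge0 beta) and_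
    (fun n => proj2 (andP (a_step be0 be1 n))) aoo K0 comp_le comp_cvg.
  apply: filterS2 LE H => w LEw.
  suff -> : (fun n => L_ M n B w / a_ beta n) = (fun n => total N n w / a_ beta n) by [].
  by apply/funext => n; rewrite LEw.
move=> err.
have [C1 [C2 [C10 C20 CE]]] := sum_hazard_rate_error al0 be0 be1 cbeta u0 ur erefl.
pose b n := Num.sqrt (a_ beta n).
have b0 n : (2 <= n)%N -> 0 < b n by move=> n2; rewrite sqrtr_gt0 a_gt0.
have mRbar k : measurable_fun setT (fun w => `|Rbar Rv k w - r|).
  apply: measurableT_comp => //; apply: measurable_funB => //.
  apply: measurable_funM => //.
  exact: (measurable_fun_sub (Gsub k) (@sumR_FT _ _ _ _ _ M Rv k)).
have mcomp n : measurable_fun setT (compensator lam n) := mT_comp Gsub Gmono mlam n.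
pose S n := (\sum_(1 <= j < n.+1) (powR (j%:R) (beta - 1))%:E *
  \int[P]_w (`|Rbar Rv j w - r|)%:E)%E.
have compD n w : (1 <= n)%N -> `|compensator lam n w - v * a_ beta n| <=
    C1 + C2 * \sum_(1 <= k < n.+1) powR k%:R (beta - 1) * `|Rbar Rv k w - r|.
  move=> n1; rewrite compE /v -/mb.
  rewrite (_ : _ - _ = mb * (\sum_(i < n) hazard_rate alpha beta c (fun k => sumR Rv k w) i -
    lambda_ alpha c r beta * a_ beta n)); last by ring.
  rewrite normrM (ger0_norm mb0).
  apply: le_trans (ler_piMl (normr_ge0 _) mb1) _.
  apply: le_trans (CE _ (path w) n n1) _; rewrite lerD2l ler_wpM2l//.
  (* The pathwise error sums over k < n, while the hypothesis includes j = n; the extra term is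
     nonnegative. *)
  by rewrite big_nat_recr//= lerDl mulr_ge0// powR_ge0.
(* The weights [Rv] need not be integrable, so the expectations stay in the extended reals until the
   convergence in [err] makes [S n] finite for large n. *)
have distE n : (1 <= n)%N ->
    (\int[P]_w (`|compensator lam n w - v * a_ beta n|)%:E <= C1%:E + C2%:E * S n)%E.
  move=> n1.
  have mT k : measurable_fun setT
      (fun w => ((powR k%:R (beta - 1))%:E * (`|Rbar Rv k w - r|)%:E)%E).
    apply: emeasurable_funM => //; exact/measurable_EFinP.
  have T0 k w : (0 <= (powR k%:R (beta - 1))%:E * (`|Rbar Rv k w - r|)%:E)%E.
    by rewrite mule_ge0// lee_fin powR_ge0.
  pose U w := (\sum_(1 <= k < n.+1) (powR k%:R (beta - 1))%:E * (`|Rbar Rv k w - r|)%:E)%E.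
  have mU : measurable_fun setT U by exact: emeasurable_sum.
  have U0 w : (0 <= U w)%E by apply: sume_ge0 => k _.
  have intU : (\int[P]_w U w = S n)%E.
    rewrite /U ge0_integral_sum//; apply: eq_bigr => k _.
    by rewrite ge0_integralZl_EFin ?powR_ge0//; exact/measurable_EFinP.
  have PC : (\int[P]__ C1%:E = C1%:E)%E.
    rewrite integral_cst// -[RHS]mule1; congr (_ * _)%E; exact: probability_setT.
  have -> : (C1%:E + C2%:E * S n = \int[P]_w (C1%:E + C2%:E * U w))%E.
    rewrite ge0_integralD//=; first last.
    - exact: emeasurable_funM.
    - by move=> w _; rewrite mule_ge0.
    by rewrite ge0_integralZl_EFin// intU; congr (_ + _)%E; exact/esym.
  apply: ge0_le_integral => //.
  - by apply/measurable_EFinP; apply: measurableT_comp => //; exact: measurable_funB.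
  - apply: emeasurable_funD => //; apply: emeasurable_funM => //; exact: emeasurable_sum.
  - move=> w _; apply: le_trans (_ : _ <= (C1 + C2 *
      \sum_(1 <= k < n.+1) powR k%:R (beta - 1) * `|Rbar Rv k w - r|)%:E)%E _.
      by rewrite lee_fin compD.
    by rewrite EFinD EFinM -sumEFin; under eq_bigr do rewrite EFinM.
have S0 n : (0 <= S n)%E.
  by apply: sume_ge0 => k _; rewrite mule_ge0// ?lee_fin ?powR_ge0// integral_ge0.
have comp_error : (fun n => (\int[P]_w `|compensator lam n w - v * a_ beta n|) / b n) @ \oo --> (0 : R).
  move/fine_cvgP : err => [errfin errcv].
  apply: (@squeeze_cvgr _ _ _ _ (cst 0)
    (fun n => C1 * (b n)^-1 + C2 * fine (S n * ((b n)^-1)%:E)%E)).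
  - near=> n.
    have n2 : (2 <= n)%N by near: n; exact: nbhs_infty_ge.
    have Sfin : S n \is a fin_num.
      have : (S n * ((b n)^-1)%:E)%E \is a fin_num by near: n.
      case: (S n) (S0 n) => [x _ _ //|_|//].
      by rewrite gt0_mulye// lte_fin invr_gt0 b0.
    have bi : 0 < (b n)^-1 by rewrite invr_gt0 b0.
    apply/andP; split; first by rewrite divr_ge0 ?(ltW (b0 _ n2))// Rintegral_ge0.
    have := distE n (ltnW n2); move: Sfin; case: (S n) => [x _|//|//] h.
    rewrite /= mulrA -mulrDl ler_pM2r// -lee_fin fineK.
      by rewrite EFinD EFinM.
    rewrite ge0_fin_numE ?integral_ge0//; apply: le_lt_trans h _.
    by rewrite -EFinM -EFinD ltry.
  - exact: cvg_cst.
  - have binv : (fun n => (b n)^-1) @ \oo --> 0.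
      apply/gtr0_cvgV0; first by near=> n; apply: b0; near: n; exact: nbhs_infty_ge.
      apply/cvgryPge => A; move/cvgryPge : aoo => /(_ (A ^+ 2)) h; near=> n.
      apply: le_trans (ler_norm A) _; rewrite -sqrtr_sqr ler_wsqrtr//.
      by near: n.
    have h : (fun n => C1 * (b n)^-1 + C2 * fine (S n * ((b n)^-1)%:E)%E) @ \oo -->
        C1 * 0 + C2 * 0.
      by apply: cvgD; apply: cvgMr.
    by rewrite !mulr0 addr0 in h.
move=> H mH PH f cf bf.
have clt := total_stable_clt Gsub Gmono mN mlam lam0 N_mgf N0 ang and_ aoo v0
  comp_le comp_cvg comp_error cf bf mH.
have PH0 : 0 < fine (P H) by rewrite -lte_fin fineK// fin_num_measure.
rewrite /cexp_ev integral_cst// fineM ?fin_num_measure//=.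
apply: cvgMl; apply: cvg_trans clt; apply: near_eq_cvg; near=> n.
have n2 : (2 <= n)%N by near: n; exact: nbhs_infty_ge.
rewrite /Rintegral; congr fine; apply/esym/ae_eq_integral_any => //.
  apply/measurable_EFinP; apply: measurable_funTS.
  apply: measurableT_comp; first exact: continuous_measurable_fun.
  apply: measurable_funM => //; apply: measurable_funB => //.
  exact: (mT_total Gsub Gmono mN).
apply: filterS LE => w LEw _; rewrite LEw /normalized; congr (f _)%:E.
have an := ang _ n2; have sn := b0 _ n2; rewrite -/v -/(b n).
have ab : a_ beta n = b n ^+ 2 by rewrite sqr_sqrtr// ltW.
by rewrite /total ab; field; rewrite gt_eqF.
Unshelve. all: by end_near.
Qed.
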